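(* Let $x$ be a complex number with $0<|x|<1$, and set $z={}_2F_1\left(\frac12,\frac12;1;x\right)$, $y=\pi\,\frac{{}_2F_1\left(\frac12,\frac12;1;1-x\right)}{{}_2F_1\left(\frac12,\frac12;1;x\right)}$ and $q=e^{-y}$. Then $$\mathcal{P}(q)=z^2(1-x)+4x(1-x)z\frac{dz}{dx},$$ $$\mathcal{E}(q)=z^2(1+x),$$ $$\mathcal{Q}(q)=z^4(1-x)^2.$$
   Context: For $s,n\in\mathbb{N}$ (positive integers), $\widetilde{\sigma}_s(n)=\sum_{d\mid n}(-1)^{d-1}d^s$ and $\widehat{\sigma}_s(n)=\sum_{d\mid n}(-1)^{\frac nd-1}d^s$; write $\widetilde{\sigma}=\widetilde{\sigma}_1$, $\widehat{\sigma}=\widehat{\sigma}_1$. For $|q|<1$, $$\mathcal{P}(q)=1+8\sum_{n=1}^\infty\widetilde{\sigma}(n)q^n,\quad \mathcal{E}(q)=1+24\sum_{n=1}^\infty\widehat{\sigma}(n)q^n,\quad \mathcal{Q}(q)=1-16\sum_{n=1}^\infty\widetilde{\sigma}_3(n)q^n.$$ ${}_2F_1$ is the Gaussian hypergeometric function, with ${}_2F_1\left(\frac12,\frac12;1;1-x\right)$ given by the principal branch of its analytic continuation; for real $x\in(-1,0)$, where $1-x$ lies on the branch cut, either boundary value may be used, since they change $y$ only by an integer multiple of $2\pi i$ and leave $q$ unchanged. $z$ is regarded as a function of $x$, and $dz/dx$ is its derivative. *)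

(* Defs.v *)
From Stdlib Require Export Reals ZArith List.
From Coquelicot Require Export Coquelicot.
Export ListNotations.

(** ** Complex series, exponential, analyticity *)

(** Meaningful only when [a] is summable. *)
Definition CSeries (a : nat -> C) : C :=
  iota (T := C_CompleteNormedModule) (is_series (V := C_NormedModule) a).

Definition Cexp (z : C) : C :=
  ((exp (Re z) * cos (Im z))%R, (exp (Re z) * sin (Im z))%R).

Definition analytic_at (F : C -> C) (w : C) : Prop :=
  exists (a : nat -> C) (r : R), (0 < r)%R /\
    forall h : C, (Cmod h < r)%R ->
      is_series (V := C_NormedModule) (fun n => (a n * h ^ n)%C) (F (w + h)%C).

(** ** The Gaussian hypergeometric function *)

Fixpoint pochhammer (a : C) (n : nat) : C :=
  match n with
  | O => 1%C
  | S m => (pochhammer a m * (a + INR m))%C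
  end.

Definition hyp2F1 (a b c x : C) : C :=
  CSeries (fun n =>
    (pochhammer a n * pochhammer b n / (pochhammer c n * INR (fact n)) * x ^ n)%C).

Definition on_cut (w : C) : Prop := Im w = 0%R /\ (1 <= Re w)%R.

(** The slit plane is connected, so at most one function up to its values on
    the cut satisfies this; those values are left unspecified. *)
Definition hyp2F1_principal_branch (a b c : C) (F : C -> C) : Prop :=
  (forall w : C, ~ on_cut w -> analytic_at F w) /\
  (forall w : C, (Cmod w < 1)%R -> F w = hyp2F1 a b c w).

(** On the cut, either of the two one-sided boundary values is allowed. *)
Definition branch_value (F : C -> C) (w v : C) : Prop :=
  (~ on_cut w /\ v = F w) \/
  (on_cut w /\
    (filterlim F (within (fun u : C => (0 < Im u)%R) (locally w)) (locally v) \/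
     filterlim F (within (fun u : C => (Im u < 0)%R) (locally w)) (locally v))).

(** ** Divisor sums and the series [P], [E], [Q] *)

Definition divisors (n : nat) : list nat :=
  filter (fun d => Nat.eqb (Nat.modulo n d) 0) (seq 1 n).

Definition Zsum (l : list Z) : Z := fold_right Z.add 0%Z l.

Definition sigma_tilde (s n : nat) : Z :=
  Zsum (map (fun d => ((-1) ^ Z.of_nat (d - 1) * Z.of_nat d ^ Z.of_nat s)%Z)
            (divisors n)).

Definition sigma_hat (s n : nat) : Z :=
  Zsum (map (fun d => ((-1) ^ Z.of_nat (n / d - 1) * Z.of_nat d ^ Z.of_nat s)%Z)
            (divisors n)).

(** These are meaningful for [Cmod q < 1]. The sums run over positive
    integers, here written [S n]. *)
Definition Pfun (q : C) : C :=
  (1 + 8 * CSeries (fun n => IZR (sigma_tilde 1 (S n)) * q ^ S n))%C.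

Definition Efun (q : C) : C :=
  (1 + 24 * CSeries (fun n => IZR (sigma_hat 1 (S n)) * q ^ S n))%C.

Definition Qfun (q : C) : C :=
  (1 - 16 * CSeries (fun n => IZR (sigma_tilde 3 (S n)) * q ^ S n))%C.

(* Main.v *)
(** Put D = q d/dq. Liouville's identity for the even functions m^2, m^4, (-1)^m m^2 and
    (-1)^m m^4 evaluates convolutions of divisor sums, and yields
    [DP = (P^2 - Q)/4], [DE = (EP - Q)/2], [DQ = Q(P - E)]. As a Wronskian computation
    gives x dq/dx = q / ((1 - x) z^2), the operator D becomes x(1-x) z^2 d/dx, and the
    hypergeometric equation shows that the three right-hand sides solve the same system.
    Both solutions agree up to O(x^2) at the regular singular point 0, where the
    linearized system has exponents 0, 0, 1, so a weighted Gronwall argument along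
    the ray from 0 to x forces them to coincide.

    The nome is q = (x/16) exp(s(x)) on the whole disc: the Wronskian constant 1/pi comes
    from Wallis' product, and 16 from Landen's transformation, under which q(x) squares.
    The power series 1/((1-x) z^2) = 1 + x s'(x) has nonnegative coefficients, because
    those of z^2 decrease; hence |q(x)| <= q(|x|) < 1. *)

From Stdlib Require Import Reals Lra Lia ZArith List Permutation FunctionalExtensionality.
Require Import Defs.

Local Open Scope R_scope.

(** The branch [F] is given only by its analyticity and its values on the unit disc. The
    hypergeometric equation therefore has to be carried from the disc to the slit plane by the
    identity theorem. After that, [nome], built from power series alone, replaces [F]: being
    continuous across the cut, it is reached from either boundary value, and the comparison of the
    two solutions needs only [|nome| < 1]. The convolution formulas do not close up by themselves.
    The even function [m^4] brings in [sigma_5], at [q] and at [q^2]. Alternating sums are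
    combinations of [sigma] at [q] and [q^2], so the plain and alternating formulas of lowest weight
    evaluate the same derivative twice; this gives a relation between [sigma_3] and squares, and its
    derivative supplies the equation still missing to eliminate [sigma_5]. Equal values at 0 would
    not determine a solution: replacing [q] by a multiple of [q] gives another solution with the
    same values there. This freedom is the exponent 1, and it is why the constant 16 must be known
    before the linear coefficients can be matched. *)

(** * Continuity and differentiability of complex functions *)

Definition ccont (f : C -> C) (x : C) : Prop :=
  forall eps, 0 < eps -> exists d, 0 < d /\
    forall y, Cmod (y - x)%C < d -> Cmod (f y - f x)%C < eps.

(** Caratheodory's form of the complex derivative: the difference quotient is
    a continuous slope function, which makes the calculus rules algebraic. *)
Definition cder (f : C -> C) (x l : C) : Prop :=
  exists (phi : C -> C) (d : R), 0 < d /\ ccont phi x /\ phi x = l /\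
    forall y, Cmod (y - x)%C < d -> (f y - f x = phi y * (y - x))%C.

Lemma Cmod_minus_sym x y : Cmod (x - y)%C = Cmod (y - x)%C.
Proof. rewrite <- Cmod_opp. f_equal. ring. Qed.

Lemma Cmod_le_minus_add x y : Cmod x <= Cmod (x - y)%C + Cmod y.
Proof. replace x with ((x - y) + y)%C at 1 by ring. apply Cmod_triangle. Qed.

Lemma Cmod_small_eq x y : (forall eps, 0 < eps -> Cmod (x - y)%C < eps) -> x = y.
Proof.
  intros H. apply Ceq_minus. apply Cmod_eq_0.
  destruct (Cmod_ge_0 (x - y)%C) as [h | h]; [| now symmetry].
  specialize (H _ h). lra.
Qed.

Lemma ccont_const k x : ccont (fun _ => k) x.
Proof.
  intros eps he. exists 1. split; [lra|]. intros y _.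
  replace (k - k)%C with (RtoC 0) by ring. rewrite Cmod_0. exact he.
Qed.

Lemma ccont_id x : ccont (fun y => y) x.
Proof. intros eps he. exists eps. auto. Qed.

Lemma ccont_add f g x : ccont f x -> ccont g x -> ccont (fun y => f y + g y)%C x.
Proof.
  intros hf hg eps he.
  destruct (hf (eps / 2)) as [d1 [h1 H1]]; [lra|].
  destruct (hg (eps / 2)) as [d2 [h2 H2]]; [lra|].
  exists (Rmin d1 d2). split; [now apply Rmin_glb_lt|]. intros y hy.
  pose proof (Rmin_l d1 d2). pose proof (Rmin_r d1 d2).
  specialize (H1 y ltac:(lra)). specialize (H2 y ltac:(lra)).
  replace (f y + g y - (f x + g x))%C with ((f y - f x) + (g y - g x))%C by ring.
  eapply Rle_lt_trans; [apply Cmod_triangle|]. lra.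
Qed.

Lemma ccont_bounded f x : ccont f x ->
  exists d, 0 < d /\ forall y, Cmod (y - x)%C < d -> Cmod (f y) < Cmod (f x) + 1.
Proof.
  intros hf. destruct (hf 1) as [d [h H]]; [lra|].
  exists d. split; [exact h|]. intros y hy. specialize (H y hy).
  pose proof (Cmod_le_minus_add (f y) (f x)). lra.
Qed.

Lemma ccont_mul f g x : ccont f x -> ccont g x -> ccont (fun y => f y * g y)%C x.
Proof.
  intros hf hg eps he.
  destruct (ccont_bounded g x hg) as [d0 [h0 H0]].
  pose proof (Cmod_ge_0 (f x)) as pf. pose proof (Cmod_ge_0 (g x)) as pg.
  destruct (hf (eps / 2 / (Cmod (g x) + 1))) as [d1 [h1 H1]].
  { apply Rdiv_lt_0_compat; lra. }
  destruct (hg (eps / 2 / (Cmod (f x) + 1))) as [d2 [h2 H2]].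
  { apply Rdiv_lt_0_compat; lra. }
  exists (Rmin d0 (Rmin d1 d2)). split; [now repeat apply Rmin_glb_lt|]. intros y hy.
  pose proof (Rmin_l d0 (Rmin d1 d2)). pose proof (Rmin_r d0 (Rmin d1 d2)).
  pose proof (Rmin_l d1 d2). pose proof (Rmin_r d1 d2).
  specialize (H0 y ltac:(lra)). specialize (H1 y ltac:(lra)). specialize (H2 y ltac:(lra)).
  replace (f y * g y - f x * g x)%C with ((f y - f x) * g y + f x * (g y - g x))%C by ring.
  eapply Rle_lt_trans; [apply Cmod_triangle|]. rewrite !Cmod_mult.
  assert (A1 : Cmod (f y - f x)%C * Cmod (g y) <= eps / 2 / (Cmod (g x) + 1) * (Cmod (g x) + 1)).
  { apply Rmult_le_compat; try apply Cmod_ge_0; lra. }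
  assert (A2 : Cmod (f x) * Cmod (g y - g x)%C <= Cmod (f x) * (eps / 2 / (Cmod (f x) + 1))).
  { apply Rmult_le_compat_l; lra. }
  assert (A3 : Cmod (f x) * (eps / 2 / (Cmod (f x) + 1)) < eps / 2).
  { apply Rmult_lt_reg_r with (Cmod (f x) + 1); [lra|].
    replace (Cmod (f x) * (eps / 2 / (Cmod (f x) + 1)) * (Cmod (f x) + 1))
      with (Cmod (f x) * (eps / 2)) by (field; lra). nra. }
  replace (eps / 2 / (Cmod (g x) + 1) * (Cmod (g x) + 1)) with (eps / 2) in A1 by (field; lra).
  lra.
Qed.

Lemma ccont_comp f g x : ccont g x -> ccont f (g x) -> ccont (fun y => f (g y)) x.
Proof.
  intros hg hf eps he. destruct (hf eps he) as [d1 [h1 H1]].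
  destruct (hg d1 h1) as [d2 [h2 H2]]. exists d2. split; auto.
Qed.

Lemma ccont_nz f x : ccont f x -> f x <> 0%C ->
  exists d, 0 < d /\ forall y, Cmod (y - x)%C < d -> Cmod (f x) / 2 < Cmod (f y).
Proof.
  intros hf hx. apply Cmod_gt_0 in hx.
  destruct (hf (Cmod (f x) / 2)) as [d [h H]]; [lra|].
  exists d. split; [exact h|]. intros y hy. specialize (H y hy).
  pose proof (Cmod_le_minus_add (f x) (f y)).
  rewrite (Cmod_minus_sym (f x) (f y)) in H0. lra.
Qed.

Lemma ccont_inv f x : ccont f x -> f x <> 0%C -> ccont (fun y => / f y)%C x.
Proof.
  intros hf hx. destruct (ccont_nz f x hf hx) as [d0 [h0 H0]].
  pose proof hx as px. apply Cmod_gt_0 in px.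
  intros eps he.
  destruct (hf (eps * (Cmod (f x) * (Cmod (f x) / 2)))) as [d1 [h1 H1]].
  { apply Rmult_lt_0_compat; [lra|]. apply Rmult_lt_0_compat; lra. }
  exists (Rmin d0 d1). split; [now apply Rmin_glb_lt|]. intros y hy.
  pose proof (Rmin_l d0 d1). pose proof (Rmin_r d0 d1).
  specialize (H0 y ltac:(lra)). specialize (H1 y ltac:(lra)).
  assert (hy0 : f y <> 0%C) by (apply Cmod_gt_0; lra).
  replace (/ f y - / f x)%C with (- ((f y - f x) / (f x * f y)))%C by (field; auto).
  rewrite Cmod_opp, Cmod_div, Cmod_mult by now apply Cmult_neq_0.
  assert (hp : 0 < Cmod (f x) * Cmod (f y)) by (apply Rmult_lt_0_compat; lra).
  apply Rmult_lt_reg_r with (Cmod (f x) * Cmod (f y)); [exact hp|].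
  unfold Rdiv. rewrite Rmult_assoc, Rinv_l, Rmult_1_r by lra.
  eapply Rlt_le_trans; [exact H1|]. apply Rmult_le_compat_l; [lra|].
  apply Rmult_le_compat_l; lra.
Qed.

Lemma ccont_ext_loc f g x d : 0 < d -> (forall y, Cmod (y - x)%C < d -> f y = g y) ->
  ccont f x -> ccont g x.
Proof.
  intros hd he hf eps h. destruct (hf eps h) as [d1 [h1 H1]].
  exists (Rmin d d1). split; [now apply Rmin_glb_lt|]. intros y hy.
  pose proof (Rmin_l d d1). pose proof (Rmin_r d d1).
  rewrite <- (he y) by lra. rewrite <- (he x).
  - apply H1. lra.
  - replace (x - x)%C with (RtoC 0) by ring. rewrite Cmod_0. exact hd.
Qed.

Lemma cder_ccont f x l : cder f x l -> ccont f x.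
Proof.
  intros (phi & d & hd & hc & hl & H).
  apply ccont_ext_loc with (fun y => f x + phi y * (y - x))%C d; [exact hd| |].
  - intros y hy. rewrite <- (H y hy). ring.
  - apply ccont_add; [apply ccont_const|]. apply ccont_mul; [exact hc|].
    apply ccont_add; [apply ccont_id|apply ccont_const].
Qed.

Lemma cder_ext_loc f g x l d : 0 < d -> (forall y, Cmod (y - x)%C < d -> f y = g y) ->
  cder f x l -> cder g x l.
Proof.
  intros hd he (phi & d' & hd' & hc & hl & H).
  exists phi, (Rmin d d'). split; [now apply Rmin_glb_lt|]. repeat split; auto.
  intros y hy. pose proof (Rmin_l d d'). pose proof (Rmin_r d d').
  rewrite <- (he y) by lra. rewrite <- (he x).
  - apply H. lra.
  - replace (x - x)%C with (RtoC 0) by ring. rewrite Cmod_0. exact hd.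
Qed.

Lemma cder_ext f g x l : (forall y, f y = g y) -> cder f x l -> cder g x l.
Proof. intros he. apply cder_ext_loc with 1; [lra|auto]. Qed.

Lemma cder_eq f x l l' : cder f x l -> l = l' -> cder f x l'.
Proof. now intros h <-. Qed.

Lemma cder_const k x : cder (fun _ => k) x 0%C.
Proof.
  exists (fun _ => RtoC 0), 1. split; [lra|]. split; [apply ccont_const|].
  split; [reflexivity|]. intros; cbv beta; ring.
Qed.

Lemma cder_id x : cder (fun y => y) x 1%C.
Proof.
  exists (fun _ => RtoC 1), 1. split; [lra|]. split; [apply ccont_const|].
  split; [reflexivity|]. intros; cbv beta; ring.
Qed.

Lemma cder_add f g x l m : cder f x l -> cder g x m -> cder (fun y => f y + g y)%C x (l + m)%C.
Proof.
  intros (p & d & hd & hc & hl & H) (p' & d' & hd' & hc' & hl' & H').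
  exists (fun y => p y + p' y)%C, (Rmin d d'). split; [now apply Rmin_glb_lt|].
  split; [now apply ccont_add|]. split; [congruence|].
  intros y hy. pose proof (Rmin_l d d'). pose proof (Rmin_r d d').
  specialize (H y ltac:(lra)). specialize (H' y ltac:(lra)).
  replace (f y + g y - (f x + g x))%C with ((f y - f x) + (g y - g x))%C by ring.
  rewrite H, H'. ring.
Qed.

Lemma cder_mul f g x l m : cder f x l -> cder g x m ->
  cder (fun y => f y * g y)%C x (l * g x + f x * m)%C.
Proof.
  intros hf hg. pose proof (cder_ccont _ _ _ hg) as cg.
  destruct hf as (p & d & hd & hc & hl & H), hg as (p' & d' & hd' & hc' & hl' & H').
  exists (fun y => p y * g y + f x * p' y)%C, (Rmin d d'). split; [now apply Rmin_glb_lt|].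
  split; [apply ccont_add; apply ccont_mul; auto using ccont_const|]. split; [congruence|].
  intros y hy. pose proof (Rmin_l d d'). pose proof (Rmin_r d d').
  specialize (H y ltac:(lra)). specialize (H' y ltac:(lra)).
  replace (f y * g y - f x * g x)%C with ((f y - f x) * g y + f x * (g y - g x))%C by ring.
  rewrite H, H'. ring.
Qed.

Lemma cder_comp f g x l m : cder g x m -> cder f (g x) l ->
  cder (fun y => f (g y)) x (l * m)%C.
Proof.
  intros hg hf. pose proof (cder_ccont _ _ _ hg) as cg.
  destruct hf as (p & d & hd & hc & hl & H), hg as (p' & d' & hd' & hc' & hl' & H').
  destruct (cg d hd) as [d2 [h2 H2]].
  exists (fun y => p (g y) * p' y)%C, (Rmin d2 d'). split; [now apply Rmin_glb_lt|].
  split; [apply ccont_mul; auto; now apply ccont_comp|]. split; [congruence|].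
  intros y hy. pose proof (Rmin_l d2 d'). pose proof (Rmin_r d2 d').
  rewrite H by (apply H2; lra). rewrite H' by lra. ring.
Qed.

Lemma cder_opp f x l : cder f x l -> cder (fun y => - f y)%C x (- l)%C.
Proof.
  intros h. apply cder_ext with (fun y => (- (1)) * f y)%C; [intros; cbv beta; ring|].
  eapply cder_eq; [apply cder_mul; [apply cder_const|exact h]|]. cbv beta. ring.
Qed.

Lemma cder_sub f g x l m : cder f x l -> cder g x m -> cder (fun y => f y - g y)%C x (l - m)%C.
Proof. intros hf hg. apply cder_add; [exact hf|]. now apply cder_opp. Qed.

Lemma cder_inv f x l : cder f x l -> f x <> 0%C ->
  cder (fun y => / f y)%C x (- l / (f x) ^ 2)%C.
Proof.
  intros hf h0. pose proof (cder_ccont _ _ _ hf) as cf.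
  destruct (ccont_nz f x cf h0) as [d0 [hd0 H0]].
  destruct hf as (p & d & hd & hc & hl & H).
  exists (fun y => - (p y * / f y * / f x))%C, (Rmin d0 d). split; [now apply Rmin_glb_lt|].
  split.
  { apply ccont_ext_loc with (fun y => (- (1)) * (p y * / f y * / f x))%C 1; [lra|intros; cbv beta; ring|].
    apply ccont_mul; [apply ccont_const|]. apply ccont_mul; [|apply ccont_const].
    apply ccont_mul; [exact hc|]. now apply ccont_inv. }
  split; [rewrite hl; field; auto|].
  intros y hy. pose proof (Rmin_l d0 d). pose proof (Rmin_r d0 d).
  specialize (H0 y ltac:(lra)). specialize (H y ltac:(lra)).
  assert (hy0 : f y <> 0%C).
  { apply Cmod_gt_0. pose proof (Cmod_ge_0 (f x)). lra. }
  replace (/ f y - / f x)%C with (- ((f y - f x) / (f x * f y)))%C by (field; auto).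
  rewrite H. field; auto.
Qed.

Lemma cder_div f g x l m : cder f x l -> cder g x m -> g x <> 0%C ->
  cder (fun y => f y / g y)%C x ((l * g x - f x * m) / (g x) ^ 2)%C.
Proof.
  intros hf hg h0. eapply cder_eq.
  - apply cder_mul; [exact hf|]. apply cder_inv; [exact hg|exact h0].
  - cbv beta. field; auto.
Qed.

Lemma cder_sqr f x l : cder f x l -> cder (fun y => f y ^ 2)%C x (2 * f x * l)%C.
Proof.
  intros h. apply cder_ext with (fun y => f y * f y)%C; [intros; cbv beta; ring|].
  eapply cder_eq; [apply cder_mul; exact h|]. ring.
Qed.

Lemma cder_of_eps f x l :
  (forall eps, 0 < eps -> exists d, 0 < d /\ forall y, Cmod (y - x)%C < d ->
     Cmod (f y - f x - l * (y - x))%C <= eps * Cmod (y - x)%C) ->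
  cder f x l.
Proof.
  intros H.
  (* The slope is the difference quotient, filled in by [l] at [x]. The factorization then holds for
     every [y], so the radius 1 is arbitrary. *)
  exists (fun y => if Ceq_dec y x then l else (f y - f x) / (y - x))%C, 1.
  split; [lra|]. split; [|split].
  - intros eps he. destruct (H (eps / 2)) as [d [hd Hd]]; [lra|].
    exists d. split; [exact hd|]. intros y hy.
    destruct (Ceq_dec x x) as [_|]; [|congruence].
    destruct (Ceq_dec y x) as [_|ne].
    + replace (l - l)%C with (RtoC 0) by ring. rewrite Cmod_0. exact he.
    + assert (hn : (y - x)%C <> 0%C) by (intro E; apply ne; now apply Ceq_minus).
      specialize (Hd y hy).
      replace ((f y - f x) / (y - x) - l)%C with ((f y - f x - l * (y - x)) / (y - x))%C
        by (field; auto).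
      rewrite Cmod_div by auto. apply Cmod_gt_0 in hn.
      apply Rmult_lt_reg_r with (Cmod (y - x)%C); [exact hn|].
      unfold Rdiv. rewrite Rmult_assoc, Rinv_l, Rmult_1_r by lra. nra.
  - destruct (Ceq_dec x x) as [_|]; congruence.
  - intros y _. destruct (Ceq_dec y x) as [->|ne]; [ring|].
    assert (hn : (y - x)%C <> 0%C) by (intro E; apply ne; now apply Ceq_minus).
    field; auto.
Qed.

Lemma cder_of_quadratic f x l K d : 0 < d ->
  (forall y, Cmod (y - x)%C < d -> Cmod (f y - f x - l * (y - x))%C <= K * Cmod (y - x)%C ^ 2) ->
  cder f x l.
Proof.
  intros hd H. apply cder_of_eps. intros eps he.
  (* [K] may be zero or negative, and a positive constant is needed to divide by. *)
  set (K' := Rabs K + 1). assert (hK : 0 < K') by (unfold K'; pose proof (Rabs_pos K); lra).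
  exists (Rmin d (eps / K')). split.
  { apply Rmin_glb_lt; [lra|]. now apply Rdiv_lt_0_compat. }
  intros y hy. pose proof (Rmin_l d (eps / K')). pose proof (Rmin_r d (eps / K')).
  eapply Rle_trans; [apply H; lra|]. pose proof (Cmod_ge_0 (y - x)%C) as p.
  assert (K <= K') by (unfold K'; pose proof (Rle_abs K); lra).
  assert (K' * Cmod (y - x)%C <= eps).
  { apply Rle_trans with (K' * (eps / K')); [apply Rmult_le_compat_l; lra|].
    right. field. lra. }
  replace (K * Cmod (y - x)%C ^ 2) with (K * Cmod (y - x)%C * Cmod (y - x)%C) by ring.
  apply Rmult_le_compat_r; [exact p|]. nra.
Qed.

(** [C_derive] takes its limit along the horizontal line through [x], separately for the two
    components; the slope function is continuous along that line in particular. *)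
Lemma cder_C_derive f x l : cder f x l -> C_derive f x = l.
Proof.
  intros (phi & d & hd & hc & <- & H). unfold C_derive, C_lim.
  assert (key : forall eps, 0 < eps -> exists del : posreal, forall t : R,
    Rabs (t - fst x) < del -> t <> fst x ->
    Cmod ((f (t, snd x) - f x) / ((t, snd x) - x) - phi x)%C < eps).
  { intros eps he. destruct (hc eps he) as [d1 [h1 H1]].
    assert (h : 0 < Rmin d d1) by now apply Rmin_glb_lt.
    exists (mkposreal _ h). cbn [pos]. intros t ht hne.
    pose proof (Rmin_l d d1). pose proof (Rmin_r d d1).
    assert (E : ((t, snd x) - x)%C = RtoC (t - fst x)).
    { destruct x as [x1 x2]. unfold Cminus, Cplus, Copp, RtoC; simpl. f_equal; ring. }
    assert (E' : Cmod ((t, snd x) - x)%C = Rabs (t - fst x)) by (rewrite E; apply Cmod_R).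
    rewrite (H (t, snd x)) by (rewrite E'; lra).
    assert (hn : ((t, snd x) - x)%C <> 0%C).
    { rewrite E. intro E2. apply RtoC_inj in E2. lra. }
    replace (phi (t, snd x) * ((t, snd x) - x) / ((t, snd x) - x) - phi x)%C
      with (phi (t, snd x) - phi x)%C by (field; auto).
    apply H1. rewrite E'. lra. }
  rewrite (surjective_pairing (phi x)). f_equal.
  - transitivity (real (Finite (fst (phi x)))); [|reflexivity].
    f_equal. apply is_lim_unique. apply is_lim_spec. intros [eps he].
    destruct (key eps he) as [del Hd]. exists del. intros t ht hne. cbn.
    eapply Rle_lt_trans; [|apply (Hd t ht hne)].
    eapply Rle_trans; [|apply re_le_Cmod]. right. reflexivity.
  - transitivity (real (Finite (snd (phi x)))); [|reflexivity].
    f_equal. apply is_lim_unique. apply is_lim_spec. intros [eps he].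
    destruct (key eps he) as [del Hd]. exists del. intros t ht hne. cbn.
    eapply Rle_lt_trans; [|apply (Hd t ht hne)].
    eapply Rle_trans; [|apply Rmax_Cmod]. eapply Rle_trans; [|apply Rmax_r].
    right. reflexivity.
Qed.

Lemma cder_unique f x l m : cder f x l -> cder f x m -> l = m.
Proof. intros h1 h2. rewrite <- (cder_C_derive _ _ _ h1). now apply cder_C_derive. Qed.

Lemma im_le_Cmod c : Rabs (Im c) <= Cmod c.
Proof. eapply Rle_trans; [|apply Rmax_Cmod]. apply Rmax_r. Qed.

(** Passage to real functions of a real parameter, to which the mean value theorem and the Gronwall
    estimate apply. *)
Lemma cder_line f a b r l : cder f (a + RtoC r * b)%C l ->
  is_derive (fun t : R => Re (f (a + RtoC t * b)%C)) r (Re (l * b)%C) /\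
  is_derive (fun t : R => Im (f (a + RtoC t * b)%C)) r (Im (l * b)%C).
Proof.
  intros h.
  assert (hg : cder (fun t => f (a + t * b)%C) (RtoC r) (l * b)%C).
  { apply (cder_comp f (fun t => a + t * b)%C); [|exact h].
    eapply cder_eq; [apply cder_add; [apply cder_const|apply cder_mul; [apply cder_id|apply cder_const]]|].
    cbv beta. ring. }
  destruct hg as (phi & d & hd & hc & <- & H).
  assert (key : forall eps, 0 < eps -> exists del : posreal, forall t : R,
    t <> 0 -> Rabs t < del ->
    Cmod (RtoC (/ t) * (f (a + RtoC (r + t) * b) - f (a + RtoC r * b)) - phi (RtoC r))%C < eps).
  { intros eps he. destruct (hc eps he) as [d1 [h1 H1]].
    assert (h0 : 0 < Rmin d d1) by now apply Rmin_glb_lt.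
    exists (mkposreal _ h0). cbn [pos]. intros t hne ht.
    pose proof (Rmin_l d d1). pose proof (Rmin_r d d1).
    assert (E : (RtoC (r + t) - RtoC r)%C = RtoC t).
    { rewrite <- RtoC_minus. f_equal. ring. }
    rewrite (H (RtoC (r + t))) by (rewrite E, Cmod_R; lra).
    rewrite E.
    replace (RtoC (/ t) * (phi (RtoC (r + t)) * RtoC t) - phi (RtoC r))%C
      with (phi (RtoC (r + t)) - phi (RtoC r))%C.
    { apply H1. rewrite E, Cmod_R. lra. }
    rewrite RtoC_inv by auto. field. intro E2. apply RtoC_inj in E2. auto. }
  split; apply is_derive_Reals; intros eps he; destruct (key eps he) as [del Hd];
    exists del; intros t hne ht; eapply Rle_lt_trans; try apply (Hd t hne ht).
  - eapply Rle_trans; [|apply re_le_Cmod]. right. f_equal.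
    unfold Re; cbn. field. auto.
  - eapply Rle_trans; [|apply im_le_Cmod]. right. f_equal.
    unfold Im; cbn. field. auto.
Qed.

(** There is no mean value equality for complex values, so it is applied to real and imaginary
    parts. Endpoints need only continuity: for the quotient in [landen_zf] the vanishing of the
    derivative is obtained only away from 0. *)
Lemma cder_const_segment f a b :
  (forall t, 0 <= t <= 1 -> exists l, cder f (a + RtoC t * (b - a))%C l) ->
  (forall t, 0 < t < 1 -> cder f (a + RtoC t * (b - a))%C 0%C) ->
  f b = f a.
Proof.
  intros H1 H2.
  set (g := fun t : R => f (a + RtoC t * (b - a))%C).
  assert (R1 : forall h : R -> R, (forall t, 0 < t < 1 -> is_derive h t 0) ->
    (forall t, 0 <= t <= 1 -> continuity_pt h t) -> h 1 = h 0).
  { intros h hd hc. destruct (MVT_gen h 0 1 (fun _ => 0)) as [c [_ E]].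
    - rewrite Rmin_left, Rmax_right by lra. exact hd.
    - rewrite Rmin_left, Rmax_right by lra. exact hc.
    - lra. }
  assert (C1 : forall (h : R -> R) t l, is_derive h t l -> continuity_pt h t).
  { intros h t l hd. apply continuity_pt_filterlim. apply (ex_derive_continuous h).
    now exists l. }
  assert (E1 : Re (g 1) = Re (g 0)).
  { apply (R1 (fun t => Re (g t))).
    - intros t ht. destruct (cder_line _ _ _ _ _ (H2 t ht)) as [h _].
      replace (Re (0 * (b - a))%C) with 0 in h by (cbn; ring). exact h.
    - intros t ht. destruct (H1 t ht) as [l hl]. destruct (cder_line _ _ _ _ _ hl) as [h _].
      exact (C1 _ _ _ h). }
  assert (E2 : Im (g 1) = Im (g 0)).
  { apply (R1 (fun t => Im (g t))).
    - intros t ht. destruct (cder_line _ _ _ _ _ (H2 t ht)) as [_ h].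
      replace (Im (0 * (b - a))%C) with 0 in h by (cbn; ring). exact h.
    - intros t ht. destruct (H1 t ht) as [l hl]. destruct (cder_line _ _ _ _ _ hl) as [_ h].
      exact (C1 _ _ _ h). }
  assert (E : g 1 = g 0).
  { rewrite (surjective_pairing (g 1)), (surjective_pairing (g 0)). f_equal; assumption. }
  unfold g in E.
  replace (a + RtoC 1 * (b - a))%C with b in E by ring.
  replace (a + RtoC 0 * (b - a))%C with a in E by ring. exact E.
Qed.

(** [ring] does not see through the carriers of Coquelicot's canonical structures. *)
Ltac rring := match goal with |- @eq _ ?x ?y => change (@eq R x y) end; ring.
Ltac cring := cbv beta; match goal with |- @eq _ ?x ?y => change (@eq C x y) end; ring.

(** * Complex series and power series *)

Notation is_cseries := (is_series (V := C_NormedModule)).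

Lemma Re_sum_n (a : nat -> C) n :
  Re (sum_n (G := C_AbelianMonoid) a n) = sum_n (fun k => Re (a k)) n.
Proof.
  induction n as [|n IH].
  - now rewrite !sum_O.
  - rewrite !sum_Sn, <- IH. reflexivity.
Qed.

Lemma Im_sum_n (a : nat -> C) n :
  Im (sum_n (G := C_AbelianMonoid) a n) = sum_n (fun k => Im (a k)) n.
Proof.
  induction n as [|n IH].
  - now rewrite !sum_O.
  - rewrite !sum_Sn, <- IH. reflexivity.
Qed.

Lemma is_cseries_parts (a : nat -> C) (l : C) :
  is_cseries a l <-> is_series (fun n => Re (a n)) (Re l) /\ is_series (fun n => Im (a n)) (Im l).
Proof.
  split.
  - intros H. unfold is_series in *.
    pose proof (proj1 (filterlim_locally (U := C_NormedModule) (F := eventually) _ _) H) as H'.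
    clear H.
    split; apply (proj2 (filterlim_locally (U := R_NormedModule) (F := eventually) _ _)); intros eps;
      generalize (H' eps); apply filter_imp; intros n [h1 h2].
    + rewrite <- Re_sum_n. exact h1.
    + rewrite <- Im_sum_n. exact h2.
  - intros [H1 H2]. unfold is_series in *.
    apply (proj2 (filterlim_locally (U := C_NormedModule) (F := eventually) _ _)). intros eps.
    pose proof (proj1 (filterlim_locally (U := R_NormedModule) (F := eventually) _ _) H1 eps) as E1.
    pose proof (proj1 (filterlim_locally (U := R_NormedModule) (F := eventually) _ _) H2 eps) as E2.
    generalize (filter_and _ _ E1 E2).
    apply filter_imp. intros n [h1 h2]. rewrite <- Re_sum_n in h1. rewrite <- Im_sum_n in h2.
    split; assumption.
Qed.

Lemma is_cseries_unique (a : nat -> C) (l : C) : is_cseries a l -> CSeries a = l.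
Proof.
  intros h. unfold CSeries. apply (iota_unique (V := C_CompleteNormedModule)); [|exact h].
  intros y hy. apply is_cseries_parts in h, hy. destruct h as [h1 h2], hy as [y1 y2].
  apply is_series_unique in h1, h2, y1, y2.
  rewrite (surjective_pairing y), (surjective_pairing l).
  change (fst ?c) with (Re c). change (snd ?c) with (Im c). congruence.
Qed.

Lemma is_cseries_ext (a b : nat -> C) (l : C) : (forall n, a n = b n) -> is_cseries a l -> is_cseries b l.
Proof. apply is_series_ext. Qed.

Lemma is_cseries_RtoC (a : nat -> R) (l : R) :
  is_series a l -> is_cseries (fun n => RtoC (a n)) (RtoC l).
Proof.
  intros h. apply is_cseries_parts. split; [exact h|].
  apply is_series_ext with (fun _ => 0); [reflexivity|].
  apply is_series_Reals. intros eps he. exists 0%nat. intros n _.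
  rewrite <- sum_n_Reals, sum_n_const. cbn [Im RtoC snd].
  unfold Rdist. rewrite Rmult_0_r, Rminus_0_r, Rabs_R0. exact he.
Qed.

Lemma is_cseries_add (a b : nat -> C) (la lb : C) : is_cseries a la -> is_cseries b lb ->
  is_cseries (fun n => a n + b n)%C (la + lb)%C.
Proof. exact (is_series_plus (V := C_NormedModule) a b la lb). Qed.

Lemma is_cseries_scal (c : C) (a : nat -> C) (l : C) : is_cseries a l ->
  is_cseries (fun n => c * a n)%C (c * l)%C.
Proof. exact (is_series_scal_l (V := C_NormedModule) c a l). Qed.

Lemma is_cseries_shift (a : nat -> C) (l : C) : is_cseries (fun n => a (S n)) l ->
  is_cseries a (a O + l)%C.
Proof.
  intros h. apply (is_series_decr_1 (V := C_NormedModule)).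
  refine (eq_ind _ (fun u : C => is_cseries (fun n => a (S n)) u) h _ _).
  change (l = (a O + l) + - (a O))%C. ring.
Qed.

Lemma is_cseries_unshift (a : nat -> C) (l : C) : is_cseries a l ->
  is_cseries (fun n => a (S n)) (l - a O)%C.
Proof.
  intros h. apply (is_series_incr_1 (V := C_NormedModule)).
  refine (eq_ind _ (fun u : C => is_cseries a u) h _ _).
  change ((l : C) = (l - a O) + a O)%C. ring.
Qed.

Lemma Re_parts_summable (a : nat -> C) : ex_series (fun n => Cmod (a n)) ->
  ex_series (fun n => Rabs (Re (a n))) /\ ex_series (fun n => Rabs (Im (a n))).
Proof.
  intros h. split.
  - apply (ex_series_le (K := R_AbsRing) (V := R_CompleteNormedModule) _ (fun n => Cmod (a n))); [|exact h].
    intros n. cbn. unfold abs; cbn. rewrite Rabs_Rabsolu. apply re_le_Cmod.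
  - apply (ex_series_le (K := R_AbsRing) (V := R_CompleteNormedModule) _ (fun n => Cmod (a n))); [|exact h].
    intros n. cbn. unfold abs; cbn. rewrite Rabs_Rabsolu. apply im_le_Cmod.
Qed.

Lemma CSeries_correct (a : nat -> C) : ex_series (fun n => Cmod (a n)) -> is_cseries a (CSeries a).
Proof.
  intros h. destruct (Re_parts_summable a h) as [h1 h2].
  apply ex_series_Rabs in h1, h2. destruct h1 as [l1 h1], h2 as [l2 h2].
  assert (H : is_cseries a (l1, l2)) by now apply is_cseries_parts.
  now rewrite (is_cseries_unique _ _ H).
Qed.

Lemma is_cseries_bound (a : nat -> C) (b : nat -> R) (l : C) (s : R) :
  is_cseries a l -> is_series b s -> (forall n, Cmod (a n) <= b n) -> Cmod l <= s.
Proof.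
  intros ha hb hle.
  set (P := fun n => sum_n (G := C_AbelianMonoid) a n).
  assert (B : forall n, Cmod (P n) <= sum_n b n).
  { induction n as [|n IH]; unfold P.
    - rewrite !sum_O. apply hle.
    - rewrite !sum_Sn. eapply Rle_trans; [apply Cmod_triangle|].
      apply Rplus_le_compat; [apply IH|apply hle]. }
  apply Rnot_lt_le. intro hlt.
  (* A quarter of the gap: the partial sums of [a] cost [2 * eps], because balls of [C] are measured
     by components, and those of [b] cost one more [eps]. *)
  set (eps := (Cmod l - s) / 4). assert (he : 0 < eps) by (unfold eps; lra).
  assert (H1 : eventually (fun n => Cmod (P n - l)%C < 2 * eps)).
  { assert (h := proj1 (filterlim_locally (U := C_NormedModule) (F := eventually) _ _) ha (mkposreal _ he)).
    revert h. apply filter_imp. intros n [h1 h2]. change (ball ?x ?e ?y) with (Rabs (y - x) < e) in h1, h2.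
    eapply Rle_lt_trans; [apply Cmod_2Rmax|]. cbn [pos] in h1, h2.
    assert (hm : Rmax (Rabs (fst (P n - l)%C)) (Rabs (snd (P n - l)%C)) < eps).
    { apply Rmax_lub_lt; assumption. }
    assert (hs : sqrt 2 <= 2).
    { rewrite <- (sqrt_square 2) at 2 by lra. apply sqrt_le_1; lra. }
    pose proof (Rmax_l (Rabs (fst (P n - l)%C)) (Rabs (snd (P n - l)%C))).
    pose proof (Rabs_pos (fst (P n - l)%C)).
    apply Rle_lt_trans with (2 * Rmax (Rabs (fst (P n - l)%C)) (Rabs (snd (P n - l)%C))); [|lra].
    apply Rmult_le_compat_r; lra. }
  assert (H2 : eventually (fun n => sum_n b n < s + eps)).
  { assert (h := proj1 (filterlim_locally (U := R_NormedModule) (F := eventually) _ _) hb (mkposreal _ he)).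
    revert h. apply filter_imp. intros n h1. change (Rabs (sum_n b n - s) < eps) in h1.
    apply Rabs_def2 in h1. lra. }
  destruct (filter_and _ _ H1 H2) as [N HN]. destruct (HN N (le_n N)) as [h1 h2].
  specialize (B N). pose proof (Cmod_le_minus_add l (P N)) as h3.
  rewrite Cmod_minus_sym in h3. unfold eps in *. lra.
Qed.

Lemma sum_n_lin (c : R) (u v w : nat -> R) n : (forall k, w k = u k + c * v k) ->
  sum_n u n + c * sum_n v n = sum_n w n.
Proof.
  intros h. induction n as [|n IH].
  - rewrite !sum_O. now rewrite h.
  - rewrite !sum_Sn, <- IH, h. change (plus ?x ?y) with (x + y). rring.
Qed.

Definition cconv (a b : nat -> C) (n : nat) : C :=
  sum_n (G := C_AbelianMonoid) (fun k => a k * b (n - k)%nat)%C n.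

(** The real Cauchy product theorem, applied to the four products of real and imaginary parts. *)
Lemma is_cseries_conv (a b : nat -> C) (la lb : C) :
  is_cseries a la -> is_cseries b lb ->
  ex_series (fun n => Cmod (a n)) -> ex_series (fun n => Cmod (b n)) ->
  is_cseries (cconv a b) (la * lb)%C.
Proof.
  intros ha hb sa sb.
  apply is_cseries_parts in ha, hb. destruct ha as [a1 a2], hb as [b1 b2].
  destruct (Re_parts_summable a sa) as [sa1 sa2]. destruct (Re_parts_summable b sb) as [sb1 sb2].
  apply is_cseries_parts. split.
  - eapply is_series_ext; [|exact (is_series_minus _ _ _ _
      (is_series_mult _ _ _ _ a1 b1 sa1 sb1) (is_series_mult _ _ _ _ a2 b2 sa2 sb2))].
    intros n. unfold cconv. rewrite Re_sum_n, <- !sum_n_Reals.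
    change (minus ?x ?y) with (x - y). change (plus ?x (opp ?y)) with (x - y).
    rewrite <- (sum_n_lin (-1) (fun k => Re (a k) * Re (b (n - k)%nat)) (fun k => Im (a k) * Im (b (n - k)%nat)) (fun k => Re (a k * b (n - k)%nat)%C) n); [rring|].
    intros k. cbn. unfold Re, Im. ring.
  - eapply is_series_ext; [|exact (is_series_plus _ _ _ _
      (is_series_mult _ _ _ _ a1 b2 sa1 sb2) (is_series_mult _ _ _ _ a2 b1 sa2 sb1))].
    intros n. unfold cconv. rewrite Im_sum_n, <- !sum_n_Reals.
    change (plus ?x ?y) with (x + y).
    rewrite <- (sum_n_lin 1 (fun k => Re (a k) * Im (b (n - k)%nat)) (fun k => Im (a k) * Re (b (n - k)%nat)) (fun k => Im (a k * b (n - k)%nat)%C) n); [rring|].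
    intros k. cbn. unfold Re, Im. ring.
Qed.

(** Boundedness below every radius [rho < R] says that the power series with
    coefficients [a] has radius of convergence at least [R], and is stable under
    the operations on coefficients used here. *)
Definition good (R : R) (a : nat -> C) : Prop :=
  forall rho, 0 <= rho < R -> exists M, forall n, Cmod (a n) * rho ^ n <= M.

Definition PS (a : nat -> C) (x : C) : C := CSeries (fun n => a n * x ^ n)%C.

(** [n t^n] is at most [1 + t + ... + t^(n-1)], hence at most [1 / (1 - t)]. *)
Lemma geom_mul_bounded (t : R) : 0 <= t < 1 -> exists M, forall n, INR n * t ^ n <= M.
Proof.
  intros ht. exists (/ (1 - t)).
  assert (H : forall n, INR n * t ^ n * (1 - t) <= 1 - t ^ n).
  { induction n as [|n IH]; [simpl; lra|].
    rewrite S_INR. cbn [pow]. pose proof (pow_le t n (proj1 ht)). pose proof (pos_INR n).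
    assert (t ^ n <= 1) by (rewrite <- (pow1 n); apply pow_incr; lra).
    assert (INR n * t ^ n * (1 - t) * t <= (1 - t ^ n) * t) by (apply Rmult_le_compat_r; lra).
    assert (t * t ^ n <= 1 * 1) by (apply Rmult_le_compat; lra).
    assert (0 <= (1 - t) * (1 - t * t ^ n)) by (apply Rmult_le_pos; lra).
    lra. }
  intros n. apply Rmult_le_reg_r with (1 - t); [lra|]. rewrite Rinv_l by lra.
  specialize (H n). pose proof (pow_le t n (proj1 ht)). lra.
Qed.

Lemma between_radius (r R : R) : 0 <= r < R -> exists r' , r < r' < R /\ 0 < r'.
Proof. intros h. exists ((r + R) / 2). lra. Qed.

(** Boundedness at a radius strictly between [r] and [R] becomes geometric decay at [r]. *)
Lemma good_geom R a r : good R a -> 0 <= r < R ->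
  exists M t, 0 <= M /\ 0 <= t < 1 /\ forall n, Cmod (a n) * r ^ n <= M * t ^ n.
Proof.
  intros hg hr. destruct (between_radius r R hr) as [r' [h1 h2]].
  destruct (hg r') as [M HM]; [lra|]. exists M, (r / r').
  assert (hM : 0 <= M).
  { eapply Rle_trans; [|apply (HM O)]. simpl. rewrite Rmult_1_r. apply Cmod_ge_0. }
  split; [exact hM|]. split.
  - split; [apply Rdiv_le_0_compat; lra|]. apply Rmult_lt_reg_r with r'; [lra|].
    unfold Rdiv. rewrite Rmult_assoc, Rinv_l by lra. lra.
  - intros n. unfold Rdiv at 1. rewrite Rpow_mult_distr, pow_inv. fold (r ^ n / r' ^ n). specialize (HM n).
    pose proof (pow_lt r' n h2). pose proof (pow_le r n (proj1 hr)).
    apply Rle_trans with (Cmod (a n) * r' ^ n * (r ^ n / r' ^ n)).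
    + right. field. lra.
    + apply Rmult_le_compat_r; [|exact HM]. apply Rdiv_le_0_compat; lra.
Qed.

Lemma good_summable R a r : good R a -> 0 <= r < R -> ex_series (fun n => Cmod (a n) * r ^ n).
Proof.
  intros hg hr. destruct (good_geom R a r hg hr) as (M & t & hM & ht & H).
  apply (ex_series_le (K := R_AbsRing) (V := R_CompleteNormedModule) _ (fun n => M * t ^ n)).
  - intros n. cbn. unfold abs; cbn. rewrite Rabs_pos_eq; [apply H|].
    apply Rmult_le_pos; [apply Cmod_ge_0|]. apply pow_le; lra.
  - apply (ex_series_scal_l (V := R_NormedModule)). apply ex_series_geom. rewrite Rabs_pos_eq; lra.
Qed.

Lemma good_abs_summable R a x : good R a -> Cmod x < R ->
  ex_series (fun n => Cmod (a n * x ^ n)%C).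
Proof.
  intros hg hx. apply ex_series_ext with (fun n => Cmod (a n) * Cmod x ^ n).
  - intros n. now rewrite Cmod_mult, Cmod_pow.
  - apply good_summable with R; [exact hg|]. split; [apply Cmod_ge_0|exact hx].
Qed.

Lemma PS_correct R a x : good R a -> Cmod x < R -> is_cseries (fun n => a n * x ^ n)%C (PS a x).
Proof. intros hg hx. apply CSeries_correct. now apply good_abs_summable with R. Qed.

Lemma PS_ext a b x : (forall n, a n = b n) -> PS a x = PS b x.
Proof.
  intros h. f_equal. now apply functional_extensionality.
Qed.

Lemma good_ext R a b : (forall n, a n = b n) -> good R a -> good R b.
Proof.
  intros h hg rho hr. destruct (hg rho hr) as [M H]. exists M. intros n. now rewrite <- h.
Qed.

Lemma good_bounded a M : (forall n, Cmod (a n) <= M) -> good 1 a.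
Proof.
  intros h rho hr. exists M. intros n. rewrite <- (Rmult_1_r M).
  pose proof (pow_le rho n (proj1 hr)).
  assert (rho ^ n <= 1) by (rewrite <- (pow1 n); apply pow_incr; lra).
  apply Rmult_le_compat; auto using Cmod_ge_0.
Qed.

Lemma good_add R a b : good R a -> good R b -> good R (fun n => a n + b n)%C.
Proof.
  intros ha hb rho hr. destruct (ha rho hr) as [M H], (hb rho hr) as [M' H'].
  exists (M + M'). intros n. specialize (H n). specialize (H' n).
  pose proof (pow_le rho n (proj1 hr)). pose proof (Cmod_triangle (a n) (b n)). nra.
Qed.

Lemma good_scal R c a : good R a -> good R (fun n => c * a n)%C.
Proof.
  intros ha rho hr. destruct (ha rho hr) as [M H].
  exists (Cmod c * M). intros n. rewrite Cmod_mult, Rmult_assoc.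
  apply Rmult_le_compat_l; [apply Cmod_ge_0|apply H].
Qed.

Lemma good_INR R a : good R a -> good R (fun n => RtoC (INR n) * a n)%C.
Proof.
  intros ha rho hr. destruct (good_geom R a rho ha hr) as (M & t & hM & ht & H).
  destruct (geom_mul_bounded t ht) as [K HK]. exists (M * K). intros n.
  rewrite Cmod_mult, Cmod_R, (Rabs_pos_eq (INR n)) by apply pos_INR.
  rewrite Rmult_assoc. apply Rle_trans with (INR n * (M * t ^ n)).
  - apply Rmult_le_compat_l; [apply pos_INR|apply H].
  - replace (INR n * (M * t ^ n)) with (M * (INR n * t ^ n)) by ring.
    apply Rmult_le_compat_l; [exact hM|apply HK].
Qed.

Lemma good_unshift R a : good R a -> good R (fun n => a (S n)).
Proof.
  intros ha rho hr. destruct (between_radius rho R hr) as [r' [h1 h2]].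
  destruct (ha r') as [M H]; [lra|]. exists (M / r'). intros n. specialize (H (S n)).
  apply Rmult_le_reg_r with r'; [exact h2|].
  unfold Rdiv. rewrite (Rmult_assoc M), Rinv_l, Rmult_1_r by lra.
  eapply Rle_trans; [|exact H]. cbn [pow].
  rewrite (Rmult_comm r'), <- Rmult_assoc. apply Rmult_le_compat_r; [lra|].
  apply Rmult_le_compat_l; [apply Cmod_ge_0|]. apply pow_incr. lra.
Qed.

Lemma good_shift R a : good R (fun n => a (S n)) -> good R a.
Proof.
  intros ha rho hr. destruct (ha rho hr) as [M H].
  exists (Rmax (Cmod (a O)) (M * rho)). intros [|n].
  - simpl. rewrite Rmult_1_r. apply Rmax_l.
  - eapply Rle_trans; [|apply Rmax_r]. cbn [pow].
    replace (Cmod (a (S n)) * (rho * rho ^ n)) with (Cmod (a (S n)) * rho ^ n * rho) by ring.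
    apply Rmult_le_compat_r; [lra|apply H].
Qed.

(** At an intermediate radius [r'] each of the [n + 1] summands is at most [Ma * Mb]; the factor
    [n + 1] is absorbed by [(rho / r') ^ n]. *)
Lemma good_conv R a b : good R a -> good R b -> good R (cconv a b).
Proof.
  intros ha hb rho hr.
  destruct (between_radius rho R hr) as [r' [h1 h2]].
  destruct (ha r') as [Ma Ha]; [lra|]. destruct (hb r') as [Mb Hb]; [lra|].
  assert (B : forall n, Cmod (cconv a b n) * r' ^ n <= INR (S n) * (Ma * Mb)).
  { intros n. unfold cconv.
    assert (G : forall m, (m <= n)%nat ->
      Cmod (sum_n (G := C_AbelianMonoid) (fun k => a k * b (n - k)%nat)%C m) * r' ^ n
        <= INR (S m) * (Ma * Mb)).
    { assert (T : forall k, (k <= n)%nat -> Cmod (a k * b (n - k)%nat)%C * r' ^ n <= Ma * Mb).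
      { intros k hk. rewrite Cmod_mult. replace (r' ^ n) with (r' ^ k * r' ^ (n - k)).
        - replace (Cmod (a k) * Cmod (b (n - k)%nat) * (r' ^ k * r' ^ (n - k)))
            with ((Cmod (a k) * r' ^ k) * (Cmod (b (n - k)%nat) * r' ^ (n - k))) by ring.
          apply Rmult_le_compat; auto;
            (apply Rmult_le_pos; [apply Cmod_ge_0|apply pow_le; lra]).
        - rewrite <- pow_add. f_equal. lia. }
      induction m as [|m IH]; intros hm.
      - rewrite sum_O. simpl INR. rewrite Rmult_1_l. apply T. exact hm.
      - rewrite sum_Sn, S_INR. pose proof (T (S m) hm). pose proof (IH ltac:(lia)).
        pose proof (pow_lt r' n h2).
        eapply Rle_trans; [apply Rmult_le_compat_r; [lra|apply Cmod_triangle]|].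
        rewrite Rmult_plus_distr_r. lra. }
    apply G. lia. }
  assert (ht : 0 <= rho / r' < 1).
  { split; [apply Rdiv_le_0_compat; lra|]. apply Rmult_lt_reg_r with r'; [lra|].
    unfold Rdiv. rewrite Rmult_assoc, Rinv_l by lra. lra. }
  destruct (geom_mul_bounded _ ht) as [K HK].
  assert (hM : 0 <= Ma * Mb).
  { apply Rmult_le_pos.
    - eapply Rle_trans; [|apply (Ha O)]. simpl. rewrite Rmult_1_r. apply Cmod_ge_0.
    - eapply Rle_trans; [|apply (Hb O)]. simpl. rewrite Rmult_1_r. apply Cmod_ge_0. }
  exists ((Ma * Mb) * (K + 1)). intros n.
  assert (e : rho ^ n = r' ^ n * (rho / r') ^ n).
  { rewrite <- Rpow_mult_distr. f_equal. field. lra. }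
  rewrite e, <- Rmult_assoc.
  assert (h0 : 0 <= (rho / r') ^ n) by (apply pow_le; lra).
  assert (h3 : (rho / r') ^ n <= 1) by (rewrite <- (pow1 n); apply pow_incr; lra).
  apply Rle_trans with (INR (S n) * (Ma * Mb) * (rho / r') ^ n).
  - apply Rmult_le_compat_r; [exact h0|apply B].
  - rewrite S_INR. replace ((INR n + 1) * (Ma * Mb) * (rho / r') ^ n)
      with ((Ma * Mb) * (INR n * (rho / r') ^ n + (rho / r') ^ n)) by ring.
    apply Rmult_le_compat_l; [exact hM|]. specialize (HK n). lra.
Qed.

Lemma PS_add R a b x : good R a -> good R b -> Cmod x < R ->
  PS (fun n => a n + b n)%C x = (PS a x + PS b x)%C.
Proof.
  intros ha hb hx. apply is_cseries_unique.
  eapply is_cseries_ext; [|apply is_cseries_add; eapply PS_correct; eauto].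
  intros n. cbv beta. ring.
Qed.

Lemma PS_scal R c a x : good R a -> Cmod x < R ->
  PS (fun n => c * a n)%C x = (c * PS a x)%C.
Proof.
  intros ha hx. apply is_cseries_unique.
  eapply is_cseries_ext; [|apply is_cseries_scal; eapply PS_correct; eauto].
  intros n. cbv beta. ring.
Qed.

Lemma PS_split R a x : good R a -> Cmod x < R ->
  PS a x = (a O + x * PS (fun n => a (S n)) x)%C.
Proof.
  intros ha hx. apply is_cseries_unique.
  replace (a O) with (a O * x ^ 0)%C by (simpl; ring).
  apply (is_cseries_shift (fun n => a n * x ^ n)%C).
  eapply is_cseries_ext;
    [|apply is_cseries_scal; eapply PS_correct; [apply good_unshift; exact ha|exact hx]].
  intros n. cbn [Cpow]. ring.
Qed.

Lemma PS_conv R a b x : good R a -> good R b -> Cmod x < R ->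
  PS (cconv a b) x = (PS a x * PS b x)%C.
Proof.
  intros ha hb hx. apply is_cseries_unique.
  eapply is_cseries_ext; [|apply is_cseries_conv;
    [apply (PS_correct R); eauto|apply (PS_correct R); eauto|
     apply (good_abs_summable R); eauto|apply (good_abs_summable R); eauto]].
  intros n. unfold cconv.
  enough (G : forall m, (m <= n)%nat ->
    sum_n (G := C_AbelianMonoid) (fun k => a k * x ^ k * (b (n - k)%nat * x ^ (n - k)))%C m =
    (sum_n (G := C_AbelianMonoid) (fun k => a k * b (n - k)%nat)%C m * x ^ n)%C)
    by now apply G.
  assert (E : forall k, (k <= n)%nat -> (x ^ n = x ^ k * x ^ (n - k))%C).
  { intros k hk. replace n with (k + (n - k))%nat at 1 by lia.
    induction k as [|k IHk]; [cbn; ring|]. generalize (n - S k)%nat. intros j.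
    clear. induction (S k) as [|i IHi]; cbn; [ring|]. rewrite IHi. ring. }
  induction m as [|m IH]; intros hm.
  - rewrite !sum_O, Nat.sub_0_r. cbn [Cpow]. cring.
  - rewrite !sum_Sn, IH by lia. change (plus ?u ?v) with (u + v)%C.
    rewrite (E (S m) hm). cring.
Qed.

Lemma PS_bound R a x M : good R a -> 0 <= M < R -> Cmod x <= M ->
  Cmod (PS a x) <= Series (fun n => Cmod (a n) * M ^ n).
Proof.
  intros ha hM hx.
  apply (is_cseries_bound (fun n => a n * x ^ n)%C (fun n => Cmod (a n) * M ^ n)).
  - apply PS_correct with R; [exact ha|lra].
  - apply Series_correct. now apply good_summable with R.
  - intros n. rewrite Cmod_mult, Cmod_pow. apply Rmult_le_compat_l; [apply Cmod_ge_0|].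
    apply pow_incr. split; [apply Cmod_ge_0|exact hx].
Qed.

Definition dcoef (a : nat -> C) (n : nat) : C := (RtoC (INR (S n)) * a (S n))%C.

Lemma good_dcoef R a : good R a -> good R (dcoef a).
Proof. intros ha. apply (good_unshift R (fun n => RtoC (INR n) * a n)%C). now apply good_INR. Qed.

(** Second-order remainder of a power, by induction from the first-order bound [D]. The factor [r]
    on the left stands for an exponent [n - 1] on the right, which would be truncated at [n = 0]. *)
Lemma Cpow_taylor (x y : C) (r : R) n : Cmod x <= r -> Cmod y <= r ->
  Cmod (y ^ S n - x ^ S n - RtoC (INR (S n)) * x ^ n * (y - x))%C * r
  <= INR (S n) * INR n * r ^ n * Cmod (y - x)%C ^ 2.
Proof.
  intros hx hy. assert (hr : 0 <= r) by (pose proof (Cmod_ge_0 x); lra).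
  assert (D : forall n, Cmod (y ^ S n - x ^ S n)%C <= INR (S n) * r ^ n * Cmod (y - x)%C).
  { clear n. induction n as [|n IH].
    - cbn. rewrite !Cmult_1_r. lra.
    - replace (y ^ S (S n) - x ^ S (S n))%C with (y * (y ^ S n - x ^ S n) + (y - x) * x ^ S n)%C
        by (cbn [Cpow]; ring).
      eapply Rle_trans; [apply Cmod_triangle|]. rewrite !Cmod_mult, Cmod_pow.
      rewrite (S_INR (S n)). pose proof (Cmod_ge_0 (y - x)%C) as p0. pose proof (Cmod_ge_0 y) as py.
      assert (h1 : Cmod y * Cmod (y ^ S n - x ^ S n)%C <= r * (INR (S n) * r ^ n * Cmod (y - x)%C))
        by (apply Rmult_le_compat; auto using Cmod_ge_0).
      assert (h2 : Cmod x ^ S n <= r ^ S n) by (apply pow_incr; split; [apply Cmod_ge_0|exact hx]).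
      assert (h3 : Cmod (y - x)%C * Cmod x ^ S n <= Cmod (y - x)%C * r ^ S n)
        by (apply Rmult_le_compat_l; assumption).
      cbn [pow] in *. lra. }
  induction n as [|n IH].
  - replace (y ^ 1 - x ^ 1 - RtoC (INR 1) * x ^ 0 * (y - x))%C with (RtoC 0) by (cbn; ring).
    rewrite Cmod_0. simpl. lra.
  - replace (y ^ S (S n) - x ^ S (S n) - RtoC (INR (S (S n))) * x ^ S n * (y - x))%C
      with (x * (y ^ S n - x ^ S n - RtoC (INR (S n)) * x ^ n * (y - x)) +
            (y - x) * (y ^ S n - x ^ S n))%C
      by (rewrite (S_INR (S n)), RtoC_plus; cbn [Cpow]; ring).
    eapply Rle_trans; [apply Rmult_le_compat_r; [exact hr|apply Cmod_triangle]|].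
    rewrite !Cmod_mult, Rmult_plus_distr_r.
    set (T := Cmod (y ^ S n - x ^ S n - RtoC (INR (S n)) * x ^ n * (y - x))%C) in *.
    pose proof (Cmod_ge_0 (y - x)%C) as p0. pose proof (Cmod_ge_0 x) as px.
    assert (pT : 0 <= T) by apply Cmod_ge_0.
    specialize (D n).
    assert (h1 : Cmod x * T * r <= r * (INR (S n) * INR n * r ^ n * Cmod (y - x)%C ^ 2)).
    { rewrite Rmult_assoc. apply Rmult_le_compat; auto. apply Rmult_le_pos; auto. }
    assert (h2 : Cmod (y - x)%C * Cmod (y ^ S n - x ^ S n)%C * r <=
      Cmod (y - x)%C * (INR (S n) * r ^ n * Cmod (y - x)%C) * r).
    { apply Rmult_le_compat_r; [exact hr|]. apply Rmult_le_compat_l; auto. }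
    rewrite (S_INR (S n)). cbn [pow]. cbn [pow] in h1, h2.
    assert (h3 : 0 <= INR (S n) * r ^ n * r * Cmod (y - x)%C ^ 2).
    { repeat apply Rmult_le_pos; auto using pos_INR. apply pow_le; exact hr. simpl; lra. }
    rewrite (S_INR n) in *. cbn [pow] in h3. lra.
Qed.

Lemma cder_PS R a x : good R a -> Cmod x < R -> cder (PS a) x (PS (dcoef a) x).
Proof.
  intros ha hx. destruct (between_radius (Cmod x) R) as [r [h1 h2]].
  { split; [apply Cmod_ge_0|exact hx]. }
  (* Second-derivative coefficients at a radius beyond [Cmod x]: by [Cpow_taylor], the remainder of
     the term of degree [n + 2] is at most [b n * Cmod (y - x) ^ 2]. *)
  set (b := fun n => Cmod (RtoC (INR (S n)) * (RtoC (INR (S (S n))) * a (S (S n))))%C * r ^ n).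
  assert (sb : ex_series b).
  { apply good_summable with R; [|lra].
    apply good_ext with (dcoef (dcoef a)); [reflexivity|]. now apply good_dcoef, good_dcoef. }
  apply cder_of_quadratic with (Series b) (r - Cmod x); [lra|]. intros y hy.
  assert (hyr : Cmod y < r) by (pose proof (Cmod_le_minus_add y x); lra).
  set (t := fun n => (a n * (y ^ n - x ^ n - RtoC (INR n) * x ^ (n - 1) * (y - x)))%C).
  assert (H : is_cseries t (PS a y - PS a x - PS (dcoef a) x * (y - x))%C).
  { assert (e1 : is_cseries (fun n => a n * y ^ n)%C (PS a y)) by (apply PS_correct with R; [exact ha|lra]).
    assert (e2 : is_cseries (fun n => a n * x ^ n)%C (PS a x)) by (apply PS_correct with R; assumption).
    assert (e3 : is_cseries (fun n => RtoC (INR n) * a n * x ^ (n - 1))%C (PS (dcoef a) x)).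
    { replace (PS (dcoef a) x) with (RtoC (INR 0) * a O * x ^ (0 - 1) + PS (dcoef a) x)%C
        by (cbn; ring).
      apply (is_cseries_shift (fun n => RtoC (INR n) * a n * x ^ (n - 1))%C).
      apply is_cseries_ext with (fun n => dcoef a n * x ^ n)%C.
      - intros n. rewrite Nat.sub_succ, Nat.sub_0_r. reflexivity.
      - apply PS_correct with R; [now apply good_dcoef|exact hx]. }
    replace (PS a y - PS a x - PS (dcoef a) x * (y - x))%C
      with ((PS a y + (- (1)) * PS a x) + (- (y - x)) * PS (dcoef a) x)%C by ring.
    eapply is_cseries_ext; [|exact (is_cseries_add _ _ _ _ (is_cseries_add _ _ _ _ e1
       (is_cseries_scal (- (1))%C _ _ e2)) (is_cseries_scal (- (y - x))%C _ _ e3))].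
    intros n. unfold t. cbv beta. ring. }
  (* The remainders of degree 0 and 1 vanish; dropping them aligns the series with [b]. *)
  apply is_cseries_unshift in H. apply is_cseries_unshift in H.
  replace (PS a y - PS a x - PS (dcoef a) x * (y - x) - t O - t 1%nat)%C
    with (PS a y - PS a x - PS (dcoef a) x * (y - x))%C in H by (unfold t; cbn; ring).
  apply (is_cseries_bound _ (fun n => b n * Cmod (y - x)%C ^ 2) _ _ H).
  - apply is_series_scal_r. now apply Series_correct.
  - intros n. unfold t, b. rewrite !Cmod_mult, !Cmod_R, !Rabs_pos_eq by apply pos_INR.
    replace (S (S n) - 1)%nat with (S n) by lia.
    pose proof (Cpow_taylor x y r (S n) ltac:(lra) ltac:(lra)) as HT.
    set (T := Cmod (y ^ S (S n) - x ^ S (S n) - RtoC (INR (S (S n))) * x ^ S n * (y - x))%C) in *.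
    assert (HT' : T <= INR (S (S n)) * INR (S n) * r ^ n * Cmod (y - x)%C ^ 2).
    { apply Rmult_le_reg_r with r; [exact h2|]. cbn [pow] in *. lra. }
    eapply Rle_trans; [apply Rmult_le_compat_l; [apply Cmod_ge_0|exact HT']|].
    right. ring.
Qed.

Lemma ccont_PS R a x : good R a -> Cmod x < R -> ccont (PS a) x.
Proof. intros. eapply cder_ccont, cder_PS; eauto. Qed.

Lemma PS_0 R a : 0 < R -> good R a -> PS a 0%C = a O.
Proof. intros hR ha. rewrite (PS_split R) by (rewrite ?Cmod_0; auto). ring. Qed.

(** * The complex exponential *)

Lemma Cmod_le_parts c : Cmod c <= Rabs (Re c) + Rabs (Im c).
Proof.
  destruct c as [a b]. unfold Cmod, Re, Im; cbn [fst snd].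
  pose proof (Rabs_pos a). pose proof (Rabs_pos b).
  rewrite <- (sqrt_pow2 (Rabs a + Rabs b)) by lra. apply sqrt_le_1_alt.
  rewrite <- (pow2_abs a), <- (pow2_abs b). nra.
Qed.

Lemma Cexp_add x y : Cexp (x + y)%C = (Cexp x * Cexp y)%C.
Proof.
  destruct x as [a b], y as [c d]. unfold Cexp, Cmult; cbn. rewrite exp_plus, cos_plus, sin_plus.
  f_equal; ring.
Qed.

Lemma Cexp_0 : Cexp 0%C = 1%C.
Proof. unfold Cexp; cbn. rewrite exp_0, cos_0, sin_0. unfold RtoC. f_equal; ring. Qed.

Lemma Cmod_Cexp x : Cmod (Cexp x) = exp (Re x).
Proof.
  unfold Cmod, Cexp; cbn [fst snd].
  replace ((exp (Re x) * cos (Im x)) ^ 2 + (exp (Re x) * sin (Im x)) ^ 2)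
    with (exp (Re x) ^ 2 * (Rsqr (sin (Im x)) + Rsqr (cos (Im x)))) by (unfold Rsqr; ring).
  rewrite sin2_cos2, Rmult_1_r. apply sqrt_pow2. left. apply exp_pos.
Qed.

Lemma Cexp_nz x : Cexp x <> 0%C.
Proof. apply Cmod_gt_0. rewrite Cmod_Cexp. apply exp_pos. Qed.

Section ExpEstimates.
Variables a b : R.
(** [g] and [h] are the real and imaginary parts of [Cexp] at [t] times [(a, b)]; [g1] and [h1] are
    their derivatives in [t]. *)
Let g t := exp (t * a) * cos (t * b).
Let g1 t := exp (t * a) * (a * cos (t * b) - b * sin (t * b)).
Let h t := exp (t * a) * sin (t * b).
Let h1 t := exp (t * a) * (a * sin (t * b) + b * cos (t * b)).

Lemma exp_line_le t : 0 <= t <= 1 -> 0 < exp (t * a) <= exp (Rabs a).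
Proof.
  intros ht. split; [apply exp_pos|].
  assert (H : t * a <= Rabs a) by (pose proof (Rle_abs a); pose proof (Rabs_pos a); nra).
  destruct H as [H|H]; [left; now apply exp_increasing|right; now rewrite H].
Qed.

Lemma exp_mult_bound t u B : 0 <= t <= 1 -> Rabs u <= B -> Rabs (exp (t * a) * u) <= exp (Rabs a) * B.
Proof.
  intros ht hu. rewrite Rabs_mult. destruct (exp_line_le t ht).
  apply Rmult_le_compat; auto using Rabs_pos. rewrite Rabs_pos_eq; lra.
Qed.

Lemma trig_comb_bound (p q c s : R) : Rabs c <= 1 -> Rabs s <= 1 -> Rabs (p * c + q * s) <= Rabs p + Rabs q.
Proof.
  intros hc hs. eapply Rle_trans; [apply Rabs_triang|]. rewrite !Rabs_mult.
  pose proof (Rabs_pos p). pose proof (Rabs_pos q). nra.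
Qed.

Lemma cos_abs_le t : Rabs (cos t) <= 1.
Proof. apply Rabs_le. apply COS_bound. Qed.

Lemma sin_abs_le t : Rabs (sin t) <= 1.
Proof. apply Rabs_le. apply SIN_bound. Qed.

Lemma mvt_abs (f f' : R -> R) (t B : R) : 0 <= t <= 1 ->
  (forall s, is_derive f s (f' s)) -> (forall s, 0 <= s <= 1 -> Rabs (f' s) <= B) ->
  Rabs (f t - f 0) <= B * t.
Proof.
  intros ht hd hb. destruct (MVT_gen f 0 t f') as [c [hc E]].
  - intros; apply hd.
  - intros s _. apply continuity_pt_filterlim. apply (ex_derive_continuous f). eexists; apply hd.
  - rewrite Rmin_left, Rmax_right in hc by lra. rewrite E, Rabs_mult, (Rabs_pos_eq (t - 0)) by lra.
    rewrite Rminus_0_r. apply Rmult_le_compat_r; [lra|]. apply hb. lra.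
Qed.

Lemma mvt2_abs (f f1 f2 : R -> R) (B : R) :
  (forall s, is_derive f s (f1 s)) -> (forall s, is_derive f1 s (f2 s)) ->
  (forall s, 0 <= s <= 1 -> Rabs (f2 s) <= B) ->
  Rabs (f 1 - f 0 - f1 0) <= B.
Proof.
  intros d1 d2 hb.
  destruct (MVT_gen f 0 1 f1) as [c [hc E]].
  - intros; apply d1.
  - intros s _. apply continuity_pt_filterlim. apply (ex_derive_continuous f). eexists; apply d1.
  - rewrite Rmin_left, Rmax_right in hc by lra. rewrite E.
    replace (f1 c * (1 - 0) - f1 0) with (f1 c - f1 0) by ring.
    eapply Rle_trans; [apply (mvt_abs f1 f2 c B); auto|].
    assert (0 <= B) by (eapply Rle_trans; [apply Rabs_pos|apply (hb 0); lra]). nra.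
Qed.

Lemma Cexp_quadratic_bound :
  Cmod (Cexp (a, b) - 1 - (a, b))%C <= 4 * exp (Rabs a) * Cmod (a, b) ^ 2.
Proof.
  (* These are the parts of the square of [(a, b)], which appear as coefficients in the second
     derivatives of [g] and [h]; each component contributes 2 to the constant 4. *)
  assert (N : Rabs (a * a - b * b) + Rabs (2 * a * b) <= 2 * Cmod (a, b) ^ 2).
  { unfold Cmod; cbn [fst snd]. rewrite pow2_sqrt by nra.
    unfold Rabs. destruct (Rcase_abs _), (Rcase_abs _); nra. }
  eapply Rle_trans; [apply Cmod_le_parts|].
  assert (G : Rabs (g 1 - g 0 - g1 0) <= exp (Rabs a) * (2 * Cmod (a, b) ^ 2)).
  { apply mvt2_abs with (fun t => exp (t * a) * ((a * a - b * b) * cos (t * b) + (- (2 * a * b)) * sin (t * b))).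
    - intros s. unfold g, g1. auto_derive; [trivial|ring].
    - intros s. unfold g1. auto_derive; [trivial|ring].
    - intros s hs. apply exp_mult_bound; [exact hs|].
      eapply Rle_trans; [apply trig_comb_bound; auto using cos_abs_le, sin_abs_le|].
      rewrite Rabs_Ropp. exact N. }
  assert (H : Rabs (h 1 - h 0 - h1 0) <= exp (Rabs a) * (2 * Cmod (a, b) ^ 2)).
  { apply mvt2_abs with (fun t => exp (t * a) * ((2 * a * b) * cos (t * b) + (a * a - b * b) * sin (t * b))).
    - intros s. unfold h, h1. auto_derive; [trivial|ring].
    - intros s. unfold h1. auto_derive; [trivial|ring].
    - intros s hs. apply exp_mult_bound; [exact hs|].
      eapply Rle_trans; [apply trig_comb_bound; auto using cos_abs_le, sin_abs_le|]. lra. }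
  unfold g, h, g1, h1 in *. rewrite !Rmult_0_l, exp_0, cos_0, sin_0, !Rmult_1_l in *.
  replace (Re (Cexp (a, b) - 1 - (a, b))%C) with (exp a * cos b - 1 - (a * 1 - b * 0)) by (cbn; ring).
  replace (Im (Cexp (a, b) - 1 - (a, b))%C) with (exp a * sin b - 0 - (a * 0 + b * 1)) by (cbn; ring).
  lra.
Qed.
End ExpEstimates.

Lemma Cexp_sub_1_le (h : C) (M : R) : Cmod h <= M ->
  Cmod (Cexp h - 1)%C <= (1 + 4 * exp M * M) * Cmod h.
Proof.
  intros hM. destruct h as [a b]. pose proof (Cexp_quadratic_bound a b) as H.
  pose proof (re_le_Cmod (a, b)) as h1. cbn in h1. pose proof (Cmod_ge_0 (a, b)) as h2.
  assert (e : exp (Rabs a) <= exp M).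
  { destruct (Rle_lt_or_eq_dec (Rabs a) M) as [l| ->]; [lra|left; now apply exp_increasing|lra]. }
  pose proof (exp_pos (Rabs a)).
  replace (Cexp (a, b) - 1)%C with ((Cexp (a, b) - 1 - (a, b)) + (a, b))%C by ring.
  eapply Rle_trans; [apply Cmod_triangle|].
  assert (4 * exp (Rabs a) * Cmod (a, b) ^ 2 <= 4 * exp M * (M * Cmod (a, b))).
  { apply Rmult_le_compat; [lra|apply pow2_ge_0|lra|]. cbn [pow]. rewrite Rmult_1_r.
    apply Rmult_le_compat_r; assumption. }
  lra.
Qed.

Lemma cder_Cexp x : cder Cexp x (Cexp x).
Proof.
  apply cder_of_quadratic with (Cmod (Cexp x) * (4 * exp 1)) 1; [lra|]. intros y hy.
  replace (Cexp y) with (Cexp x * Cexp (y - x))%C by (rewrite <- Cexp_add; f_equal; ring).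
  replace (Cexp x * Cexp (y - x) - Cexp x - Cexp x * (y - x))%C
    with (Cexp x * (Cexp (y - x) - 1 - (y - x)))%C by ring.
  rewrite Cmod_mult, Rmult_assoc. apply Rmult_le_compat_l; [apply Cmod_ge_0|].
  destruct (y - x)%C as [a b]. eapply Rle_trans; [apply Cexp_quadratic_bound|].
  apply Rmult_le_compat_r; [apply pow_le, Cmod_ge_0|]. apply Rmult_le_compat_l; [lra|].
  pose proof (re_le_Cmod (a, b)) as h1. cbn in h1. left. apply exp_increasing. lra.
Qed.

Lemma cder_exp_comp f x l : cder f x l -> cder (fun y => Cexp (f y)) x (Cexp (f x) * l)%C.
Proof. intros h. apply (cder_comp Cexp f); [exact h|apply cder_Cexp]. Qed.

(** * First-order expansions at 0 *)

(** The quadratic error bound is uniform on a fixed disc, not only asymptotic at 0, because the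
    final comparison uses it along the whole ray from 0 to [x]. *)
Definition jet (rho : R) (f : C -> C) (f0 f1 : C) : Prop :=
  exists K, 0 <= K /\ forall x, Cmod x <= rho -> Cmod (f x - f0 - f1 * x)%C <= K * Cmod x ^ 2.

Lemma jet_intro rho f f0 f1 K :
  (forall x, Cmod x <= rho -> Cmod (f x - f0 - f1 * x)%C <= K * Cmod x ^ 2) -> jet rho f f0 f1.
Proof.
  intros H. exists (Rabs K). split; [apply Rabs_pos|]. intros x hx.
  eapply Rle_trans; [now apply H|]. apply Rmult_le_compat_r; [apply pow_le, Cmod_ge_0|apply Rle_abs].
Qed.

Lemma jet_ext rho f g f0 f1 g0 g1 : (forall x, Cmod x <= rho -> f x = g x) -> f0 = g0 -> f1 = g1 ->
  jet rho f f0 f1 -> jet rho g g0 g1.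
Proof.
  intros h <- <- [K [hK H]]. exists K. split; [exact hK|]. intros x hx. rewrite <- h by exact hx.
  now apply H.
Qed.

Lemma jet_const rho c : jet rho (fun _ => c) c 0%C.
Proof.
  apply jet_intro with 0. intros x _. replace (c - c - 0 * x)%C with (RtoC 0) by ring.
  rewrite Cmod_0. lra.
Qed.

Lemma jet_id rho : jet rho (fun x => x) 0%C 1%C.
Proof.
  apply jet_intro with 0. intros x _. replace (x - 0 - 1 * x)%C with (RtoC 0) by ring.
  rewrite Cmod_0. lra.
Qed.

Lemma jet_add rho f g f0 f1 g0 g1 : jet rho f f0 f1 -> jet rho g g0 g1 ->
  jet rho (fun x => f x + g x)%C (f0 + g0)%C (f1 + g1)%C.
Proof.
  intros [K [hK H]] [K' [hK' H']]. apply jet_intro with (K + K'). intros x hx.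
  specialize (H x hx). specialize (H' x hx).
  replace (f x + g x - (f0 + g0) - (f1 + g1) * x)%C
    with ((f x - f0 - f1 * x) + (g x - g0 - g1 * x))%C by ring.
  eapply Rle_trans; [apply Cmod_triangle|]. lra.
Qed.

Lemma jet_near rho f f0 f1 : jet rho f f0 f1 ->
  exists K, 0 <= K /\ forall x, Cmod x <= rho -> Cmod (f x - f0)%C <= K * Cmod x.
Proof.
  intros [K [hK H]]. exists (K * Rabs rho + Cmod f1). split.
  { pose proof (Rabs_pos rho). pose proof (Cmod_ge_0 f1). nra. }
  intros x hx. specialize (H x hx).
  replace (f x - f0)%C with ((f x - f0 - f1 * x) + f1 * x)%C by ring.
  eapply Rle_trans; [apply Cmod_triangle|]. rewrite Cmod_mult.
  pose proof (Cmod_ge_0 x) as p. pose proof (Rle_abs rho).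
  assert (K * Cmod x ^ 2 <= K * Rabs rho * Cmod x).
  { replace (K * Cmod x ^ 2) with (K * Cmod x * Cmod x) by ring.
    apply Rmult_le_compat_r; [exact p|]. apply Rmult_le_compat_l; lra. }
  lra.
Qed.

Lemma jet_mul rho f g f0 f1 g0 g1 : jet rho f f0 f1 -> jet rho g g0 g1 ->
  jet rho (fun x => f x * g x)%C (f0 * g0)%C (f0 * g1 + f1 * g0)%C.
Proof.
  intros hf hg. destruct (jet_near _ _ _ _ hf) as [A [hA HA]].
  destruct (jet_near _ _ _ _ hg) as [B [hB HB]].
  destruct hf as [K [hK H]], hg as [K' [hK' H']].
  apply jet_intro with (A * B + Cmod f0 * K' + Cmod g0 * K). intros x hx.
  specialize (H x hx). specialize (H' x hx). specialize (HA x hx). specialize (HB x hx).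
  replace (f x * g x - f0 * g0 - (f0 * g1 + f1 * g0) * x)%C
    with ((f x - f0) * (g x - g0) + f0 * (g x - g0 - g1 * x) + g0 * (f x - f0 - f1 * x))%C by ring.
  eapply Rle_trans; [apply Cmod_triangle|].
  eapply Rle_trans; [apply Rplus_le_compat_r, Cmod_triangle|]. rewrite !Cmod_mult.
  pose proof (Cmod_ge_0 x) as p.
  assert (Cmod (f x - f0)%C * Cmod (g x - g0)%C <= (A * Cmod x) * (B * Cmod x))
    by (apply Rmult_le_compat; auto using Cmod_ge_0).
  assert (Cmod f0 * Cmod (g x - g0 - g1 * x)%C <= Cmod f0 * (K' * Cmod x ^ 2))
    by (apply Rmult_le_compat_l; auto using Cmod_ge_0).
  assert (Cmod g0 * Cmod (f x - f0 - f1 * x)%C <= Cmod g0 * (K * Cmod x ^ 2))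
    by (apply Rmult_le_compat_l; auto using Cmod_ge_0).
  replace ((A * B + Cmod f0 * K' + Cmod g0 * K) * Cmod x ^ 2) with
    (A * Cmod x * (B * Cmod x) + Cmod f0 * (K' * Cmod x ^ 2) + Cmod g0 * (K * Cmod x ^ 2)) by ring.
  lra.
Qed.

Lemma jet_scal rho c f f0 f1 : jet rho f f0 f1 -> jet rho (fun x => c * f x)%C (c * f0)%C (c * f1)%C.
Proof.
  intros hf. eapply jet_ext; [| | |apply jet_mul; [apply (jet_const rho c)|exact hf]];
    intros; cbv beta; ring.
Qed.

(** The bound [M < R] keeps the inner function in a closed disc inside the disc of convergence,
    where the series left after the linear term is uniformly bounded. *)
Lemma jet_PS_comp R a q q1 rho M : good R a -> 0 <= M < R -> jet rho q 0%C q1 ->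
  (forall x, Cmod x <= rho -> Cmod (q x) <= M) ->
  jet rho (fun x => PS a (q x)) (a O) (a 1%nat * q1)%C.
Proof.
  intros ha hM hq hb.
  set (S2 := Series (fun n => Cmod (a (S (S n))) * M ^ n)).
  destruct (jet_near _ _ _ _ hq) as [B [hB HB]].
  destruct hq as [K [hK H]].
  apply jet_intro with (B ^ 2 * S2 + Cmod (a 1%nat) * K). intros x hx.
  specialize (hb x hx). specialize (H x hx). specialize (HB x hx).
  replace (q x - 0)%C with (q x) in HB by ring.
  rewrite (PS_split R) by (auto; lra). rewrite (PS_split R) by (auto using good_unshift; lra).
  replace (a O + q x * (a 1%nat + q x * PS (fun n => a (S (S n))) (q x)) - a O - a 1%nat * q1 * x)%C
    with (q x ^ 2 * PS (fun n => a (S (S n))) (q x) + a 1%nat * (q x - 0 - q1 * x))%C by ring.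
  eapply Rle_trans; [apply Cmod_triangle|]. rewrite !Cmod_mult, Cmod_pow.
  assert (b2 : Cmod (PS (fun n => a (S (S n))) (q x)) <= S2).
  { apply PS_bound with R; auto. apply (good_unshift R (fun n => a (S n))). now apply good_unshift. }
  assert (Cmod (q x) ^ 2 <= (B * Cmod x) ^ 2) by (apply pow_incr; split; auto using Cmod_ge_0).
  assert (Cmod (q x) ^ 2 * Cmod (PS (fun n => a (S (S n))) (q x)) <= (B * Cmod x) ^ 2 * S2)
    by (apply Rmult_le_compat; auto using Cmod_ge_0; apply pow_le, Cmod_ge_0).
  assert (Cmod (a 1%nat) * Cmod (q x - 0 - q1 * x)%C <= Cmod (a 1%nat) * (K * Cmod x ^ 2))
    by (apply Rmult_le_compat_l; auto using Cmod_ge_0).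
  replace ((B ^ 2 * S2 + Cmod (a 1%nat) * K) * Cmod x ^ 2)
    with ((B * Cmod x) ^ 2 * S2 + Cmod (a 1%nat) * (K * Cmod x ^ 2)) by ring. lra.
Qed.

Lemma jet_PS R a rho : good R a -> 0 <= rho < R -> jet rho (PS a) (a O) (a 1%nat).
Proof.
  intros ha hr. eapply jet_ext; [| | |apply (jet_PS_comp R a (fun x => x) 1%C rho rho ha hr)];
    auto using jet_id; intros; ring.
Qed.

(** * Analytic functions and the identity theorem *)

Lemma bounded_of_is_cseries (a : nat -> C) (l : C) : is_cseries a l ->
  exists M, forall n, Cmod (a n) <= M.
Proof.
  intros h. apply is_cseries_parts in h. destruct h as [h1 h2].
  assert (B : forall u : nat -> R, forall l, is_series u l -> exists M, forall n, Rabs (u n) <= M).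
  { clear. intros u l h. assert (hl : is_lim_seq u 0) by (apply ex_series_lim_0; now exists l).
    apply is_lim_seq_Reals in hl. destruct (maj_by_pos u) as [M [_ HM]]; [now exists 0|].
    exists M. exact HM. }
  destruct (B _ _ h1) as [M1 H1], (B _ _ h2) as [M2 H2]. exists (M1 + M2). intros n.
  eapply Rle_trans; [apply Cmod_le_parts|]. specialize (H1 n). specialize (H2 n). lra.
Qed.

(** Convergence at the real point [rho] makes the terms there bounded, which is the condition
    [good]; so mere convergence on a disc already gives absolute convergence inside it. *)
Lemma analytic_at_PS F w : analytic_at F w <->
  exists a r, 0 < r /\ good r a /\ forall h, Cmod h < r -> F (w + h)%C = PS a h.
Proof.
  split.
  - intros (a & r & hr & H). exists a, r. split; [exact hr|]. split.
    + intros rho hrho.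
      assert (hh : Cmod (RtoC rho) < r) by (rewrite Cmod_R, Rabs_pos_eq; lra).
      destruct (bounded_of_is_cseries _ _ (H _ hh)) as [M HM]. exists M. intros n.
      specialize (HM n). cbv beta in HM. rewrite Cmod_mult, Cmod_pow, Cmod_R, Rabs_pos_eq in HM by lra.
      exact HM.
    + intros h hh. symmetry. apply is_cseries_unique. now apply H.
  - intros (a & r & hr & ha & H). exists a, r. split; [exact hr|]. intros h hh.
    rewrite H by exact hh. now apply PS_correct with r.
Qed.

Lemma good_mono R R' a : R' <= R -> good R a -> good R' a.
Proof. intros h ha rho hr. apply ha. lra. Qed.

Lemma good_zero R : good R (fun _ => 0%C).
Proof. intros rho _. exists 0. intros n. rewrite Cmod_0. lra. Qed.

Lemma PS_zero x : PS (fun _ => 0%C) x = 0%C.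
Proof.
  transitivity (PS (fun _ => 0 * 0)%C x); [apply PS_ext; intros n; ring|].
  rewrite (PS_scal (Cmod x + 1) 0%C (fun _ => 0%C)) by (auto using good_zero; lra). ring.
Qed.

Lemma analytic_const c w : analytic_at (fun _ => c) w.
Proof.
  set (a := fun n : nat => match n with O => c | _ => 0%C end).
  assert (ha : good 1 a) by (apply good_shift, good_zero).
  apply analytic_at_PS. exists a, 1. split; [lra|]. split; [exact ha|]. intros h hh.
  rewrite (PS_split 1 a), (PS_ext (fun n => a (S n)) (fun _ => 0%C)), PS_zero by auto.
  cbn [a]. ring.
Qed.

Lemma analytic_id w : analytic_at (fun x => x) w.
Proof.
  set (a := fun n : nat => match n with O => w | S O => 1%C | _ => 0%C end).
  assert (ha : good 1 a) by (apply good_shift, good_shift, good_zero).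
  apply analytic_at_PS. exists a, 1. split; [lra|]. split; [exact ha|]. intros h hh.
  rewrite (PS_split 1 a), (PS_split 1 (fun n => a (S n))) by auto using good_unshift.
  rewrite (PS_ext (fun n => a (S (S n))) (fun _ => 0%C)), PS_zero by auto. cbn [a]. ring.
Qed.

Lemma analytic_add f g w : analytic_at f w -> analytic_at g w -> analytic_at (fun x => f x + g x)%C w.
Proof.
  rewrite !analytic_at_PS. intros (a & r & hr & ha & H) (b & s & hs & hb & H').
  exists (fun n => a n + b n)%C, (Rmin r s). pose proof (Rmin_l r s). pose proof (Rmin_r r s).
  apply (good_mono _ (Rmin r s)) in ha; [|lra]. apply (good_mono _ (Rmin r s)) in hb; [|lra].
  split; [now apply Rmin_glb_lt|]. split; [now apply good_add|]. intros h hh.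
  rewrite (PS_add (Rmin r s)) by auto. rewrite H, H' by lra. reflexivity.
Qed.

Lemma analytic_mul f g w : analytic_at f w -> analytic_at g w -> analytic_at (fun x => f x * g x)%C w.
Proof.
  rewrite !analytic_at_PS. intros (a & r & hr & ha & H) (b & s & hs & hb & H').
  exists (cconv a b), (Rmin r s). pose proof (Rmin_l r s). pose proof (Rmin_r r s).
  apply (good_mono _ (Rmin r s)) in ha; [|lra]. apply (good_mono _ (Rmin r s)) in hb; [|lra].
  split; [now apply Rmin_glb_lt|]. split; [now apply good_conv|]. intros h hh.
  rewrite (PS_conv (Rmin r s)) by auto. rewrite H, H' by lra. reflexivity.
Qed.

Lemma cder_of_PS_local F w a r h : good r a -> (forall h, Cmod h < r -> F (w + h)%C = PS a h) ->
  Cmod h < r -> cder F (w + h)%C (PS (dcoef a) h).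
Proof.
  intros ha H hh.
  apply cder_ext_loc with (fun y => PS a (y - w)%C) (r - Cmod h); [lra| |].
  - intros y hy. rewrite <- H.
    + f_equal. ring.
    + pose proof (Cmod_le_minus_add (y - w)%C h).
      replace (y - w - h)%C with (y - (w + h))%C in H0 by ring. lra.
  - assert (E : (w + h - w)%C = h) by ring.
    eapply cder_eq.
    + apply (cder_comp (PS a) (fun y => y - w)%C).
      * apply cder_sub; [apply cder_id|apply cder_const].
      * cbv beta. rewrite E. apply cder_PS with r; auto.
    + ring.
Qed.

Lemma analytic_cder F w : analytic_at F w -> cder F w (C_derive F w).
Proof.
  rewrite analytic_at_PS. intros (a & r & hr & ha & H).
  pose proof (cder_of_PS_local F w a r 0%C ha H ltac:(rewrite Cmod_0; exact hr)) as h.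
  replace (w + 0)%C with w in h by ring. now rewrite (cder_C_derive _ _ _ h).
Qed.

Lemma analytic_derive F w : analytic_at F w -> analytic_at (C_derive F) w.
Proof.
  rewrite !analytic_at_PS. intros (a & r & hr & ha & H).
  exists (dcoef a), r. split; [exact hr|]. split; [now apply good_dcoef|]. intros h hh.
  apply cder_C_derive. now apply cder_of_PS_local with r.
Qed.

(** The constant coefficient vanishes by continuity at 0; then the series can be divided by its
    variable and the argument repeated. Zeros on one side of 0 suffice, and continuation along a
    segment provides no more. *)
Lemma PS_one_sided_zero rad n : forall (a : nat -> C) (d : C) (t0 : R), 0 < rad -> good rad a -> d <> 0%C -> 0 < t0 ->
  (forall t, 0 < t < t0 -> PS a (RtoC t * d)%C = 0%C) -> a n = 0%C.
Proof.
  assert (base : forall (a : nat -> C) (d : C) (t0 : R), 0 < rad -> good rad a -> d <> 0%C -> 0 < t0 ->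
    (forall t, 0 < t < t0 -> PS a (RtoC t * d)%C = 0%C) -> a O = 0%C).
  { intros a d t0 hR ha hd ht H.
    apply Cmod_small_eq. intros eps he.
    destruct (ccont_PS rad a 0%C ha ltac:(rewrite Cmod_0; exact hR) eps he) as [del [hdel Hd]].
    pose proof (proj1 (Cmod_gt_0 d) hd) as pd.
    set (t := Rmin (t0 / 2) (del / 2 / Cmod d)).
    assert (h1 : 0 < t) by (apply Rmin_glb_lt; [lra|]; apply Rdiv_lt_0_compat; lra).
    assert (h2 : t <= t0 / 2) by apply Rmin_l.
    assert (h3 : t <= del / 2 / Cmod d) by apply Rmin_r.
    specialize (Hd (RtoC t * d)%C).
    rewrite H, (PS_0 rad) in Hd by (auto; lra).
    rewrite Cmod_minus_sym. apply Hd.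
    replace (RtoC t * d - 0)%C with (RtoC t * d)%C by ring.
    rewrite Cmod_mult, Cmod_R, Rabs_pos_eq by lra.
    apply Rle_lt_trans with (del / 2 / Cmod d * Cmod d); [apply Rmult_le_compat_r; lra|].
    unfold Rdiv. rewrite Rmult_assoc, Rinv_l by lra. lra. }
  induction n as [|n IH]; intros a d t0 hR ha hd ht H; [eapply base; eauto|].
  pose proof (proj1 (Cmod_gt_0 d) hd) as pd.
  apply (IH (fun n => a (S n)) d (Rmin t0 (rad / Cmod d))); auto using good_unshift.
  { apply Rmin_glb_lt; [lra|]. now apply Rdiv_lt_0_compat. }
  pose proof (base a d t0 hR ha hd ht H) as a0.
  intros t h. pose proof (Rmin_l t0 (rad / Cmod d)). pose proof (Rmin_r t0 (rad / Cmod d)).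
  specialize (H t ltac:(lra)). rewrite (PS_split rad), a0 in H.
  - assert (hn : (RtoC t * d)%C <> 0%C).
    { apply Cmult_neq_0; [|exact hd]. intro E. apply RtoC_inj in E. lra. }
    destruct (Ceq_dec (PS (fun n => a (S n)) (RtoC t * d)%C) 0%C) as [e|e]; [exact e|].
    exfalso. apply (Cmult_neq_0 _ _ hn e). rewrite <- H. ring.
  - exact ha.
  - rewrite Cmod_mult, Cmod_R, Rabs_pos_eq by lra.
    apply Rlt_le_trans with (rad / Cmod d * Cmod d); [apply Rmult_lt_compat_r; lra|].
    unfold Rdiv. rewrite Rmult_assoc, Rinv_l; lra.
Qed.

(** Let [T] be the supremum of the parameters up to which [f] vanishes. The expansion at [T] has
    zeros just below [T], so it is identically 0 and [f] vanishes beyond [T] too, unless [T = 1]. *)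
Lemma analytic_segment_zero f a b :
  (forall t, 0 <= t <= 1 -> analytic_at f (a + RtoC t * (b - a))%C) ->
  (exists r, 0 < r /\ forall y, Cmod (y - a)%C < r -> f y = 0%C) -> f b = 0%C.
Proof.
  intros han [r0 [hr0 h0]].
  destruct (Ceq_dec b a) as [->|hne].
  { apply h0. replace (a - a)%C with (RtoC 0) by ring. rewrite Cmod_0. exact hr0. }
  set (d := (b - a)%C) in *. assert (hd : d <> 0%C) by (intro E; apply hne; now apply Ceq_minus).
  pose proof (proj1 (Cmod_gt_0 d) hd) as pd.
  set (E := fun t => 0 <= t <= 1 /\ forall s, 0 <= s <= t -> f (a + RtoC s * d)%C = 0%C).
  assert (small : forall r t, 0 < r -> Rabs t <= r / 2 / Cmod d -> Cmod (RtoC t * d)%C < r).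
  { intros r t hr ht. rewrite Cmod_mult, Cmod_R.
    apply Rle_lt_trans with (r / 2 / Cmod d * Cmod d); [apply Rmult_le_compat_r; lra|].
    unfold Rdiv. rewrite Rmult_assoc, Rinv_l by lra. lra. }
  set (t1 := Rmin 1 (r0 / 2 / Cmod d)).
  assert (ht1 : 0 < t1) by (apply Rmin_glb_lt; [lra|]; apply Rdiv_lt_0_compat; lra).
  assert (Et1 : E t1).
  { pose proof (Rmin_l 1 (r0 / 2 / Cmod d)) as l1. pose proof (Rmin_r 1 (r0 / 2 / Cmod d)) as l2.
    fold t1 in l1, l2. split; [lra|]. intros s hs. apply h0.
    replace (a + RtoC s * d - a)%C with (RtoC s * d)%C by ring. apply small; [exact hr0|].
    rewrite Rabs_pos_eq; lra. }
  destruct (completeness E) as [T [ub lub]].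
  { exists 1. intros t [h _]. lra. }
  { now exists t1. }
  assert (hT1 : t1 <= T) by now apply ub.
  assert (hT : T <= 1) by (apply lub; intros t [h _]; lra).
  assert (below : forall s, 0 <= s < T -> f (a + RtoC s * d)%C = 0%C).
  { intros s hs. destruct (Classical_Prop.classic (exists t, E t /\ s < t)) as [[t [[_ Ht] hst]]|no].
    - apply Ht. lra.
    - exfalso. assert (T <= s); [|lra]. apply lub. intros t ht.
      apply Rnot_lt_le. intro hst. apply no. now exists t. }
  destruct (proj1 (analytic_at_PS _ _) (han T ltac:(lra))) as (c & r & hr & hc & H).
  set (t2 := Rmin T (r / 2 / Cmod d)).
  assert (hr2 : 0 < r / 2 / Cmod d) by (apply Rdiv_lt_0_compat; lra).
  assert (ht2 : 0 < t2) by (apply Rmin_glb_lt; lra).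
  assert (hl1 : t2 <= T) by apply Rmin_l. assert (hl2 : t2 <= r / 2 / Cmod d) by apply Rmin_r.
  assert (c0 : forall n, c n = 0%C).
  (* Zeros are known only for parameters below [T], hence the direction [- d]. *)
  { intros n. apply (PS_one_sided_zero r n c (- d)%C t2); auto.
    - intro e. apply hd. replace d with (- - d)%C by ring. rewrite e. ring.
    - intros t ht. rewrite <- H.
      + replace (a + RtoC T * d + RtoC t * - d)%C with (a + RtoC (T - t) * d)%C
          by (rewrite RtoC_minus; ring).
        apply below. lra.
      + replace (RtoC t * - d)%C with (- (RtoC t * d))%C by ring. rewrite Cmod_opp.
        apply small; [exact hr|]. rewrite Rabs_pos_eq; lra. }
  assert (near : forall s, Rabs (s - T) <= r / 2 / Cmod d -> f (a + RtoC s * d)%C = 0%C).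
  { intros s hs. replace (a + RtoC s * d)%C with (a + RtoC T * d + RtoC (s - T) * d)%C
      by (rewrite RtoC_minus; ring).
    rewrite H by (apply small; auto). rewrite <- (PS_zero (RtoC (s - T) * d)%C).
    apply PS_ext. exact c0. }
  assert (all : forall s, 0 <= s <= T -> f (a + RtoC s * d)%C = 0%C).
  { intros s hs. destruct (Rle_lt_or_eq_dec s T) as [l| ->]; [lra|apply below; lra|].
    apply near. replace (T - T) with 0 by ring. rewrite Rabs_R0. lra. }
  assert (T1 : T = 1).
  { apply Rle_antisym; [exact hT|]. apply Rnot_lt_le. intro hlt.
    set (t3 := Rmin 1 (T + r / 2 / Cmod d)).
    assert (h1 : t3 <= 1) by apply Rmin_l. assert (h2 : t3 <= T + r / 2 / Cmod d) by apply Rmin_r.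
    assert (h3 : T < t3) by (apply Rmin_glb_lt; lra).
    enough (E3 : E t3) by (specialize (ub t3 E3); lra).
    split; [lra|]. intros s hs. destruct (Rle_lt_dec s T) as [l|l]; [apply all; lra|].
    apply near. rewrite Rabs_pos_eq; lra. }
  rewrite <- (all 1) by lra. f_equal. unfold d. ring.
Qed.

(** * The hypergeometric series on the unit disc *)

(** The coefficients of 2F1(1/2,1/2;1;x). *)
Fixpoint acoef (n : nat) : R :=
  match n with
  | O => 1
  | S m => acoef m * ((INR m + 1 / 2) / (INR m + 1)) ^ 2
  end.

Definition zc (n : nat) : C := RtoC (acoef n).
Definition zf : C -> C := PS zc.
Definition zf' : C -> C := PS (dcoef zc).

Lemma acoef_bound n : 0 < acoef n <= 1.
Proof.
  induction n as [|n IH]; [simpl; lra|]. cbn [acoef]. pose proof (pos_INR n).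
  set (t := (INR n + 1 / 2) / (INR n + 1)).
  assert (h : 0 < t <= 1).
  { unfold t. split; [apply Rdiv_lt_0_compat; lra|].
    apply Rmult_le_reg_r with (INR n + 1); [lra|]. unfold Rdiv at 1.
    rewrite Rmult_assoc, Rinv_l; lra. }
  assert (0 < t ^ 2 <= 1) by nra. nra.
Qed.

Lemma acoef_rec n : (INR n + 1) ^ 2 * acoef (S n) = (INR n + 1 / 2) ^ 2 * acoef n.
Proof. cbn [acoef]. pose proof (pos_INR n). field. lra. Qed.

Lemma good_of_real_bounded (a : nat -> R) M : (forall n, 0 <= a n <= M) -> good 1 (fun n => RtoC (a n)).
Proof.
  intros h. apply good_bounded with M. intros n. rewrite Cmod_R, Rabs_pos_eq; apply h.
Qed.

Lemma good_zc : good 1 zc.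
Proof. apply (good_of_real_bounded acoef 1). intros n. pose proof (acoef_bound n). lra. Qed.

Lemma pochhammer_half_coef n :
  (pochhammer (1 / 2) n * pochhammer (1 / 2) n / (pochhammer 1 n * INR (fact n)))%C = zc n.
Proof.
  assert (P1 : forall n, pochhammer 1%C n = RtoC (INR (fact n))).
  { clear n. induction n as [|n IH]; [reflexivity|]. cbn [pochhammer]. rewrite IH.
    change (fact (S n)) with (S n * fact n)%nat.
    rewrite mult_INR, S_INR, RtoC_mult, RtoC_plus. ring. }
  rewrite P1. unfold zc.
  assert (H : forall n, (pochhammer (1 / 2) n * pochhammer (1 / 2) n =
    RtoC (acoef n) * (RtoC (INR (fact n)) * RtoC (INR (fact n))))%C).
  { clear n. induction n as [|n IH]; [cbn; ring|]. cbn [pochhammer].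
    change (fact (S n)) with (S n * fact n)%nat.
    replace (pochhammer (1 / 2) n * (1 / 2 + INR n) * (pochhammer (1 / 2) n * (1 / 2 + INR n)))%C
      with (pochhammer (1 / 2) n * pochhammer (1 / 2) n * ((1 / 2 + INR n) * (1 / 2 + INR n)))%C by ring.
    rewrite IH.
    replace ((1 / 2 + INR n) * (1 / 2 + INR n))%C with (RtoC ((INR n + 1 / 2) ^ 2))
      by (rewrite RtoC_pow, RtoC_plus, RtoC_div by lra; ring).
    rewrite <- !RtoC_mult. f_equal. rewrite mult_INR, S_INR.
    replace (acoef (S n) * ((INR n + 1) * INR (fact n) * ((INR n + 1) * INR (fact n))))
      with ((INR n + 1) ^ 2 * acoef (S n) * (INR (fact n) * INR (fact n))) by ring.
    rewrite acoef_rec. ring. }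
  rewrite H. field. intro E. apply RtoC_inj in E. now apply INR_fact_neq_0 in E.
Qed.

Lemma hyp2F1_zf : hyp2F1 (1 / 2)%C (1 / 2)%C 1%C = zf.
Proof.
  apply functional_extensionality. intros x. apply (PS_ext _ zc). exact pochhammer_half_coef.
Qed.

Lemma cder_zf x : Cmod x < 1 -> cder zf x (zf' x).
Proof. apply cder_PS, good_zc. Qed.

Definition Yf (x : C) : C := (x * (1 - x) * zf' x)%C.

(** Self-adjoint form [(x(1-x)z')' = z/4] of the hypergeometric equation. *)
Lemma cder_Yf x : Cmod x < 1 -> cder Yf x (zf x / 4)%C.
Proof.
  intros hx.
  (* Coefficients of [x (z' - x z')]. Those of its derivative are
     [(n + 1)^2 a_(n+1) - n (n + 1) a_n], which is [a_n / 4] by [acoef_rec]. *)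
  set (m := fun n : nat => match n return C with O => 0%C | S k => (dcoef zc k + (- (1)) * (RtoC (INR k) * zc k))%C end).
  assert (g0 : good 1 (fun k => RtoC (INR k) * zc k)%C) by apply good_INR, good_zc.
  assert (g1 : good 1 (dcoef zc)) by apply good_dcoef, good_zc.
  assert (gm : good 1 m) by (apply good_shift, good_add; [exact g1|now apply good_scal]).
  apply cder_ext_loc with (PS m) (1 - Cmod x); [lra| |].
  - intros y hy. assert (hy1 : Cmod y < 1) by (pose proof (Cmod_le_minus_add y x); lra).
    rewrite (PS_split 1) by auto.
    change (fun n => m (S n)) with (fun k => dcoef zc k + (- (1)) * (RtoC (INR k) * zc k))%C.
    rewrite (PS_add 1) by auto using good_scal. rewrite (PS_scal 1) by auto.
    rewrite (PS_split 1 (fun k => RtoC (INR k) * zc k)%C) by auto.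
    change (fun n => (RtoC (INR (S n)) * zc (S n))%C) with (dcoef zc).
    unfold Yf, zf'. cbn [m INR]. ring.
  - eapply cder_eq; [apply (cder_PS 1); auto|].
    replace (zf x / 4)%C with (/ 4 * zf x)%C by (unfold Cdiv; ring).
    unfold zf. rewrite <- (PS_scal 1) by (auto using good_zc). apply PS_ext. intros n.
    unfold dcoef at 1.
    change (m (S n)) with (dcoef zc n + (- (1)) * (RtoC (INR n) * zc n))%C.
    unfold dcoef, zc. rewrite <- RtoC_inv by lra. rewrite <- !RtoC_opp, <- !RtoC_mult, <- RtoC_plus, <- !RtoC_mult.
    f_equal. pose proof (acoef_rec n) as h. rewrite !S_INR.
    transitivity ((INR n + 1) ^ 2 * acoef (S n) - (INR n + 1) * INR n * acoef n); [ring|].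
    rewrite h. field.
Qed.

(** * The coefficients of the reciprocal of (1 - x) z^2 *)

Lemma sum_f_R0_rev (f : nat -> R) n : sum_f_R0 (fun k => f (n - k)%nat) n = sum_f_R0 f n.
Proof.
  revert f. induction n as [|n IH]; intros f; [reflexivity|].
  rewrite decomp_sum by lia. cbn [pred]. rewrite tech5, <- (IH f), Nat.sub_0_r.
  rewrite Rplus_comm. f_equal.
Qed.

(** Symmetrize under [k -> n - k]: the two weights add up to [n]. *)
Lemma conv_weighted_sum (a : nat -> R) n :
  2 * sum_f_R0 (fun k => INR k * (a k * a (n - k)%nat)) n = INR n * sum_f_R0 (fun k => a k * a (n - k)%nat) n.
Proof.
  set (f := fun k => INR k * (a k * a (n - k)%nat)).
  replace (2 * sum_f_R0 f n) with (sum_f_R0 f n + sum_f_R0 (fun k => f (n - k)%nat) n)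
    by (rewrite sum_f_R0_rev; ring).
  rewrite <- sum_plus, scal_sum. apply sum_eq. intros k hk. unfold f.
  replace (n - (n - k))%nat with k by lia. rewrite minus_INR by lia. ring.
Qed.

(** The coefficients of [zf x ^ 2]. *)
Definition ccoef (n : nat) : R := sum_f_R0 (fun k => acoef k * acoef (n - k)%nat) n.

Lemma ccoef_nonneg n : 0 <= ccoef n.
Proof.
  apply cond_pos_sum. intros k. pose proof (acoef_bound k). pose proof (acoef_bound (n - k)). nra.
Qed.

(** From [(k + 1/2)^2 <= (k + 1) (k + 1/4)] one gets [(k + 1) a_(k+1) <= (k + 1/4) a_k], and the
    factor 2 of the symmetrized sum turns 1/4 into 1/2. A bare bound by [n + 1] is enough for the
    coefficients to decrease. *)
Lemma ccoef_ratio n : (INR n + 1) * ccoef (S n) <= (INR n + 1 / 2) * ccoef n.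
Proof.
  rewrite <- S_INR. unfold ccoef at 1. rewrite <- conv_weighted_sum, decomp_sum by lia.
  cbn [pred]. rewrite Rmult_0_l, Rplus_0_l.
  apply Rle_trans with (2 * sum_f_R0 (fun k => INR k * (acoef k * acoef (n - k)%nat)) n + / 2 * ccoef n).
  - unfold ccoef. rewrite !scal_sum, <- sum_plus. apply sum_Rle. intros k hk.
    cbn [Nat.sub]. pose proof (acoef_bound (n - k)) as h1. pose proof (acoef_bound k) as h2.
    pose proof (pos_INR k) as h3. pose proof (acoef_rec k) as h4. rewrite S_INR.
    assert (h5 : (INR k + 1) * acoef (S k) <= (INR k + 1 / 4) * acoef k).
    { apply Rmult_le_reg_l with (INR k + 1); [lra|].
      replace ((INR k + 1) * ((INR k + 1) * acoef (S k))) with ((INR k + 1) ^ 2 * acoef (S k)) by ring.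
      rewrite h4. nra. }
    nra.
  - rewrite conv_weighted_sum. fold (ccoef n). lra.
Qed.

(** The coefficients of [(1 - (1 - x) z^2) / x]. *)
Definition dgap (n : nat) : R := ccoef n - ccoef (S n).

Lemma dgap_nonneg n : 0 <= dgap n.
Proof.
  unfold dgap. pose proof (ccoef_ratio n). pose proof (ccoef_nonneg n).
  pose proof (pos_INR n). assert ((INR n + 1) * ccoef (S n) <= (INR n + 1) * ccoef n) by nra.
  apply Rmult_le_reg_l in H2; lra.
Qed.

Lemma ccoef_0 : ccoef 0 = 1.
Proof. unfold ccoef. simpl. ring. Qed.

Lemma dgap_sum_le n : sum_f_R0 dgap n <= 1.
Proof.
  assert (H : sum_f_R0 dgap n = 1 - ccoef (S n)).
  { induction n as [|n IH].
    - cbn [sum_f_R0]. unfold dgap. rewrite ccoef_0. reflexivity.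
    - rewrite tech5, IH. unfold dgap. ring. }
  rewrite H. pose proof (ccoef_nonneg (S n)). lra.
Qed.

Lemma ccoef_le_1 n : ccoef n <= 1.
Proof.
  induction n as [|n IH]; [rewrite ccoef_0; lra|].
  pose proof (dgap_nonneg n). unfold dgap in *. lra.
Qed.

(** The coefficients of the reciprocal of [1 - sum dgap_n x^(n+1)]; [etab n]
    tabulates the first [n + 1] of them. *)
Fixpoint etab (n : nat) : nat -> R :=
  match n with
  | O => fun _ => 1
  | S m => fun k => if (k <=? m)%nat then etab m k
                    else sum_f_R0 (fun j => dgap j * etab m (m - j)%nat) m
  end.

Definition ecoef (n : nat) : R := etab n n.

Lemma etab_ecoef m k : (k <= m)%nat -> etab m k = ecoef k.
Proof.
  induction m as [|m IH]; intros h.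
  - now replace k with O by lia.
  - destruct (Nat.eq_dec k (S m)) as [->|ne]; [reflexivity|].
    cbn [etab]. destruct (Nat.leb_spec k m); [now apply IH|lia].
Qed.

Lemma ecoef_rec n : ecoef (S n) = sum_f_R0 (fun j => dgap j * ecoef (n - j)%nat) n.
Proof.
  unfold ecoef at 1. cbn [etab]. destruct (Nat.leb_spec (S n) n); [lia|].
  apply sum_eq. intros j hj. rewrite etab_ecoef by lia. reflexivity.
Qed.

(** A renewal recursion: each term is a combination of the earlier ones with nonnegative weights
    [dgap j] of total at most 1. *)
Lemma ecoef_bound n : 0 <= ecoef n <= 1.
Proof.
  induction n as [n IH] using (well_founded_induction lt_wf).
  destruct n as [|n]; [cbn; lra|]. rewrite ecoef_rec. split.
  - assert (H : forall m, (m <= n)%nat -> 0 <= sum_f_R0 (fun j => dgap j * ecoef (n - j)%nat) m).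
    { induction m as [|m IHm]; intros hm.
      - cbn [sum_f_R0]. apply Rmult_le_pos; [apply dgap_nonneg|]. apply IH. lia.
      - rewrite tech5. apply Rplus_le_le_0_compat; [apply IHm; lia|].
        apply Rmult_le_pos; [apply dgap_nonneg|]. apply IH. lia. }
    now apply H.
  - eapply Rle_trans; [|apply (dgap_sum_le n)]. apply sum_Rle. intros j hj.
    destruct (IH (n - j)%nat) as [_ h]; [lia|]. pose proof (dgap_nonneg j). nra.
Qed.

Lemma cconv_RtoC (a b : nat -> R) n :
  cconv (fun k => RtoC (a k)) (fun k => RtoC (b k)) n = RtoC (sum_f_R0 (fun k => a k * b (n - k)%nat) n).
Proof.
  unfold cconv. generalize n at 2 4 as m. induction m as [|m IH].
  - rewrite sum_O. cbn [sum_f_R0]. now rewrite RtoC_mult.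
  - rewrite sum_Sn, IH, tech5, RtoC_plus, (RtoC_mult (a (S m))). reflexivity.
Qed.

Definition ef : C -> C := PS (fun n => RtoC (ecoef n)).

Lemma good_ecoef : good 1 (fun n => RtoC (ecoef n)).
Proof. apply (good_of_real_bounded _ 1), ecoef_bound. Qed.

(** An explicit inverse series also shows that [zf] has no zero in the disc, which legitimizes every
    later division by [zf]. *)
Lemma ef_reciprocal x : Cmod x < 1 -> ((1 - x) * zf x ^ 2 * ef x = 1)%C.
Proof.
  intros hx.
  assert (gc : good 1 (fun n => RtoC (ccoef n))).
  { apply (good_of_real_bounded _ 1). split; [apply ccoef_nonneg|apply ccoef_le_1]. }
  assert (gd : good 1 (fun n => RtoC (dgap n))).
  { apply (good_of_real_bounded _ 1). intros n. split; [apply dgap_nonneg|].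
    unfold dgap. pose proof (ccoef_le_1 n). pose proof (ccoef_nonneg (S n)). lra. }
  assert (E1 : PS (fun n => RtoC (ccoef n)) x = (zf x ^ 2)%C).
  { replace (zf x ^ 2)%C with (zf x * zf x)%C by ring. unfold zf.
    rewrite <- (PS_conv 1) by auto using good_zc. apply PS_ext. intros n. symmetry.
    apply (cconv_RtoC acoef acoef n). }
  assert (E2 : (x * PS (fun n => RtoC (dgap n)) x = 1 - (1 - x) * zf x ^ 2)%C).
  { rewrite (PS_ext _ (fun n => RtoC (ccoef n) + (- (1)) * RtoC (ccoef (S n)))%C).
    - pose proof (good_unshift 1 _ gc) as gc'. cbv beta in gc'.
      rewrite (PS_add 1), (PS_scal 1) by (auto using good_scal).
      assert (E3 := PS_split 1 _ x gc hx). rewrite E1, ccoef_0 in E3. rewrite E1.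
      set (u := PS (fun n => RtoC (ccoef (S n))) x) in *.
      transitivity (x * zf x ^ 2 - x * u)%C; [ring|].
      replace (x * u)%C with (zf x ^ 2 - 1)%C by (rewrite E3; ring). ring.
    - intros n. unfold dgap. rewrite RtoC_minus. ring. }
  assert (E4 : (ef x = 1 + x * PS (fun n => RtoC (dgap n)) x * ef x)%C).
  { unfold ef at 1. rewrite (PS_split 1) by auto using good_ecoef.
    rewrite (PS_ext _ (cconv (fun n => RtoC (dgap n)) (fun n => RtoC (ecoef n)))).
    - rewrite (PS_conv 1) by auto using good_ecoef. fold (ef x). cbn. ring.
    - intros n. now rewrite cconv_RtoC, ecoef_rec. }
  rewrite E2 in E4.
  replace ((1 - x) * zf x ^ 2 * ef x)%C with (ef x - (1 - (1 - x) * zf x ^ 2) * ef x)%C by ring.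
  rewrite E4 at 1. ring.
Qed.

Lemma zf_nz x : Cmod x < 1 -> zf x <> 0%C.
Proof.
  intros hx E. pose proof (ef_reciprocal x hx) as H. rewrite E in H.
  apply C1_nz. rewrite <- H. ring.
Qed.

Lemma one_minus_nz x : Cmod x < 1 -> (1 - x)%C <> 0%C.
Proof.
  intros hx E. replace x with (RtoC 1) in hx.
  - rewrite Cmod_1 in hx. lra.
  - replace x with (1 - (1 - x))%C by ring. rewrite E. ring.
Qed.

Lemma ef_eq x : Cmod x < 1 -> ef x = (/ ((1 - x) * zf x ^ 2))%C.
Proof.
  intros hx. pose proof (zf_nz x hx). pose proof (one_minus_nz x hx).
  pose proof (ef_reciprocal x hx) as E.
  replace (ef x) with ((1 - x) * zf x ^ 2 * ef x / ((1 - x) * zf x ^ 2))%C by (field; auto).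
  rewrite E. field; auto.
Qed.

(** * The nome as a function on the whole disc *)

(** Termwise integral of [(ef x - 1) / x], with constant term 0. *)
Definition scoef (n : nat) : R := match n with O => 0 | S m => ecoef (S m) / INR (S m) end.
Definition sf : C -> C := PS (fun n => RtoC (scoef n)).

Lemma scoef_bound n : 0 <= scoef n <= 1.
Proof.
  destruct n as [|n]; [cbn; lra|]. unfold scoef. pose proof (ecoef_bound (S n)).
  assert (1 <= INR (S n)) by (rewrite S_INR; pose proof (pos_INR n); lra). split.
  - apply Rdiv_le_0_compat; lra.
  - apply Rmult_le_reg_r with (INR (S n)); [lra|]. unfold Rdiv. rewrite Rmult_assoc, Rinv_l; lra.
Qed.

Lemma good_scoef : good 1 (fun n => RtoC (scoef n)).
Proof. apply (good_of_real_bounded _ 1), scoef_bound. Qed.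

Lemma cder_sf x : Cmod x < 1 -> exists l, cder sf x l /\ (ef x = 1 + x * l)%C.
Proof.
  intros hx. exists (PS (dcoef (fun n => RtoC (scoef n))) x). split.
  - apply (cder_PS 1); auto using good_scoef.
  - unfold ef. rewrite (PS_split 1) by auto using good_ecoef. f_equal. f_equal.
    apply PS_ext. intros n. unfold dcoef. rewrite <- RtoC_mult. f_equal. unfold scoef.
    field. apply not_0_INR. lia.
Qed.

(** [sf] is chosen so that [nome] solves [x q' = q / ((1 - x) z^2)]. *)
Definition nome (x : C) : C := (x / 16 * Cexp (sf x))%C.

(** The factor [x] in [nome] cancels the denominator in [q / x], so the formula holds at 0 as
    well. *)
Lemma cder_nome x : Cmod x < 1 -> cder nome x (Cexp (sf x) / 16 * ef x)%C.
Proof.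
  intros hx. destruct (cder_sf x hx) as (l & hl & ->). eapply cder_eq.
  - apply cder_mul; [apply cder_mul; [apply cder_id|apply cder_const]|].
    apply cder_exp_comp. exact hl.
  - cbv beta. unfold Cdiv. ring.
Qed.

Lemma PS_RtoC (rad : R) (a : nat -> R) (r : R) : good rad (fun n => RtoC (a n)) -> Rabs r < rad ->
  PS (fun n => RtoC (a n)) (RtoC r) = RtoC (Series (fun n => a n * r ^ n)) /\
  is_series (fun n => a n * r ^ n) (Series (fun n => a n * r ^ n)).
Proof.
  intros ha hr.
  assert (h : is_series (fun n => a n * r ^ n) (Series (fun n => a n * r ^ n))).
  { apply Series_correct, ex_series_Rabs.
    assert (hc : Cmod (RtoC r) < rad) by now rewrite Cmod_R.
    eapply ex_series_ext; [|exact (good_abs_summable rad _ (RtoC r) ha hc)].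
    intros n. cbv beta. now rewrite <- RtoC_pow, <- RtoC_mult, Cmod_R. }
  split; [|exact h]. apply is_cseries_unique.
  eapply is_cseries_ext; [|exact (is_cseries_RtoC _ _ h)].
  intros n. cbv beta. now rewrite RtoC_mult, RtoC_pow.
Qed.

(** Since the [scoef] are nonnegative, [Re (sf x) <= Cmod (sf x) <= sf r]. *)
Lemma nome_mono x r : Cmod x <= r -> r < 1 -> Cmod (nome x) <= Cmod (nome (RtoC r)).
Proof.
  intros hx hr. assert (h0 : 0 <= r) by (pose proof (Cmod_ge_0 x); lra).
  assert (hr' : Rabs r < 1) by (rewrite Rabs_pos_eq; lra).
  destruct (PS_RtoC 1 scoef r good_scoef hr') as [E S].
  unfold nome, Cdiv. rewrite !Cmod_mult, !Cmod_Cexp, Cmod_R, (Rabs_pos_eq r) by lra.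
  apply Rmult_le_compat; [apply Rmult_le_pos; apply Cmod_ge_0|left; apply exp_pos| |].
  - apply Rmult_le_compat_r; [apply Cmod_ge_0|exact hx].
  - assert (H : Re (sf x) <= Re (sf (RtoC r))).
    { unfold sf. rewrite E. cbn [Re RtoC fst].
      eapply Rle_trans; [apply Rle_abs|]. eapply Rle_trans; [apply re_le_Cmod|].
      apply (is_cseries_bound _ _ _ _ (PS_correct 1 _ x good_scoef ltac:(lra)) S).
      intros n. rewrite Cmod_mult, Cmod_pow, Cmod_R, Rabs_pos_eq by apply scoef_bound.
      apply Rmult_le_compat_l; [apply scoef_bound|]. apply pow_incr. split; [apply Cmod_ge_0|exact hx]. }
    destruct H as [H|H]; [left; now apply exp_increasing|right; now rewrite H].
Qed.

Lemma PS_real_ge_1 r : 0 <= r < 1 -> exists u, 1 <= u /\ zf (RtoC r) = RtoC u.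
Proof.
  intros hr. assert (hr' : Rabs r < 1) by (rewrite Rabs_pos_eq; lra).
  destruct (PS_RtoC 1 acoef r good_zc hr') as [E S]. eexists. split; [|exact E].
  rewrite Series_incr_1 by (eexists; exact S). replace (acoef 0 * r ^ 0) with 1 by (simpl; ring).
  enough (0 <= Series (fun k => acoef (Datatypes.S k) * r ^ Datatypes.S k)) by lra.
  set (b := fun k => acoef (Datatypes.S k) * r ^ Datatypes.S k).
  apply Rle_trans with (0 * Series b); [lra|]. rewrite <- Series_scal_l.
  assert (hb : forall n, 0 <= b n).
  { intros n. apply Rmult_le_pos; [left; apply acoef_bound|apply pow_le; lra]. }
  apply Series_le.
  - intros n. specialize (hb n). lra.
  - apply (ex_series_incr_1 (V := R_NormedModule) (fun n => acoef n * r ^ n)). eexists; exact S.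
Qed.

(** * One-sided limits at 0 and an Abelian theorem *)

(** One-sided limits at 0 along the positive reals, phrased through a
    continuous extension so as to inherit the rules of [ccont]. *)
Definition lim0 (f : R -> C) (l : C) : Prop :=
  exists (g : C -> C) (d : R), 0 < d /\ ccont g 0%C /\ g 0%C = l /\
    forall r, 0 < r < d -> g (RtoC r) = f r.

Lemma lim0_of_eps f l :
  (forall eps, 0 < eps -> exists d, 0 < d /\ forall r, 0 < r < d -> Cmod (f r - l)%C < eps) -> lim0 f l.
Proof.
  (* The extension is constant on vertical lines and equal to [l] wherever the real part is not
     positive. *)
  intros H. exists (fun y => if Rlt_dec 0 (Re y) then f (Re y) else l), 1.
  split; [lra|]. cbn [Re RtoC fst]. destruct (Rlt_dec 0 0) as [h|_]; [lra|]. split; [|split].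
  - intros eps he. destruct (H eps he) as [d [hd Hd]]. exists d. split; [exact hd|]. intros y hy.
    cbn [Re RtoC fst]. destruct (Rlt_dec 0 0) as [h|_]; [lra|].
    destruct (Rlt_dec 0 (Re y)) as [h|h].
    + apply Hd. replace (y - 0)%C with y in hy by ring. pose proof (re_le_Cmod y).
      rewrite Rabs_pos_eq in H0 by lra. unfold Re in *. lra.
    + replace (l - l)%C with (RtoC 0) by ring. rewrite Cmod_0. exact he.
  - reflexivity.
  - intros r hr. destruct (Rlt_dec 0 r); [reflexivity|lra].
Qed.

Lemma lim0_ccont g l : ccont g 0%C -> g 0%C = l -> lim0 (fun r => g (RtoC r)) l.
Proof. intros h <-. exists g, 1. repeat split; auto. lra. Qed.

Lemma lim0_const c : lim0 (fun _ => c) c.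
Proof. apply (lim0_ccont (fun _ => c)); [apply ccont_const|reflexivity]. Qed.

Lemma lim0_add f g l m : lim0 f l -> lim0 g m -> lim0 (fun r => f r + g r)%C (l + m)%C.
Proof.
  intros (a & d & hd & ha & <- & H) (b & e & he & hb & <- & H').
  exists (fun y => a y + b y)%C, (Rmin d e). pose proof (Rmin_l d e). pose proof (Rmin_r d e).
  split; [now apply Rmin_glb_lt|]. split; [now apply ccont_add|]. split; [reflexivity|].
  intros r hr. rewrite H, H' by lra. reflexivity.
Qed.

Lemma lim0_mul f g l m : lim0 f l -> lim0 g m -> lim0 (fun r => f r * g r)%C (l * m)%C.
Proof.
  intros (a & d & hd & ha & <- & H) (b & e & he & hb & <- & H').
  exists (fun y => a y * b y)%C, (Rmin d e). pose proof (Rmin_l d e). pose proof (Rmin_r d e).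
  split; [now apply Rmin_glb_lt|]. split; [now apply ccont_mul|]. split; [reflexivity|].
  intros r hr. rewrite H, H' by lra. reflexivity.
Qed.

Lemma lim0_comp f h l : ccont h l -> lim0 f l -> lim0 (fun r => h (f r)) (h l).
Proof.
  intros hh (a & d & hd & ha & <- & H). exists (fun y => h (a y)), d.
  repeat split; auto; [now apply ccont_comp|]. intros r hr. now rewrite H.
Qed.

Lemma lim0_ext_loc f g l d0 : 0 < d0 -> (forall r, 0 < r < d0 -> f r = g r) -> lim0 f l -> lim0 g l.
Proof.
  intros hd0 h (a & d & hd & ha & e & H). exists a, (Rmin d d0).
  pose proof (Rmin_l d d0). pose proof (Rmin_r d d0).
  split; [apply Rmin_glb_lt; lra|]. repeat split; auto. intros r hr. rewrite H, h by lra. reflexivity.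
Qed.

Lemma lim0_ext f g l : (forall r, 0 < r < 1 -> f r = g r) -> lim0 f l -> lim0 g l.
Proof. apply lim0_ext_loc. lra. Qed.

Lemma lim0_unique f l m : lim0 f l -> lim0 f m -> l = m.
Proof.
  intros (a & d & hd & ha & <- & H) (b & e & he & hb & <- & H').
  apply Cmod_small_eq. intros eps heps.
  destruct (ha (eps / 2)) as [d1 [h1 H1]]; [lra|]. destruct (hb (eps / 2)) as [d2 [h2 H2]]; [lra|].
  set (r := Rmin (Rmin d e) (Rmin d1 d2) / 2).
  pose proof (Rmin_l (Rmin d e) (Rmin d1 d2)). pose proof (Rmin_r (Rmin d e) (Rmin d1 d2)).
  pose proof (Rmin_l d e). pose proof (Rmin_r d e). pose proof (Rmin_l d1 d2). pose proof (Rmin_r d1 d2).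
  assert (hr : 0 < Rmin (Rmin d e) (Rmin d1 d2)) by (repeat apply Rmin_glb_lt; lra).
  assert (E : Cmod (RtoC r - 0)%C = r).
  { replace (RtoC r - 0)%C with (RtoC r) by ring. rewrite Cmod_R, Rabs_pos_eq; unfold r; lra. }
  specialize (H1 (RtoC r)). specialize (H2 (RtoC r)). rewrite E in H1, H2.
  specialize (H1 ltac:(unfold r; lra)). specialize (H2 ltac:(unfold r; lra)).
  rewrite H in H1 by (unfold r; lra). rewrite H' in H2 by (unfold r; lra).
  replace (a 0 - b 0)%C with ((f r - b 0) - (f r - a 0))%C by ring.
  eapply Rle_lt_trans; [apply Cmod_triangle|]. rewrite Cmod_opp. lra.
Qed.

(** The weights [r (1 - r)^n] sum to 1 and each single one tends to 0 with [r], so only the limit of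
    [c] survives. *)
Lemma abel_limit (c : nat -> R) (L : R) : is_lim_seq c L ->
  lim0 (fun r => RtoC r * PS (fun n => RtoC (c n)) (RtoC (1 - r)))%C (RtoC L).
Proof.
  intros hc. apply is_lim_seq_Reals in hc.
  destruct (maj_by_pos (fun n => c n - L)) as [M [hM HM]].
  { exists 0. intros eps he. destruct (hc eps he) as [N HN]. exists N. intros n hn.
    unfold Rdist. rewrite Rminus_0_r. now apply HN. }
  apply lim0_of_eps. intros eps he.
  destruct (hc (eps / 2)) as [N HN]; [lra|].
  (* Instead of splitting the sum at [N], the bound [M * 2 ^ N / 2 ^ n + eps / 2] covers
     [Rabs (c n - L)] for every [n]. Weighted by [w ^ n], its first part sums to at most [K],
     uniformly in [w]. *)
  set (K := M * 2 ^ N * 2). assert (hK : 0 < K).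
  { unfold K. pose proof (pow_lt 2 N ltac:(lra)). repeat apply Rmult_lt_0_compat; lra. }
  set (d := Rmin 1 (eps / 2 / K)).
  assert (d1 : d <= 1) by apply Rmin_l. assert (d2 : d <= eps / 2 / K) by apply Rmin_r.
  exists d. split; [apply Rmin_glb_lt; [lra|]; apply Rdiv_lt_0_compat; lra|]. intros r hr.
  set (w := 1 - r). assert (hw : 0 < w < 1) by (unfold w; lra).
  assert (aw : Cmod (RtoC w) < 1) by (rewrite Cmod_R, Rabs_pos_eq; lra).
  assert (gc : good 1 (fun n => RtoC (c n))).
  { apply good_bounded with (M + Rabs L). intros n. rewrite Cmod_R.
    replace (c n) with ((c n - L) + L) by ring. eapply Rle_trans; [apply Rabs_triang|].
    specialize (HM n). cbv beta in HM. lra. }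
  assert (hone : is_series (fun n => w ^ n) (/ (1 - w))) by (apply is_series_geom; rewrite Rabs_pos_eq; lra).
  assert (hhalf : is_series (fun n => (w / 2) ^ n) (/ (1 - w / 2)))
    by (apply is_series_geom; rewrite Rabs_pos_eq; lra).
  assert (S1 : is_cseries (fun n => RtoC (c n - L) * RtoC w ^ n)%C
    (PS (fun n => RtoC (c n)) (RtoC w) + (- RtoC L) * RtoC (/ (1 - w)))%C).
  { eapply is_cseries_ext; [|apply is_cseries_add; [exact (PS_correct 1 _ _ gc aw)|
      apply is_cseries_scal; exact (is_cseries_RtoC _ _ hone)]].
    intros n. cbv beta. rewrite RtoC_minus, RtoC_pow. ring. }
  assert (S2 : is_series (fun n => M * 2 ^ N * (w / 2) ^ n + eps / 2 * w ^ n)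
    (M * 2 ^ N * / (1 - w / 2) + eps / 2 * / (1 - w))).
  { apply (is_series_plus (V := R_NormedModule) (fun n => M * 2 ^ N * (w / 2) ^ n));
      [exact (is_series_scal_l (V := R_NormedModule) (M * 2 ^ N) _ _ hhalf)|
       exact (is_series_scal_l (V := R_NormedModule) (eps / 2) _ _ hone)]. }
  assert (B : Cmod (PS (fun n => RtoC (c n)) (RtoC w) + (- RtoC L) * RtoC (/ (1 - w)))%C <=
    M * 2 ^ N * / (1 - w / 2) + eps / 2 * / (1 - w)).
  { apply (is_cseries_bound _ _ _ _ S1 S2). intros n.
    rewrite Cmod_mult, Cmod_pow, !Cmod_R, (Rabs_pos_eq w) by lra.
    pose proof (pow_lt w n ltac:(lra)) as pw. pose proof (pow_lt 2 n ltac:(lra)) as p2.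
    pose proof (pow_lt 2 N ltac:(lra)) as pN.
    assert (e2 : M * 2 ^ N * (w / 2) ^ n = M * (2 ^ N / 2 ^ n) * w ^ n).
    { unfold Rdiv. rewrite Rpow_mult_distr, pow_inv. ring. }
    rewrite e2, <- Rmult_plus_distr_r. apply Rmult_le_compat_r; [lra|].
    destruct (le_lt_dec N n) as [l|l].
    - specialize (HN n l). unfold Rdist in HN.
      assert (0 < M * (2 ^ N / 2 ^ n)) by (apply Rmult_lt_0_compat; [lra|]; apply Rdiv_lt_0_compat; lra).
      lra.
    - specialize (HM n). cbv beta in HM.
      assert (1 <= 2 ^ N / 2 ^ n).
      { apply Rmult_le_reg_r with (2 ^ n); [lra|]. unfold Rdiv. rewrite Rmult_assoc, Rinv_l by lra.
        rewrite Rmult_1_l, Rmult_1_r. apply Rle_pow; [lra|lia]. }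
      nra. }
  replace (1 - w) with r in B by (unfold w; ring).
  replace (RtoC r * PS (fun n => RtoC (c n)) (RtoC w) - RtoC L)%C
    with (RtoC r * (PS (fun n => RtoC (c n)) (RtoC w) + (- RtoC L) * RtoC (/ r)))%C.
  2:{ rewrite RtoC_inv by lra. field. intro E. apply RtoC_inj in E. lra. }
  rewrite Cmod_mult, Cmod_R, Rabs_pos_eq by lra.
  assert (i2 : / (1 - w / 2) <= 2).
  { apply Rmult_le_reg_l with (1 - w / 2); [lra|]. rewrite Rinv_r; lra. }
  assert (B2 : Cmod (PS (fun n => RtoC (c n)) (RtoC w) + (- RtoC L) * RtoC (/ r))%C <= K + eps / 2 * / r).
  { eapply Rle_trans; [exact B|]. apply Rplus_le_compat_r. unfold K.
    apply Rmult_le_compat_l; [|exact i2]. pose proof (pow_lt 2 N ltac:(lra)). nra. }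
  apply Rle_lt_trans with (r * (K + eps / 2 * / r)); [apply Rmult_le_compat_l; lra|].
  replace (r * (K + eps / 2 * / r)) with (r * K + eps / 2) by (field; lra).
  assert (r * K < eps / 2 / K * K) by (apply Rmult_lt_compat_r; lra).
  replace (eps / 2 / K * K) with (eps / 2) in H by (field; lra). lra.
Qed.

(** * Wallis' product *)

Definition wallis (n : nat) : R := RInt (fun t => sin t ^ n) 0 (PI / 2).

Lemma ex_RInt_of_derive (f f' : R -> R) a b : (forall t, is_derive f t (f' t)) -> ex_RInt f a b.
Proof.
  intros h. apply (ex_RInt_continuous (V := R_CompleteNormedModule)). intros t _.
  apply (ex_derive_continuous f). now exists (f' t).
Qed.

Lemma sin_pow_integrable n a b : ex_RInt (fun t => sin t ^ n) a b.
Proof.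
  apply ex_RInt_of_derive with (fun t => INR n * cos t * sin t ^ pred n). intros t.
  auto_derive; [trivial|ring].
Qed.

Lemma wallis_rec n : (INR n + 2) * wallis (S (S n)) = (INR n + 1) * wallis n.
Proof.
  (* The integrand is the derivative of [- cos t * sin t ^ S n], which vanishes at both ends. *)
  assert (H : is_RInt (fun t => (INR n + 2) * sin t ^ S (S n) - (INR n + 1) * sin t ^ n) 0 (PI / 2)
    (- cos (PI / 2) * sin (PI / 2) ^ S n - - cos 0 * sin 0 ^ S n)).
  { apply (is_RInt_derive (V := R_CompleteNormedModule) (fun t => - cos t * sin t ^ S n)).
    - intros t _. auto_derive; [trivial|]. pose proof (sin2_cos2 t) as h. unfold Rsqr in h.
      change (match n with 0%nat => 1 | S _ => INR n + 1 end) with (INR (S n)). rewrite S_INR. cbn [pow].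
      replace ((INR n + 2) * (sin t * (sin t * sin t ^ n)) - (INR n + 1) * sin t ^ n)
        with ((sin t * sin t + (INR n + 1) * (sin t * sin t - 1)) * sin t ^ n) by ring.
      replace (sin t * sin t - 1) with (- (cos t * cos t)) by lra. ring.
    - intros t _. apply (ex_derive_continuous (fun t => (INR n + 2) * sin t ^ S (S n) - (INR n + 1) * sin t ^ n)).
      auto_derive. trivial. }
  assert (I : forall m, is_RInt (fun t => sin t ^ m) 0 (PI / 2) (wallis m)).
  { intros m. apply (RInt_correct (V := R_CompleteNormedModule)), sin_pow_integrable. }
  pose proof (is_RInt_minus (V := R_NormedModule) _ _ _ _ _ _
    (is_RInt_scal (V := R_NormedModule) _ _ _ (INR n + 2) _ (I (S (S n))))
    (is_RInt_scal (V := R_NormedModule) _ _ _ (INR n + 1) _ (I n))) as H'.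
  apply (is_RInt_unique (V := R_CompleteNormedModule)) in H, H'.
  pose proof (eq_trans (eq_sym H) H') as E.
  rewrite cos_PI2, sin_0 in E.
  change (minus (scal (INR n + 2) (wallis (S (S n)))) (scal (INR n + 1) (wallis n)))
    with ((INR n + 2) * wallis (S (S n)) - (INR n + 1) * wallis n) in E.
  cbn [pow] in E. lra.
Qed.

Lemma wallis_0 : wallis 0 = PI / 2.
Proof. unfold wallis. cbn [pow]. rewrite RInt_const. change (scal ?a ?b) with (a * b). ring. Qed.

Lemma wallis_1 : wallis 1 = 1.
Proof.
  unfold wallis.
  assert (H : is_RInt (fun t => sin t ^ 1) 0 (PI / 2) (- cos (PI / 2) - - cos 0)).
  { apply (is_RInt_derive (V := R_CompleteNormedModule) (fun t => - cos t)).
    - intros t _. auto_derive; [trivial|ring].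
    - intros t _. apply (ex_derive_continuous (fun t => sin t ^ 1)). auto_derive. trivial. }
  apply (is_RInt_unique (V := R_CompleteNormedModule)) in H. rewrite H, cos_PI2, cos_0. ring.
Qed.

Lemma wallis_decr n : wallis (S n) <= wallis n.
Proof.
  pose proof PI_RGT_0. apply RInt_le; [lra|apply sin_pow_integrable|apply sin_pow_integrable|].
  intros t ht. assert (0 <= sin t) by (apply sin_ge_0; lra). pose proof (SIN_bound t).
  cbn [pow]. pose proof (pow_le (sin t) n H0). nra.
Qed.

(** By [wallis_rec] this product does not change with [n]. *)
Lemma wallis_prod n : (INR n + 1) * (wallis n * wallis (S n)) = PI / 2.
Proof.
  induction n as [|n IH]; [rewrite wallis_0, wallis_1; simpl; ring|].
  rewrite S_INR. replace ((INR n + 1 + 1) * (wallis (S n) * wallis (S (S n))))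
    with ((INR n + 2) * wallis (S (S n)) * wallis (S n)) by ring.
  rewrite wallis_rec, <- IH. ring.
Qed.

Lemma wallis_pos n : 0 < wallis n.
Proof.
  assert (h : forall n, 0 <= wallis n).
  { clear n. intros n. pose proof PI_RGT_0. unfold wallis.
    apply RInt_ge_0; [lra|apply sin_pow_integrable|]. intros t ht. apply pow_le, sin_ge_0; lra. }
  destruct (h n) as [l|e]; [exact l|]. pose proof (wallis_prod n) as H. rewrite <- e in H.
  pose proof PI_RGT_0. lra.
Qed.

(** Both sides have the same ratio of consecutive terms, [((m + 1/2) / (m + 1))^2]. *)
Lemma wallis_acoef m : wallis (2 * m) ^ 2 = (PI / 2) ^ 2 * acoef m.
Proof.
  induction m as [|m IH]; [simpl (2 * 0)%nat; rewrite wallis_0; simpl; ring|].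
  replace (2 * S m)%nat with (S (S (2 * m))) by lia.
  pose proof (wallis_rec (2 * m)) as h. pose proof (pos_INR m) as pm.
  rewrite mult_INR in h. simpl (INR 2) in h.
  replace (wallis (S (S (2 * m)))) with ((INR m + 1 / 2) / (INR m + 1) * wallis (2 * m)).
  - rewrite Rpow_mult_distr, IH. cbn [acoef]. ring.
  - apply Rmult_eq_reg_l with ((1 + 1) * INR m + 2); [|lra]. rewrite h. field. lra.
Qed.

(** By monotonicity the square of [wallis (2 n + 2)] lies between its products with the two
    neighbouring integrals, and [wallis_prod] evaluates these. *)
Lemma acoef_asymptotic n : / PI * ((INR n + 1) / (INR n + 3 / 2)) <= (INR n + 1) * acoef (S n) <= / PI.
Proof.
  pose proof PI_RGT_0 as hp. pose proof (pos_INR n) as pn.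
  pose proof (wallis_acoef (S n)) as E.
  pose proof (wallis_prod (2 * S n)) as H1. pose proof (wallis_prod (S (2 * n))) as H2.
  replace (S (S (2 * n))) with (2 * S n)%nat in H2 by lia.
  pose proof (wallis_decr (2 * S n)) as D1. pose proof (wallis_decr (S (2 * n))) as D2.
  replace (S (S (2 * n))) with (2 * S n)%nat in D2 by lia.
  pose proof (wallis_pos (2 * S n)) as p.
  assert (I1 : INR (2 * S n) = 2 * INR n + 2) by (rewrite mult_INR, (S_INR n); simpl (INR 2); ring).
  assert (I2 : INR (S (2 * n)) = 2 * INR n + 1) by (rewrite S_INR, mult_INR; simpl (INR 2); ring).
  rewrite I1 in H1. rewrite I2 in H2.
  set (w := wallis (2 * S n)) in *.
  assert (L : PI / 2 <= (2 * INR n + 3) * w ^ 2).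
  { rewrite <- H1. replace (2 * INR n + 2 + 1) with (2 * INR n + 3) by ring.
    apply Rmult_le_compat_l; [lra|]. cbn [pow]. nra. }
  assert (U : (2 * INR n + 2) * w ^ 2 <= PI / 2).
  { rewrite <- H2. replace (2 * INR n + 1 + 1) with (2 * INR n + 2) by ring.
    apply Rmult_le_compat_l; [lra|]. cbn [pow]. nra. }
  rewrite E in L, U. split.
  - apply Rmult_le_reg_l with (PI * (INR n + 3 / 2)); [apply Rmult_lt_0_compat; lra|].
    replace (PI * (INR n + 3 / 2) * (/ PI * ((INR n + 1) / (INR n + 3 / 2)))) with (INR n + 1) by (field; lra).
    apply Rmult_le_reg_l with (PI / 2); [lra|]. nra.
  - apply Rmult_le_reg_l with PI; [lra|]. rewrite Rinv_r by lra.
    apply Rmult_le_reg_l with (PI / 2); [lra|]. lra.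
Qed.

Lemma acoef_limit : is_lim_seq (fun n => (INR n + 1) * acoef (S n)) (/ PI).
Proof.
  pose proof PI_RGT_0 as hp.
  apply is_lim_seq_le_le with (fun n => / PI - / PI * / (INR n + 1)) (fun _ => / PI).
  - intros n. pose proof (acoef_asymptotic n) as [h1 h2]. split; [|exact h2].
    eapply Rle_trans; [|exact h1]. pose proof (pos_INR n).
    assert (hi : 0 < / PI) by now apply Rinv_0_lt_compat.
    replace (/ PI - / PI * / (INR n + 1)) with (/ PI * (1 - / (INR n + 1))) by ring.
    apply Rmult_le_compat_l; [lra|].
    replace (1 - / (INR n + 1)) with (INR n / (INR n + 1)) by (field; lra).
    apply Rmult_le_reg_r with ((INR n + 1) * (INR n + 3 / 2)); [apply Rmult_lt_0_compat; lra|].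
    replace (INR n / (INR n + 1) * ((INR n + 1) * (INR n + 3 / 2))) with (INR n * (INR n + 3 / 2)) by (field; lra).
    replace ((INR n + 1) / (INR n + 3 / 2) * ((INR n + 1) * (INR n + 3 / 2))) with ((INR n + 1) * (INR n + 1)) by (field; lra).
    nra.
  - replace (Finite (/ PI)) with (Finite (/ PI - / PI * 0)) by (f_equal; ring).
    apply is_lim_seq_minus'; [apply is_lim_seq_const|].
    apply (is_lim_seq_scal_l _ (/ PI) 0).
    apply is_lim_seq_ext with (fun n => / INR (S n)); [intros n; now rewrite S_INR|].
    apply (is_lim_seq_incr_1 (fun n => / INR n)).
    apply (is_lim_seq_inv _ p_infty); [apply is_lim_seq_INR|discriminate].
  - apply is_lim_seq_const.
Qed.

Lemma acoef_lim_0 : is_lim_seq acoef 0.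
Proof.
  apply is_lim_seq_incr_1.
  apply is_lim_seq_ext with (fun n => (INR n + 1) * acoef (S n) * / INR (S n)).
  - intros n. rewrite S_INR. pose proof (pos_INR n). field. lra.
  - replace (Finite 0) with (Finite (/ PI * 0)) by (f_equal; ring).
    apply is_lim_seq_mult'; [apply acoef_limit|].
    apply (is_lim_seq_incr_1 (fun n => / INR n)).
    apply (is_lim_seq_inv _ p_infty); [apply is_lim_seq_INR|discriminate].
Qed.

Lemma lim0_zf_reflected : lim0 (fun r => RtoC r * zf (RtoC (1 - r)))%C 0%C.
Proof. exact (abel_limit acoef 0 acoef_lim_0). Qed.

(** The coefficients [(n + 1) a_(n+1)] of [z'] tend to [1 / PI], so [(1 - x) z'] tends to [1 / PI]
    as [x] increases to 1. *)
Lemma lim0_Yf_reflected : lim0 (fun r => Yf (RtoC (1 - r))) (RtoC (/ PI)).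
Proof.
  apply lim0_ext with (fun r => (1 - RtoC r) *
    (RtoC r * PS (fun n => RtoC ((INR n + 1) * acoef (S n))) (RtoC (1 - r))))%C.
  - intros r _. unfold Yf, zf'.
    replace (PS (dcoef zc) (RtoC (1 - r))) with (PS (fun n => RtoC ((INR n + 1) * acoef (S n))) (RtoC (1 - r))).
    + rewrite !RtoC_minus. ring.
    + apply PS_ext. intros n. unfold dcoef, zc. rewrite <- RtoC_mult, S_INR. reflexivity.
  - replace (RtoC (/ PI)) with ((1 - 0) * RtoC (/ PI))%C by ring.
    apply lim0_mul; [|apply (abel_limit _ _ acoef_limit)].
    apply (lim0_ccont (fun y => 1 - y)%C); [|reflexivity].
    eapply cder_ccont, cder_sub; [apply cder_const|apply cder_id].
Qed.

(** * Landen's transformation *)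

Definition landen (t : C) : C := (4 * t / (1 + t) ^ 2)%C.

Lemma one_plus_real_nz t : 0 <= t -> (1 + RtoC t)%C <> 0%C.
Proof.
  intros ht E. rewrite <- RtoC_plus in E. apply RtoC_inj in E. lra.
Qed.

Lemma landen_real t : 0 <= t -> landen (RtoC t) = RtoC (4 * t / (1 + t) ^ 2).
Proof.
  intros ht. unfold landen. rewrite RtoC_div by nra. now rewrite RtoC_pow, RtoC_plus, RtoC_mult.
Qed.

Lemma landen_real_bound t : 0 <= t < 1 -> 0 <= 4 * t / (1 + t) ^ 2 < 1.
Proof.
  intros ht. assert (0 < (1 + t) ^ 2) by nra. split; [apply Rdiv_le_0_compat; lra|].
  apply Rmult_lt_reg_r with ((1 + t) ^ 2); [lra|]. unfold Rdiv. rewrite Rmult_assoc, Rinv_l by lra. nra.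
Qed.

Lemma Cmod_landen_real t : 0 <= t < 1 -> Cmod (landen (RtoC t)) < 1.
Proof.
  intros ht. rewrite landen_real by lra. pose proof (landen_real_bound t ht).
  rewrite Cmod_R, Rabs_pos_eq; lra.
Qed.

Lemma cder_landen t : (1 + t)%C <> 0%C -> cder landen t (4 * (1 - t) / (1 + t) ^ 3)%C.
Proof.
  intros h. eapply cder_eq.
  - apply cder_div; [apply cder_mul; [apply cder_const|apply cder_id]| |].
    + apply cder_sqr. apply cder_add; [apply cder_const|apply cder_id].
    + cbv beta. now apply Cpow_nz.
  - cbv beta. field. exact h.
Qed.

(** The Wronskian of [zf (landen t) / (1 + t)] and [zf (t ^ 2)], two solutions of
    [(t(1-t^2)f')' = t f], vanishes at 0, so it vanishes throughout. *)
Section Landen.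
Let f1 t := (zf (landen t) / (1 + t))%C.
Let f2 t := zf (t ^ 2)%C.
(** [p1] and [p2] are [t (1 - t^2)] times [f1'] and [f2'], written through [Yf] so that [cder_Yf]
    differentiates them without second derivatives of [zf]. *)
Let p1 t := ((1 + t) * Yf (landen t) - t * (1 - t) / (1 + t) * zf (landen t))%C.
Let p2 t := (2 * Yf (t ^ 2))%C.
Let f1' t := (4 * (1 - t) / (1 + t) ^ 4 * zf' (landen t) - zf (landen t) / (1 + t) ^ 2)%C.
Let f2' t := (2 * t * zf' (t ^ 2))%C.

Variable r : R.
Hypothesis hr : 0 <= r < 1.

Lemma Cmod_sqr_real : Cmod (RtoC r ^ 2)%C < 1.
Proof. rewrite <- RtoC_pow, Cmod_R, Rabs_pos_eq; nra. Qed.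

Lemma cder_landen_f1 : cder f1 (RtoC r) (f1' (RtoC r)).
Proof.
  pose proof (one_plus_real_nz r (proj1 hr)) as h. eapply cder_eq.
  - apply cder_div; [|apply cder_add; [apply cder_const|apply cder_id]|exact h].
    apply (cder_comp zf landen); [now apply cder_landen|]. apply cder_zf. now apply Cmod_landen_real.
  - unfold f1'. cbv beta. field. exact h.
Qed.

Lemma cder_landen_f2 : cder f2 (RtoC r) (f2' (RtoC r)).
Proof.
  eapply cder_eq.
  - apply (cder_comp zf (fun t => t ^ 2)%C); [apply cder_sqr, cder_id|].
    apply cder_zf. apply Cmod_sqr_real.
  - unfold f2'. cbv beta. ring.
Qed.

Lemma cder_landen_p1 : cder p1 (RtoC r) (RtoC r * f1 (RtoC r))%C.
Proof.
  pose proof (one_plus_real_nz r (proj1 hr)) as h. pose proof (Cmod_landen_real r hr) as hl.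
  eapply cder_eq.
  - apply cder_sub; apply cder_mul.
    + apply cder_add; [apply cder_const|apply cder_id].
    + apply (cder_comp Yf landen); [now apply cder_landen|now apply cder_Yf].
    + apply cder_div; [|apply cder_add; [apply cder_const|apply cder_id]|exact h].
      apply cder_mul; [apply cder_id|apply cder_sub; [apply cder_const|apply cder_id]].
    + apply (cder_comp zf landen); [now apply cder_landen|now apply cder_zf].
  - unfold f1, Yf. cbv beta. set (Z := zf _). set (Z' := zf' _). unfold landen. field. exact h.
Qed.

Lemma cder_landen_p2 : cder p2 (RtoC r) (RtoC r * f2 (RtoC r))%C.
Proof.
  eapply cder_eq.
  - apply cder_mul; [apply cder_const|].
    apply (cder_comp Yf (fun t => t ^ 2)%C); [apply cder_sqr, cder_id|].
    apply cder_Yf. apply Cmod_sqr_real.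
  - unfold f2. cbv beta. field.
Qed.

Lemma landen_p1_eq : p1 (RtoC r) = (RtoC r * (1 - RtoC r ^ 2) * f1' (RtoC r))%C.
Proof.
  pose proof (one_plus_real_nz r (proj1 hr)) as h.
  unfold p1, f1', Yf. set (Z := zf _). set (Z' := zf' _). unfold landen. field. exact h.
Qed.

Lemma landen_p2_eq : p2 (RtoC r) = (RtoC r * (1 - RtoC r ^ 2) * f2' (RtoC r))%C.
Proof. unfold p2, f2', Yf. ring. Qed.

Lemma cder_landen_wronskian :
  cder (fun t => f1 t * p2 t - f2 t * p1 t)%C (RtoC r) 0%C.
Proof.
  eapply cder_eq.
  - apply cder_sub; apply cder_mul;
      [apply cder_landen_f1|apply cder_landen_p2|apply cder_landen_f2|apply cder_landen_p1].
  - rewrite landen_p1_eq, landen_p2_eq. ring.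
Qed.
End Landen.

(** The quotient of the two solutions has a derivative proportional to their Wronskian; it is
    therefore constant, and equal to 1 at 0. *)
Lemma landen_zf r : 0 <= r < 1 -> zf (landen (RtoC r)) = ((1 + RtoC r) * zf (RtoC r ^ 2))%C.
Proof.
  intros hr.
  assert (seg : forall s t, 0 <= s < 1 -> 0 <= t <= 1 ->
    (0 + RtoC t * (RtoC s - 0))%C = RtoC (t * s) /\ 0 <= t * s < 1).
  { intros s t hs ht. split; [rewrite RtoC_mult; ring|nra]. }
  assert (e0 : landen 0 = 0%C) by (unfold landen; rewrite Cplus_0_r; field).
  (* For [r = 0] the segment degenerates, and the Wronskian relation could not be divided by
     [s (1 - s^2)]. *)
  destruct (Req_dec r 0) as [r0|r0].
  { rewrite r0, e0. replace (RtoC 0 ^ 2)%C with (RtoC 0) by ring. ring. }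
  pose proof cder_landen_wronskian as HW. cbv beta zeta in HW.
  assert (W0 : forall s, 0 <= s < 1 ->
    (zf (landen (RtoC s)) / (1 + RtoC s) * (2 * Yf (RtoC s ^ 2)) - zf (RtoC s ^ 2) *
     ((1 + RtoC s) * Yf (landen (RtoC s)) - RtoC s * (1 - RtoC s) / (1 + RtoC s) * zf (landen (RtoC s))) = 0)%C).
  { intros s hs.
    rewrite (cder_const_segment (fun t => zf (landen t) / (1 + t) * (2 * Yf (t ^ 2)) - zf (t ^ 2) *
     ((1 + t) * Yf (landen t) - t * (1 - t) / (1 + t) * zf (landen t)))%C 0%C (RtoC s)).
    - rewrite e0. unfold Yf. rewrite Cplus_0_r. field.
    - intros t ht. exists 0%C. destruct (seg s t hs ht) as [-> h]. now apply HW.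
    - intros t ht. destruct (seg s t hs ltac:(lra)) as [-> h]. now apply HW. }
  pose proof cder_landen_f1 as D1. pose proof cder_landen_f2 as D2. cbv beta zeta in D1, D2.
  pose proof landen_p1_eq as E1. pose proof landen_p2_eq as E2. cbv beta zeta in E1, E2.
  assert (nz2 : forall s, 0 <= s < 1 -> zf (RtoC s ^ 2) <> 0%C).
  { intros s hs. apply zf_nz. now apply Cmod_sqr_real. }
  assert (G : (zf (landen (RtoC r)) / (1 + RtoC r) / zf (RtoC r ^ 2) = zf (landen 0) / (1 + 0) / zf (0 ^ 2))%C).
  { apply (cder_const_segment (fun t => zf (landen t) / (1 + t) / zf (t ^ 2))%C 0%C (RtoC r)).
    - intros t ht. destruct (seg r t hr ht) as [-> h]. eexists.
      apply cder_div; [now apply D1|now apply D2|now apply nz2].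
    - intros t ht. destruct (seg r t hr ltac:(lra)) as [-> h].
      assert (ts : 0 < t * r) by (apply Rmult_lt_0_compat; lra).
      eapply cder_eq; [apply cder_div; [now apply D1|now apply D2|now apply nz2]|].
      cbv beta. specialize (W0 _ h). rewrite E1, E2 in W0 by exact h.
      pose proof (nz2 _ h) as n2.
      set (s := RtoC (t * r)) in *.
      assert (hs : (s * (1 - s ^ 2))%C <> 0%C).
      { unfold s. rewrite <- RtoC_pow, <- RtoC_minus, <- RtoC_mult. intro E. apply RtoC_inj in E.
        assert (0 < t * r * (1 - (t * r) ^ 2)) by (apply Rmult_lt_0_compat; nra). lra. }
      set (A := (4 * (1 - s) / (1 + s) ^ 4 * zf' (landen s) - zf (landen s) / (1 + s) ^ 2)%C) in *.
      set (B := (zf (landen s) / (1 + s))%C) in *.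
      assert (E : (A * zf (s ^ 2) - B * (2 * s * zf' (s ^ 2)) = 0)%C).
      { destruct (Ceq_dec (A * zf (s ^ 2) - B * (2 * s * zf' (s ^ 2)))%C 0%C) as [e|e]; [exact e|].
        exfalso. apply (Cmult_neq_0 _ _ hs e).
        transitivity (- (B * (s * (1 - s ^ 2) * (2 * s * zf' (s ^ 2))) - zf (s ^ 2) * (s * (1 - s ^ 2) * A)))%C;
          [ring|]. rewrite W0. ring. }
      rewrite E. unfold Cdiv. ring. }
  rewrite e0 in G. replace (0 ^ 2)%C with (RtoC 0) in G by ring.
  pose proof (nz2 r hr) as n2. pose proof (one_plus_real_nz r (proj1 hr)) as n1.
  pose proof (zf_nz 0 ltac:(rewrite Cmod_0; lra)) as n0.
  replace (zf 0 / (1 + 0) / zf 0)%C with (RtoC 1) in G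
    by (rewrite Cplus_0_r; field; exact n0).
  transitivity ((1 + RtoC r) * zf (RtoC r ^ 2) * (zf (landen (RtoC r)) / (1 + RtoC r) / zf (RtoC r ^ 2)))%C.
  - field. auto.
  - rewrite G. ring.
Qed.

(** * The continued branch and its identification with the nome *)

Lemma analytic_Yterm F w : analytic_at F w ->
  analytic_at (fun w => w * (1 + (- (1)) * w) * C_derive F w)%C w.
Proof.
  intros h. apply analytic_mul; [|now apply analytic_derive].
  apply analytic_mul; [apply analytic_id|].
  apply analytic_add; [apply analytic_const|]. apply analytic_mul; [apply analytic_const|apply analytic_id].
Qed.

Section Continuation.
Variable F : C -> C.
Hypothesis hF : hyp2F1_principal_branch (1 / 2)%C (1 / 2)%C 1%C F.

Lemma branch_zf w : Cmod w < 1 -> F w = zf w.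
Proof. intros hw. rewrite <- hyp2F1_zf. now apply (proj2 hF). Qed.

Lemma branch_derive_zf w : Cmod w < 1 -> C_derive F w = zf' w.
Proof.
  intros hw. apply cder_C_derive. apply cder_ext_loc with zf (1 - Cmod w); [lra| |now apply cder_zf].
  intros y hy. symmetry. apply branch_zf. pose proof (Cmod_le_minus_add y w). lra.
Qed.

(** The residual of the hypergeometric equation is analytic along [[0, w]] and
    vanishes near 0. *)
Lemma branch_ode w : ~ on_cut w ->
  cder (fun w => w * (1 + (- (1)) * w) * C_derive F w)%C w (F w / 4)%C.
Proof.
  intros hw. set (M := (fun w => w * (1 + (- (1)) * w) * C_derive F w)%C).
  assert (hM : analytic_at M w) by (apply analytic_Yterm, (proj1 hF), hw).
  eapply cder_eq; [apply analytic_cder; exact hM|].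
  apply Ceq_minus. replace (C_derive M w - F w / 4)%C with (C_derive M w + (- / 4) * F w)%C
    by (unfold Cdiv; ring).
  apply (analytic_segment_zero (fun w => C_derive M w + (- / 4) * F w)%C 0%C w).
  - intros t ht.
    assert (hc : ~ on_cut (0 + RtoC t * (w - 0))%C).
    (* The slit plane is star-shaped about 0: dividing a point of the cut by [t <= 1] leaves it on
       the cut. *)
    { intros [h1 h2]. apply hw. unfold on_cut, Re, Im in *. cbn in *.
      assert (ht0 : 0 < t) by (destruct (Req_dec t 0) as [E|E]; [rewrite E in *|]; lra).
      split; [apply Rmult_eq_reg_l with t; lra|nra]. }
    apply analytic_add.
    + apply analytic_derive. apply analytic_Yterm. now apply (proj1 hF).
    + apply analytic_mul; [apply analytic_const|]. now apply (proj1 hF).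
  - exists 1. split; [lra|]. intros y hy. replace (y - 0)%C with y in hy by ring.
    assert (E : C_derive M y = (zf y / 4)%C).
    { apply cder_C_derive. apply cder_ext_loc with Yf (1 - Cmod y); [lra| |now apply cder_Yf].
      intros y' hy'. unfold Yf, M. rewrite branch_derive_zf; [ring|].
      pose proof (Cmod_le_minus_add y' y). lra. }
    rewrite E, (branch_zf y hy). unfold Cdiv. ring.
Qed.

(** A second solution: the equation is invariant under [x -> 1 - x]. *)
Let u x := F (1 - x)%C.
Let u' x := (- C_derive F (1 - x))%C.
Let V x := (x * (1 - x) * u' x)%C.

Lemma cder_one_minus x : cder (fun x => 1 - x)%C x (- (1))%C.
Proof. eapply cder_eq; [apply cder_sub; [apply cder_const|apply cder_id]|ring]. Qed.

Lemma cder_u x : ~ on_cut (1 - x)%C -> cder u x (u' x).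
Proof.
  intros hx. eapply cder_eq.
  - apply (cder_comp F (fun x => 1 - x)%C); [apply cder_one_minus|].
    apply analytic_cder. now apply (proj1 hF).
  - unfold u'. ring.
Qed.

Lemma cder_V x : ~ on_cut (1 - x)%C -> cder V x (u x / 4)%C.
Proof.
  intros hx. pose proof (cder_comp _ _ _ _ _ (cder_one_minus x) (branch_ode _ hx)) as h.
  apply cder_opp in h.
  eapply cder_ext; [|eapply cder_eq; [exact h|]].
  - intros y. unfold V, u'. cbv beta. ring.
  - unfold u, Cdiv. ring.
Qed.

(** The Wronskian of [zf] and [u] times [x (1 - x)], which the self-adjoint form of the equation
    makes constant. *)
Let W x := (V x * zf x - u x * Yf x)%C.

Lemma cder_W x : Cmod x < 1 -> ~ on_cut (1 - x)%C -> cder W x 0%C.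
Proof.
  intros hx hc. eapply cder_eq.
  - apply cder_sub; apply cder_mul;
      [now apply cder_V|now apply cder_zf|now apply cder_u|now apply cder_Yf].
  - unfold V, Yf, Cdiv. ring.
Qed.

(** The disc without [(-1, 0]] is star-shaped about 1/2; the natural centre 0 is itself excluded, as
    [1 - 0] lies on the cut. *)
Lemma cut_disc_segment x t : Cmod x < 1 -> ~ on_cut (1 - x)%C -> 0 <= t <= 1 ->
  Cmod (/ 2 + RtoC t * (x - / 2))%C < 1 /\ ~ on_cut (1 - (/ 2 + RtoC t * (x - / 2)))%C.
Proof.
  intros hx hc ht. split.
  - replace (/ 2 + RtoC t * (x - / 2))%C with (RtoC ((1 - t) / 2) + RtoC t * x)%C
      by (rewrite RtoC_div, RtoC_minus by lra; unfold Cdiv; ring).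
    eapply Rle_lt_trans; [apply Cmod_triangle|].
    rewrite Cmod_mult, !Cmod_R, !Rabs_pos_eq by lra. pose proof (Cmod_ge_0 x).
    destruct (Rle_lt_dec t (1 / 2)); nra.
  - intros [h1 h2]. apply hc. rewrite <- RtoC_inv in h1, h2 by lra.
    unfold on_cut, Re, Im in *. cbn in *.
    assert (ht0 : 0 < t) by (destruct (Req_dec t 0) as [E|E]; [rewrite E in *|]; lra).
    split; [apply Rmult_eq_reg_l with t; lra|nra].
Qed.

Lemma constant_on_cut_disc f x :
  (forall y, Cmod y < 1 -> ~ on_cut (1 - y)%C -> cder f y 0%C) ->
  Cmod x < 1 -> ~ on_cut (1 - x)%C -> f x = f (/ 2)%C.
Proof.
  intros H hx hc. apply cder_const_segment.
  - intros t ht. exists 0%C. destruct (cut_disc_segment x t hx hc ht). now apply H.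
  - intros t ht. destruct (cut_disc_segment x t hx hc ltac:(lra)). now apply H.
Qed.

Lemma real_not_on_cut r : 0 < r -> ~ on_cut (1 - RtoC r)%C.
Proof. intros hr [_ h]. cbn in h. lra. Qed.

Lemma Cmod_real_lt r : 0 < r < 1 -> Cmod (RtoC r) < 1.
Proof. intros hr. rewrite Cmod_R, Rabs_pos_eq; lra. Qed.

Lemma u_real r : 0 < r < 1 -> u (RtoC r) = zf (RtoC (1 - r)).
Proof.
  intros hr. unfold u. rewrite RtoC_minus. apply branch_zf.
  rewrite <- RtoC_minus. apply Cmod_real_lt. lra.
Qed.

(** The constant is read off as [x = r] decreases to 0. There [V z] tends to [- 1 / PI] by
    [lim0_Yf_reflected], while [u Y] contains the factor [r * zf (1 - r)], which tends to 0. *)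
Lemma W_value x : Cmod x < 1 -> ~ on_cut (1 - x)%C -> W x = RtoC (- / PI).
Proof.
  intros hx hc. rewrite (constant_on_cut_disc W x cder_W hx hc).
  apply lim0_unique with (fun r => W (RtoC r)).
  - apply lim0_ext with (fun _ => W (/ 2)%C); [|apply lim0_const].
    intros r hr. symmetry. apply (constant_on_cut_disc W _ cder_W).
    + now apply Cmod_real_lt.
    + apply real_not_on_cut. lra.
  - apply lim0_ext with (fun r => (- (1)) * (Yf (RtoC (1 - r)) * zf (RtoC r)) +
      (- (1)) * ((RtoC r * zf (RtoC (1 - r))) * ((1 - RtoC r) * zf' (RtoC r))))%C.
    + intros r hr. unfold W. rewrite u_real by exact hr. unfold V, u', Yf.
      rewrite RtoC_minus, branch_derive_zf by (rewrite <- RtoC_minus; apply Cmod_real_lt; lra).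
      ring.
    + replace (RtoC (- / PI)) with
        ((- (1)) * (RtoC (/ PI) * 1) + (- (1)) * (0 * ((1 - 0) * zf' 0)))%C by (rewrite RtoC_opp; ring).
      assert (h0 : Cmod 0 < 1) by (rewrite Cmod_0; lra).
      apply lim0_add; apply lim0_mul; try apply lim0_const; apply lim0_mul.
      * apply lim0_Yf_reflected.
      * apply (lim0_ccont zf); [eapply cder_ccont; now apply cder_zf|].
        unfold zf. now rewrite (PS_0 1) by (auto using good_zc; lra).
      * apply lim0_zf_reflected.
      * apply (lim0_ccont (fun y => (1 - y) * zf' y)%C); [|reflexivity].
        apply ccont_mul.
        -- eapply cder_ccont, cder_one_minus.
        -- apply (ccont_PS 1); [apply good_dcoef, good_zc|exact h0].
Qed.

Let E x := Cexp (- (PI * (u x / zf x)))%C.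
(** The quotient of [E] by [16 * nome]; its constant value fixes the normalization of the nome. *)
Let K x := (E x * Cexp (- sf x) / x)%C.

Lemma cut_disc_nz x : ~ on_cut (1 - x)%C -> x <> 0%C.
Proof. intros h ->. apply h. split; cbn; lra. Qed.

Lemma PI_C_nz : RtoC PI <> 0%C.
Proof. intro e. apply RtoC_inj in e. pose proof PI_RGT_0. lra. Qed.

(** The value [- 1 / PI] of [W] makes the logarithmic derivative of [E] equal to [ef x / x], that
    is, [1 / x] plus the derivative of [sf]. *)
Lemma cder_K x : Cmod x < 1 -> ~ on_cut (1 - x)%C -> cder K x 0%C.
Proof.
  intros hx hc. pose proof (cut_disc_nz x hc) as h0. pose proof (zf_nz x hx) as hz.
  pose proof (one_minus_nz x hx) as h1.
  destruct (cder_sf x hx) as (l & hl & El).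
  assert (Hq : cder (fun x => - (PI * (u x / zf x)))%C x (ef x / x)%C).
  { eapply cder_eq.
    - apply cder_opp, cder_mul; [apply cder_const|].
      apply cder_div; [now apply cder_u|now apply cder_zf|exact hz].
    - cbv beta. rewrite ef_eq by exact hx.
      assert (Ew : (u' x * zf x - u x * zf' x = RtoC (- / PI) / (x * (1 - x)))%C).
      { rewrite <- (W_value x hx hc). unfold W, V, Yf. field. auto. }
      rewrite Ew, RtoC_opp, RtoC_inv by (pose proof PI_RGT_0; lra).
      field. repeat split; auto using PI_C_nz. }
  eapply cder_eq.
  - apply cder_div; [|apply cder_id|exact h0].
    apply cder_mul; [apply (cder_exp_comp _ _ _ Hq)|].
    apply cder_exp_comp, cder_opp, hl.
  - cbv beta. fold (E x). rewrite El. field. exact h0.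
Qed.

Lemma E_eq x : Cmod x < 1 -> ~ on_cut (1 - x)%C -> E x = (K (/ 2) * x * Cexp (sf x))%C.
Proof.
  intros hx hc. rewrite <- (constant_on_cut_disc K x cder_K hx hc). unfold K.
  transitivity (E x * (Cexp (- sf x) * Cexp (sf x)))%C.
  - rewrite <- Cexp_add. replace (- sf x + sf x)%C with (RtoC 0) by ring. rewrite Cexp_0. ring.
  - field. now apply cut_disc_nz.
Qed.

(** Landen's formula is used twice: at [t] it relates [zf X] to [zf (t^2)], and at the complementary
    parameter [s], where [s^2 = 1 - X] and [landen s = 1 - t^2], it relates [zf (1 - t^2)] to
    [zf (1 - X)]. The quotient in the exponent is thereby halved from [t^2] to [X]. *)
Lemma E_landen t : 0 < t < 1 -> (E (landen (RtoC t)) ^ 2 = E (RtoC t ^ 2))%C.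
Proof.
  intros ht.
  set (X := 4 * t / (1 + t) ^ 2). set (s := (1 - t) / (1 + t)).
  assert (hp : 0 < (1 + t) ^ 2) by nra.
  assert (hX : 0 < X < 1).
  { pose proof (landen_real_bound t ltac:(lra)). fold X in H. split; [|lra].
    unfold X. apply Rdiv_lt_0_compat; lra. }
  assert (hs : 0 <= s < 1).
  { unfold s. split; [apply Rdiv_le_0_compat; lra|].
    apply Rmult_lt_reg_r with (1 + t); [lra|]. unfold Rdiv. rewrite Rmult_assoc, Rinv_l; lra. }
  assert (ht2 : 0 < t ^ 2 < 1) by nra.
  pose proof (landen_zf t ltac:(lra)) as L1.
  pose proof (landen_zf s hs) as L2.
  rewrite landen_real in L1 |- * by lra. rewrite landen_real in L2 by lra.
  fold X in L1 |- *. rewrite <- RtoC_pow in L1, L2 |- *.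
  replace (4 * s / (1 + s) ^ 2) with (1 - t ^ 2) in L2 by (unfold s; field; lra).
  replace (s ^ 2) with (1 - X) in L2 by (unfold s, X; field; lra).
  unfold E. replace (Cexp (- (PI * (u (RtoC X) / zf (RtoC X)))) ^ 2)%C
    with (Cexp (- (PI * (u (RtoC X) / zf (RtoC X)))) * Cexp (- (PI * (u (RtoC X) / zf (RtoC X)))))%C by ring.
  rewrite <- Cexp_add. f_equal. rewrite !u_real by lra. rewrite L1, L2.
  replace (1 + RtoC s)%C with (2 / (1 + RtoC t))%C.
  2:{ unfold s. rewrite RtoC_div by lra. rewrite RtoC_minus, RtoC_plus. field.
      apply one_plus_real_nz. lra. }
  field. split; [apply one_plus_real_nz; lra|]. apply zf_nz, Cmod_real_lt. exact ht2.
Qed.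

(** Insert [E x = K x exp (sf x)] into [E_landen]. As [t] tends to 0, [landen t] behaves like [4 t]
    and the exponentials tend to 1, which leaves [16 K^2 = K] with [K] nonzero. *)
Lemma K_value : K (/ 2)%C = (/ 16)%C.
Proof.
  set (k := K (/ 2)%C).
  assert (hk : forall t, 0 < t < 1 ->
    (16 * k * (Cexp (sf (landen (RtoC t))) * Cexp (sf (landen (RtoC t)))) =
     (1 + RtoC t) ^ 4 * Cexp (sf (RtoC t ^ 2)))%C).
  { intros t ht. pose proof (E_landen t ht) as H.
    assert (hX : Cmod (landen (RtoC t)) < 1) by (apply Cmod_landen_real; lra).
    assert (hcX : ~ on_cut (1 - landen (RtoC t))%C).
    { rewrite landen_real by lra. apply real_not_on_cut. apply Rdiv_lt_0_compat; nra. }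
    assert (h2 : Cmod (RtoC t ^ 2)%C < 1) by (apply Cmod_sqr_real; lra).
    assert (hc2 : ~ on_cut (1 - RtoC t ^ 2)%C).
    { rewrite <- RtoC_pow. apply real_not_on_cut. nra. }
    rewrite !E_eq in H by assumption. fold k in H.
    assert (k0 : k <> 0%C).
    { intro e. pose proof (E_eq _ h2 hc2) as e2. fold k in e2. rewrite e in e2.
      apply (Cexp_nz (- (PI * (u (RtoC t ^ 2) / zf (RtoC t ^ 2))))%C).
      change (E (RtoC t ^ 2)%C = 0%C). rewrite e2. ring. }
    assert (t0 : RtoC t <> 0%C) by (intro e; apply RtoC_inj in e; lra).
    pose proof (one_plus_real_nz t ltac:(lra)) as t1.
    set (e1 := Cexp (sf (landen (RtoC t)))) in *. set (e2 := Cexp (sf (RtoC t ^ 2)%C)) in *.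
    unfold landen in H.
    transitivity ((1 + RtoC t) ^ 4 / (k * RtoC t ^ 2) * (k * (4 * RtoC t / (1 + RtoC t) ^ 2) * e1) ^ 2)%C.
    - field. auto.
    - rewrite H. field. auto. }
  assert (h0 : Cmod 0 < 1) by (rewrite Cmod_0; lra).
  assert (e0 : landen 0 = 0%C) by (unfold landen; rewrite Cplus_0_r; field).
  assert (s0 : sf 0 = 0%C) by (unfold sf; now rewrite (PS_0 1) by (auto using good_scoef; lra)).
  assert (cs : ccont (fun y => Cexp (sf y)) 0%C).
  { destruct (cder_sf 0 h0) as (l & hl & _). eapply cder_ccont, cder_exp_comp, hl. }
  assert (cl : ccont (fun y => Cexp (sf (landen y))) 0%C).
  { apply (ccont_comp (fun y => Cexp (sf y)) landen).
    - eapply cder_ccont, cder_landen. rewrite Cplus_0_r. apply C1_nz.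
    - now rewrite e0. }
  assert (H16 : (16 * k)%C = 1%C).
  { apply lim0_unique with (fun t => (16 * k * (Cexp (sf (landen (RtoC t))) * Cexp (sf (landen (RtoC t)))))%C).
    - apply (lim0_ccont (fun t => 16 * k * (Cexp (sf (landen t)) * Cexp (sf (landen t))))%C).
      + apply ccont_mul; [apply ccont_const|now apply ccont_mul].
      + rewrite e0, s0, Cexp_0. ring.
    - apply lim0_ext with (fun t => (1 + RtoC t) ^ 4 * Cexp (sf (RtoC t ^ 2)))%C.
      + intros r hr. symmetry. now apply hk.
      + apply (lim0_ccont (fun t => (1 + t) ^ 4 * Cexp (sf (t ^ 2)))%C).
        * apply ccont_mul.
          -- apply ccont_ext_loc with (fun t => ((1 + t) * (1 + t)) * ((1 + t) * (1 + t)))%C 1;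
               [lra|intros; cbv beta; ring|].
             repeat apply ccont_mul; apply ccont_add; auto using ccont_const, ccont_id.
          -- apply (ccont_comp (fun y => Cexp (sf y)) (fun t => t ^ 2)%C).
             ++ eapply cder_ccont, cder_sqr, cder_id.
             ++ replace (0 ^ 2)%C with (RtoC 0) by ring. exact cs.
        * replace (0 ^ 2)%C with (RtoC 0) by ring. rewrite s0, Cexp_0. ring. }
  transitivity (16 * k / 16)%C; [field|]. rewrite H16. field.
Qed.

Lemma exp_branch_nome x : Cmod x < 1 -> ~ on_cut (1 - x)%C ->
  Cexp (- (PI * (F (1 - x) / zf x)))%C = nome x.
Proof.
  intros hx hc. change (E x = nome x). rewrite E_eq, K_value by assumption.
  unfold nome, Cdiv. ring.
Qed.

Lemma Cmod_nome_lt_1 x : Cmod x < 1 -> Cmod (nome x) < 1.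
Proof.
  (* This [r] is positive even for [x = 0], so [1 - r] is off the cut and the exponential formula
     applies at [r]. *)
  intros hx. pose proof (Cmod_ge_0 x) as p. set (r := (Cmod x + 1) / 2).
  assert (hr : 0 < r < 1) by (unfold r; lra).
  eapply Rle_lt_trans; [apply (nome_mono x r); unfold r; lra|].
  rewrite <- exp_branch_nome by (try apply real_not_on_cut; try apply Cmod_real_lt; lra).
  rewrite Cmod_Cexp. fold (u (RtoC r)). rewrite u_real by exact hr.
  destruct (PS_real_ge_1 r) as [a [ha ->]]; [lra|].
  destruct (PS_real_ge_1 (1 - r)) as [b [hb ->]]; [lra|].
  rewrite <- RtoC_div, <- RtoC_mult, <- RtoC_opp by lra. rewrite re_RtoC.
  rewrite <- exp_0. apply exp_increasing. pose proof PI_RGT_0.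
  assert (0 < PI * (b / a)) by (apply Rmult_lt_0_compat; [lra|]; apply Rdiv_lt_0_compat; lra). lra.
Qed.

(** Off the cut the exponential equals [nome], which is continuous at [x]; both sides pass to the
    limit along the vertical line through [1 - x]. The sign of [e] selects the side of the cut. *)
Lemma one_sided_branch_value_nome (e : R) (x v : C) : e <> 0 -> Cmod x < 1 -> Im x = 0 ->
  filterlim F (within (fun w : C => 0 < e * Im w) (locally (1 - x)%C)) (locally v) ->
  Cexp (- (PI * (v / zf x)))%C = nome x.
Proof.
  intros he hx ix hv. pose proof (zf_nz x hx) as hz.
  set (w := fun y : C => (1 - x + y * (RtoC e * Ci))%C).
  assert (Ew : forall r : R, Re (w (RtoC r)) = 1 - Re x /\ Im (w (RtoC r)) = e * r).
  { intros r. unfold w. destruct x as [a b]. cbn in ix. cbn. subst b. split; ring. }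
  assert (cw : ccont w 0%C).
  { eapply cder_ccont, cder_add; [apply cder_const|apply cder_mul; [apply cder_id|apply cder_const]]. }
  assert (w0 : w 0%C = (1 - x)%C) by (unfold w; ring).
  assert (c1 : ccont (fun y => 1 - w y)%C 0%C) by (apply ccont_add; [apply ccont_const|];
    apply ccont_ext_loc with (fun y => (- (1)) * w y)%C 1; [lra|intros; cbv beta; ring|];
    apply ccont_mul; [apply ccont_const|exact cw]).
  assert (x0 : (1 - w 0)%C = x) by (rewrite w0; ring).
  assert (LF : lim0 (fun r => F (w (RtoC r))) v).
  { apply lim0_of_eps. intros eps heps.
    assert (h2 : 0 < eps / 2) by lra.
    destruct (proj1 (filterlim_locally _ _) hv (mkposreal _ h2)) as [[d hd] Hd].
    set (d' := d / Rabs e). assert (pe : 0 < Rabs e) by now apply Rabs_pos_lt.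
    exists d'. split; [now apply Rdiv_lt_0_compat|]. intros r hr. destruct (Ew r) as [E1 E2].
    destruct (Hd (w (RtoC r))) as [h3 h4].
    - split.
      + change (Rabs (Re (w (RtoC r)) - Re (1 - x)%C) < d). rewrite E1. cbn.
        replace (1 - Re x - (1 + - fst x)) with 0 by (unfold Re; ring). rewrite Rabs_R0. exact hd.
      + change (Rabs (Im (w (RtoC r)) - Im (1 - x)%C) < d). rewrite E2.
        replace (Im (1 - x)%C) with 0 by (cbn; unfold Im in ix; rewrite ix; ring).
        rewrite Rminus_0_r, Rabs_mult, (Rabs_pos_eq r) by lra.
        apply Rlt_le_trans with (Rabs e * d'); [apply Rmult_lt_compat_l; lra|].
        right. unfold d'. field. lra.
    - rewrite E2. replace (e * (e * r)) with (e ^ 2 * r) by ring.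
      apply Rmult_lt_0_compat; [|lra]. now apply pow2_gt_0.
    - eapply Rle_lt_trans; [apply Cmod_le_parts|].
      change (Rabs (Re (F (w (RtoC r)) - v)%C) < eps / 2) in h3.
      change (Rabs (Im (F (w (RtoC r)) - v)%C) < eps / 2) in h4. lra. }
  (* This factor tends to 1 and exchanges the moving denominator for the fixed [zf x], so that a
     single function of [v'] remains to be composed with the limit. *)
  assert (Lz : lim0 (fun r => zf x * / zf (1 - w (RtoC r)))%C (zf x * / zf x)%C).
  { apply (lim0_ccont (fun y => zf x * / zf (1 - w y))%C); [|now rewrite x0].
    apply ccont_mul; [apply ccont_const|].
    apply (ccont_inv (fun y => zf (1 - w y)%C)); [|now rewrite x0].
    apply (ccont_comp zf (fun y => 1 - w y)%C); [exact c1|].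
    rewrite x0. eapply cder_ccont, cder_zf, hx. }
  assert (Ln : lim0 (fun r => nome (1 - w (RtoC r))%C) (nome x)).
  { apply (lim0_ccont (fun y => nome (1 - w y)%C)); [|now rewrite x0].
    apply (ccont_comp nome (fun y => 1 - w y)%C); [exact c1|].
    rewrite x0. eapply cder_ccont, cder_nome, hx. }
  pose proof (lim0_mul _ _ _ _ LF Lz) as LP.
  replace (v * (zf x * / zf x))%C with v in LP by (field; exact hz).
  assert (cP : ccont (fun v' => Cexp (- (PI * (v' / zf x))))%C v).
  { eapply cder_ccont, cder_exp_comp, cder_opp, cder_mul; [apply cder_const|].
    apply cder_div; [apply cder_id|apply cder_const|exact hz]. }
  pose proof (lim0_comp _ _ _ cP LP) as LQ. cbv beta in LQ.
  refine (lim0_unique _ _ _ LQ _).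
  destruct (c1 (1 - Cmod x)) as [d [hd Hd]]; [lra|].
  apply (lim0_ext_loc (fun r => nome (1 - w (RtoC r))%C) _ _ d hd); [|exact Ln].
  intros r hr. destruct (Ew r) as [E1 E2].
  assert (hx' : Cmod (1 - w (RtoC r))%C < 1).
  { specialize (Hd (RtoC r)). cbv beta in Hd. rewrite x0 in Hd.
    replace (RtoC r - 0)%C with (RtoC r) in Hd by ring.
    rewrite Cmod_R, Rabs_pos_eq in Hd by lra. specialize (Hd ltac:(lra)).
    pose proof (Cmod_le_minus_add (1 - w (RtoC r))%C x). lra. }
  rewrite <- exp_branch_nome.
  - replace (1 - (1 - w (RtoC r)))%C with (w (RtoC r)) by ring. f_equal.
    field. split; [now apply zf_nz|exact hz].
  - exact hx'.
  - replace (1 - (1 - w (RtoC r)))%C with (w (RtoC r)) by ring. intros [h _]. rewrite E2 in h.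
    apply Rmult_integral in h. lra.
Qed.

Lemma branch_value_nome (x v : C) : 0 < Cmod x < 1 -> branch_value F (1 - x)%C v ->
  Cexp (- (PI * (v / zf x)))%C = nome x.
Proof.
  intros hx [[hc ->]|[[hi _] hv]]; [apply exp_branch_nome; [lra|exact hc]|].
  assert (ix : Im x = 0) by (cbn in hi; unfold Im; lra).
  destruct hv as [hv|hv].
  - apply (one_sided_branch_value_nome 1); [intro; lra|lra|exact ix|].
    revert hv. apply filterlim_filter_le_1. intros P. unfold within. apply filter_imp.
    intros w h hw. apply h. lra.
  - apply (one_sided_branch_value_nome (-1)); [intro; lra|lra|exact ix|].
    revert hv. apply filterlim_filter_le_1. intros P. unfold within. apply filter_imp.
    intros w h hw. apply h. lra.
Qed.
End Continuation.

(** * Liouville's identity and convolution sums *)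

Definition Zs {A : Type} (f : A -> Z) (l : list A) : Z := Zsum (map f l).

Lemma Zs_cons {A} (f : A -> Z) x l : Zs f (x :: l) = (f x + Zs f l)%Z.
Proof. reflexivity. Qed.

Lemma Zs_app {A} (f : A -> Z) l l' : Zs f (l ++ l') = (Zs f l + Zs f l')%Z.
Proof. induction l as [|x l IH]; [reflexivity|]. cbn [app]. rewrite !Zs_cons, IH. lia. Qed.

Lemma Zs_ext {A} (f g : A -> Z) l : (forall x, In x l -> f x = g x) -> Zs f l = Zs g l.
Proof.
  induction l as [|x l IH]; intros h; [reflexivity|]. rewrite !Zs_cons, IH by auto with datatypes.
  now rewrite h by auto with datatypes.
Qed.

Lemma Zs_add {A} (f g : A -> Z) l : Zs (fun x => f x + g x)%Z l = (Zs f l + Zs g l)%Z.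
Proof. induction l as [|x l IH]; [reflexivity|]. rewrite !Zs_cons, IH. lia. Qed.

Lemma Zs_scal {A} (c : Z) (f : A -> Z) l : Zs (fun x => c * f x)%Z l = (c * Zs f l)%Z.
Proof. induction l as [|x l IH]; [unfold Zs; simpl; lia|]. rewrite !Zs_cons, IH. lia. Qed.

Lemma Zs_zero {A} (f : A -> Z) l : (forall x, In x l -> f x = 0%Z) -> Zs f l = 0%Z.
Proof.
  intros h. rewrite (Zs_ext f (fun _ => 0 * 0)%Z) by exact h. now rewrite Zs_scal.
Qed.

Lemma Zs_map {A B} (h : A -> B) (f : B -> Z) l : Zs f (map h l) = Zs (fun x => f (h x)) l.
Proof. unfold Zs. now rewrite map_map. Qed.

Lemma Zs_filter {A} (p : A -> bool) (f : A -> Z) l :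
  Zs f (filter p l) = Zs (fun x => if p x then f x else 0%Z) l.
Proof.
  induction l as [|x l IH]; [reflexivity|]. cbn [filter]. rewrite (Zs_cons (fun x => if p x then f x else 0%Z)).
  destruct (p x); [now rewrite Zs_cons, IH|now rewrite IH].
Qed.

Lemma Zs_list_prod {A B} (f : A * B -> Z) l l' :
  Zs f (list_prod l l') = Zs (fun x => Zs (fun y => f (x, y)) l') l.
Proof.
  induction l as [|x l IH]; [reflexivity|]. cbn [list_prod].
  now rewrite Zs_app, Zs_map, Zs_cons, IH.
Qed.

Lemma Zs_bij {A B} (h : A -> B) (k : B -> A) (f : B -> Z) l l' :
  NoDup l -> NoDup l' -> (forall x, In x l -> In (h x) l' /\ k (h x) = x) ->
  (forall y, In y l' -> In (k y) l /\ h (k y) = y) -> Zs (fun x => f (h x)) l = Zs f l'.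
Proof.
  intros n n' H H'. rewrite <- (Zs_map h f). unfold Zs.
  assert (P : Permutation (map h l) l').
  { apply NoDup_Permutation; [|exact n'|].
    - apply NoDup_map_NoDup_ForallPairs; [|exact n]. intros x y hx hy e.
      rewrite <- (proj2 (H x hx)), <- (proj2 (H y hy)). now rewrite e.
    - intros y. rewrite in_map_iff. split.
      + intros (x & <- & hx). now apply H.
      + intros hy. exists (k y). destruct (H' y hy). auto. }
  apply (Permutation_map f) in P. revert P. generalize (map f (map h l)) (map f l'). clear.
  intros l l' P. unfold Zsum. induction P; simpl; lia.
Qed.

Lemma NoDup_list_prod {A B} (l : list A) (l' : list B) : NoDup l -> NoDup l' -> NoDup (list_prod l l').
Proof.
  intros n n'. induction n as [|x l hx n IH]; [constructor|]. cbn [list_prod].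
  apply NoDup_app; [|exact IH|].
  - apply NoDup_map_NoDup_ForallPairs; [|exact n']. intros y z _ _ e. congruence.
  - intros [a b] h1 h2. apply in_map_iff in h1. destruct h1 as (y & e & _).
    apply in_prod_iff in h2. injection e as <- <-. now apply hx.
Qed.

Notation quad := ((nat * nat) * (nat * nat))%type.

(** The range from 1 to [n] loses no solution of [a x + b y = n] in positive integers. *)
Definition quads (n : nat) : list quad :=
  filter (fun '((a, b), (x, y)) => (a * x + b * y =? n)%nat)
    (list_prod (list_prod (seq 1 n) (seq 1 n)) (list_prod (seq 1 n) (seq 1 n))).

Lemma in_quads n a b x y : In ((a, b), (x, y)) (quads n) <->
  (1 <= a /\ 1 <= b /\ 1 <= x /\ 1 <= y /\ a * x + b * y = n)%nat.
Proof.
  unfold quads. rewrite filter_In, !in_prod_iff, !in_seq, Nat.eqb_eq. split; [lia|].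
  intros h. repeat split; nia.
Qed.

Lemma NoDup_quads n : NoDup (quads n).
Proof. apply NoDup_filter. repeat apply NoDup_list_prod; apply seq_NoDup. Qed.

Lemma quads_bij n (p p' : quad -> bool) (h k : quad -> quad) (f : quad -> Z) :
  (forall t, In t (quads n) -> p t = true -> In (h t) (quads n) /\ p' (h t) = true /\ k (h t) = t) ->
  (forall t, In t (quads n) -> p' t = true -> In (k t) (quads n) /\ p (k t) = true /\ h (k t) = t) ->
  Zs (fun t => f (h t)) (filter p (quads n)) = Zs f (filter p' (quads n)).
Proof.
  intros H H'. apply Zs_bij with k; try apply NoDup_filter, NoDup_quads.
  - intros t. rewrite !filter_In. intros [h1 h2]. destruct (H t h1 h2) as (h3 & h4 & h5). auto.
  - intros t. rewrite !filter_In. intros [h1 h2]. destruct (H' t h1 h2) as (h3 & h4 & h5). auto.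
Qed.

Definition altb (t : quad) : bool := let '((a, b), _) := t in (a <? b)%nat.
Definition beqa (t : quad) : bool := let '((a, b), _) := t in (a =? b)%nat.
Definition blta (t : quad) : bool := let '((a, b), _) := t in (b <? a)%nat.
Definition xlty (t : quad) : bool := let '(_, (x, y)) := t in (x <? y)%nat.
Definition xeqy (t : quad) : bool := let '(_, (x, y)) := t in (x =? y)%nat.
Definition yltx (t : quad) : bool := let '(_, (x, y)) := t in (y <? x)%nat.
Definition swap_terms (t : quad) : quad := let '((a, b), (x, y)) := t in ((b, a), (y, x)).

Lemma Zs_trichotomy {A} (p q r : A -> bool) (f : A -> Z) l :
  (forall t, (if p t then 1 else 0) + (if q t then 1 else 0) + (if r t then 1 else 0) = 1)%nat ->
  Zs f l = (Zs f (filter p l) + Zs f (filter q l) + Zs f (filter r l))%Z.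
Proof.
  intros h. rewrite !Zs_filter, <- !Zs_add. apply Zs_ext. intros t _. specialize (h t).
  destruct (p t), (q t), (r t); lia.
Qed.

Lemma Zs_tri_ab (f : quad -> Z) l :
  Zs f l = (Zs f (filter altb l) + Zs f (filter beqa l) + Zs f (filter blta l))%Z.
Proof.
  apply Zs_trichotomy. intros [[a b] [x y]]. unfold altb, beqa, blta.
  destruct (Nat.ltb_spec a b), (Nat.eqb_spec a b), (Nat.ltb_spec b a); lia.
Qed.

Lemma Zs_tri_xy (f : quad -> Z) l :
  Zs f l = (Zs f (filter xlty l) + Zs f (filter xeqy l) + Zs f (filter yltx l))%Z.
Proof.
  apply Zs_trichotomy. intros [[a b] [x y]]. unfold xlty, xeqy, yltx.
  destruct (Nat.ltb_spec x y), (Nat.eqb_spec x y), (Nat.ltb_spec y x); lia.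
Qed.

Ltac quad_cases :=
  intros [[? ?] [? ?]]; unfold altb, blta, xlty, yltx, swap_terms; rewrite ?in_quads, ?Nat.ltb_lt, ?Nat.eqb_eq; intros;
  repeat split; try (repeat f_equal); nia.

Lemma Zs_swap_ab n (f : quad -> Z) :
  Zs (fun t => f (swap_terms t)) (filter blta (quads n)) = Zs f (filter altb (quads n)).
Proof. apply quads_bij with swap_terms; quad_cases. Qed.

Lemma Zs_swap_xy n (f : quad -> Z) :
  Zs (fun t => f (swap_terms t)) (filter xlty (quads n)) = Zs f (filter yltx (quads n)).
Proof. apply quads_bij with swap_terms; quad_cases. Qed.

(** [a x + b y = a (x - y) + (a + b) y]. *)
Lemma Zs_shear n (f : quad -> Z) :
  Zs (fun t => f (let '((a, b), (x, y)) := t in ((a, a + b), (x - y, y)))%nat) (filter yltx (quads n))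
  = Zs f (filter altb (quads n)).
Proof.
  apply quads_bij with (fun t => let '((a, b), (x, y)) := t in ((a, b - a), (x + y, y)))%nat; quad_cases.
Qed.

(** [a x + b y = (a - b) x + b (x + y)]. *)
Lemma Zs_shear' n (f : quad -> Z) :
  Zs (fun t => f (let '((a, b), (x, y)) := t in ((a - b, b), (x, x + y)))%nat) (filter blta (quads n))
  = Zs f (filter xlty (quads n)).
Proof.
  apply quads_bij with (fun t => let '((a, b), (x, y)) := t in ((a + b, b), (x, y - x)))%nat; quad_cases.
Qed.

Definition on_b (f : Z -> Z) (t : quad) : Z := let '((a, b), _) := t in f (Z.of_nat b).
Definition on_sum (f : Z -> Z) (t : quad) : Z := let '((a, b), _) := t in f (Z.of_nat a + Z.of_nat b)%Z.
Definition on_diff (f : Z -> Z) (t : quad) : Z := let '((a, b), _) := t in f (Z.of_nat a - Z.of_nat b)%Z.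

(** The shears turn the off-diagonal parts of both sums into sums of [f b], over [y < x] for the
    differences and over [a < b] for the sums. Expanding the full sum of [f b] by either trichotomy
    shows that these two differ only by the diagonals [a = b] and [x = y]. *)
Lemma liouville_quads n (f : Z -> Z) : (forall m, f (- m) = f m)%Z -> f 0%Z = 0%Z ->
  (Zs (on_diff f) (quads n) - Zs (on_sum f) (quads n) =
   2 * Zs (on_b f) (filter beqa (quads n)) - 2 * Zs (on_b f) (filter xeqy (quads n))
   - Zs (on_sum f) (filter xeqy (quads n)))%Z.
Proof.
  intros even f0.
  assert (D0 : Zs (on_diff f) (filter beqa (quads n)) = 0%Z).
  { apply Zs_zero. intros [[a b] [x y]]. rewrite filter_In. unfold beqa. rewrite Nat.eqb_eq.
    intros [_ ->]. cbn. now rewrite Z.sub_diag. }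
  assert (D1 : Zs (on_diff f) (filter blta (quads n)) = Zs (on_diff f) (filter altb (quads n))).
  { rewrite <- Zs_swap_ab. apply Zs_ext. intros [[a b] [x y]] _. cbn.
    rewrite <- even. f_equal. lia. }
  assert (D2 : Zs (on_diff f) (filter altb (quads n)) = Zs (on_b f) (filter yltx (quads n))).
  { rewrite <- Zs_shear. apply Zs_ext. intros [[a b] [x y]] _. cbn.
    rewrite <- even. f_equal. lia. }
  assert (S1 : Zs (on_sum f) (filter xlty (quads n)) = Zs (on_sum f) (filter yltx (quads n))).
  { rewrite <- Zs_swap_xy. apply Zs_ext. intros [[a b] [x y]] _. cbn. f_equal. lia. }
  assert (S2 : Zs (on_sum f) (filter yltx (quads n)) = Zs (on_b f) (filter altb (quads n))).
  { rewrite <- Zs_shear. apply Zs_ext. intros [[a b] [x y]] _. cbn. f_equal. lia. }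
  assert (B1 : Zs (on_b f) (filter blta (quads n)) = Zs (on_b f) (filter xlty (quads n))).
  { rewrite <- Zs_shear'. apply Zs_ext. intros [[a b] [x y]] _. reflexivity. }
  pose proof (Zs_tri_ab (on_diff f) (quads n)). pose proof (Zs_tri_xy (on_sum f) (quads n)).
  pose proof (Zs_tri_ab (on_b f) (quads n)). pose proof (Zs_tri_xy (on_b f) (quads n)).
  lia.
Qed.

(** * The diagonals as sums over factorizations *)

Definition pairs (n : nat) : list (nat * nat) :=
  filter (fun '(d, e) => (d * e =? n)%nat) (list_prod (seq 1 n) (seq 1 n)).

Lemma in_pairs n d e : In (d, e) (pairs n) <-> (1 <= d /\ 1 <= e /\ d * e = n)%nat.
Proof.
  unfold pairs. rewrite filter_In, !in_prod_iff, !in_seq, Nat.eqb_eq. split; [lia|].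
  intros h. repeat split; nia.
Qed.

Lemma NoDup_pairs n : NoDup (pairs n).
Proof. apply NoDup_filter. repeat apply NoDup_list_prod; apply seq_NoDup. Qed.

(** A solution on a diagonal is a factorization [d e = n] with a splitting of one factor: of
    [e = x + y] when [a = b], and of [d = a + b] when [x = y]. The entry [l] is one part of that
    splitting. *)
Definition below (g : nat * nat -> nat) (n : nat) : list ((nat * nat) * nat) :=
  filter (fun '(t, l) => (l <? g t)%nat) (list_prod (pairs n) (seq 1 n)).

Lemma NoDup_below g n : NoDup (below g n).
Proof. apply NoDup_filter, NoDup_list_prod; [apply NoDup_pairs|apply seq_NoDup]. Qed.

Lemma in_below_fst n d e l : In ((d, e), l) (below fst n) <->
  (1 <= d /\ 1 <= e /\ d * e = n /\ 1 <= l < d)%nat.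
Proof.
  unfold below. rewrite filter_In, in_prod_iff, in_pairs, in_seq, Nat.ltb_lt. cbn [fst snd]. nia.
Qed.

Lemma in_below_snd n d e l : In ((d, e), l) (below snd n) <->
  (1 <= d /\ 1 <= e /\ d * e = n /\ 1 <= l < e)%nat.
Proof.
  unfold below. rewrite filter_In, in_prod_iff, in_pairs, in_seq, Nat.ltb_lt. cbn [fst snd]. nia.
Qed.

Lemma Zs_seq_below (f : nat -> Z) n e : (1 <= e <= n)%nat ->
  Zs (fun l => if (l <? e)%nat then f l else 0%Z) (seq 1 n) = Zs f (seq 1 (e - 1)).
Proof.
  intros h. replace n with ((e - 1) + (n - (e - 1)))%nat at 1 by lia.
  rewrite seq_app, Zs_app. rewrite (Zs_zero _ (seq (1 + (e - 1)) _)).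
  - rewrite Z.add_0_r. apply Zs_ext. intros l. rewrite in_seq. intros hl.
    destruct (Nat.ltb_spec l e); [reflexivity|lia].
  - intros l. rewrite in_seq. intros hl. destruct (Nat.ltb_spec l e); [lia|reflexivity].
Qed.

Lemma Zs_below (g : nat * nat -> nat) (f : nat * nat -> nat -> Z) n :
  (forall d e, In (d, e) (pairs n) -> 1 <= g (d, e) <= n)%nat ->
  Zs (fun '(t, l) => f t l) (below g n) = Zs (fun t => Zs (f t) (seq 1 (g t - 1))) (pairs n).
Proof.
  intros h. unfold below. rewrite Zs_filter, Zs_list_prod. apply Zs_ext. intros [d e] ht.
  apply Zs_seq_below. now apply h.
Qed.

Lemma Zs_const {A} (c : Z) (l : list A) : Zs (fun _ => c) l = (Z.of_nat (length l) * c)%Z.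
Proof.
  induction l as [|x l IH]; [reflexivity|]. rewrite Zs_cons, IH. cbn [length]. lia.
Qed.

Lemma Zs_beqa n (f : Z -> Z) : Zs (on_b f) (filter beqa (quads n)) =
  Zs (fun '(d, e) => (Z.of_nat e - 1) * f (Z.of_nat d))%Z (pairs n).
Proof.
  transitivity (Zs (fun '(t, l) => f (Z.of_nat (fst t))) (below snd n)).
  - symmetry. rewrite <- (Zs_bij (fun '((a, b), (x, y)) => ((a, x + y), x))%nat
      (fun '((d, e), l) => ((d, d), (l, e - l)))%nat _ (filter beqa (quads n)) (below snd n)).
    + apply Zs_ext. intros [[a b] [x y]]. rewrite filter_In. unfold beqa. rewrite Nat.eqb_eq.
      intros [_ ->]. reflexivity.
    + apply NoDup_filter, NoDup_quads.
    + apply NoDup_below.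
    + intros [[a b] [x y]]. rewrite filter_In, in_quads, in_below_snd. unfold beqa. rewrite Nat.eqb_eq.
      intros [h ->]. split; [nia|]. repeat f_equal; lia.
    + intros [[d e] l]. rewrite filter_In, in_quads, in_below_snd. unfold beqa. rewrite Nat.eqb_eq.
      intros h. split; [split; [nia|reflexivity]|]. repeat f_equal; lia.
  - rewrite (Zs_below snd (fun t l => f (Z.of_nat (fst t)))).
    + apply Zs_ext. intros [d e]. rewrite in_pairs. intros h. rewrite Zs_const, length_seq. cbn [fst snd].
      rewrite Nat2Z.inj_sub by lia. reflexivity.
    + intros d e. rewrite in_pairs. cbn. nia.
Qed.

Lemma Zs_xeqy n (h : nat -> nat -> Z) :
  Zs (fun '((a, b), _) => h b (a + b)%nat) (filter xeqy (quads n)) =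
  Zs (fun '(d, e) => Zs (fun l => h l d) (seq 1 (d - 1))) (pairs n).
Proof.
  transitivity (Zs (fun '(t, l) => h l (fst t)) (below fst n)).
  - symmetry. rewrite <- (Zs_bij (fun '((a, b), (x, y)) => ((a + b, x), b))%nat
      (fun '((d, e), l) => ((d - l, l), (e, e)))%nat _ (filter xeqy (quads n)) (below fst n)).
    + apply Zs_ext. intros [[a b] [x y]] _. reflexivity.
    + apply NoDup_filter, NoDup_quads.
    + apply NoDup_below.
    + intros [[a b] [x y]]. rewrite filter_In, in_quads, in_below_fst. unfold xeqy. rewrite Nat.eqb_eq.
      intros [q ->]. split; [nia|]. repeat f_equal; lia.
    + intros [[d e] l]. rewrite filter_In, in_quads, in_below_fst. unfold xeqy. rewrite Nat.eqb_eq.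
      intros q. split; [split; [nia|reflexivity]|]. repeat f_equal; lia.
  - rewrite (Zs_below fst (fun t l => h l (fst t))).
    + apply Zs_ext. intros [d e] _. reflexivity.
    + intros d e. rewrite in_pairs. cbn. nia.
Qed.

Lemma liouville_pairs n (f : Z -> Z) : (forall m, f (- m) = f m)%Z -> f 0%Z = 0%Z ->
  (Zs (on_diff f) (quads n) - Zs (on_sum f) (quads n) =
   Zs (fun '(d, e) => (2 * Z.of_nat e - 1 - Z.of_nat d) * f (Z.of_nat d)
     - 2 * Zs (fun l => f (Z.of_nat l)) (seq 1 (d - 1))) (pairs n))%Z.
Proof.
  intros even f0. rewrite liouville_quads by assumption.
  rewrite Zs_beqa.
  assert (E1 : Zs (on_b f) (filter xeqy (quads n)) =
    Zs (fun '(d, e) => Zs (fun l => f (Z.of_nat l)) (seq 1 (d - 1))) (pairs n)).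
  { rewrite <- (Zs_xeqy n (fun l d => f (Z.of_nat l))). apply Zs_ext. intros [[a b] [x y]] _. reflexivity. }
  assert (E2 : Zs (on_sum f) (filter xeqy (quads n)) =
    Zs (fun '(d, e) => (Z.of_nat d - 1) * f (Z.of_nat d))%Z (pairs n)).
  { transitivity (Zs (fun '((a, b), _) => f (Z.of_nat (a + b))) (filter xeqy (quads n))).
    - apply Zs_ext. intros [[a b] [x y]] _. cbn. f_equal. lia.
    - rewrite (Zs_xeqy n (fun l d => f (Z.of_nat d))). apply Zs_ext. intros [d e].
      rewrite in_pairs. intros h. rewrite Zs_const, length_seq, Nat2Z.inj_sub by lia. reflexivity. }
  rewrite E1, E2. rewrite <- (Zs_scal 2), <- (Zs_scal 2).
  enough (G : forall (u v w t : nat * nat -> Z) l, (forall p, t p = u p - v p - w p)%Z ->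
    (Zs u l - Zs v l - Zs w l = Zs t l)%Z).
  { apply G. intros [d e]. ring. }
  intros u v w t l h. induction l as [|p l IH]; [reflexivity|].
  rewrite !Zs_cons, h. lia.
Qed.

(** * Divisor sums and their convolutions *)

Lemma in_divisors n d : In d (divisors n) <-> (1 <= d <= n /\ n mod d = 0)%nat.
Proof. unfold divisors. rewrite filter_In, in_seq, Nat.eqb_eq. lia. Qed.

Lemma NoDup_divisors n : NoDup (divisors n).
Proof. apply NoDup_filter, seq_NoDup. Qed.

Lemma mod_0_div n d : (d <> 0)%nat -> (n mod d = 0)%nat -> (d * (n / d) = n)%nat.
Proof. intros hd h. pose proof (Nat.div_mod_eq n d). lia. Qed.

Lemma in_divisors_mul n d : In d (divisors n) <-> exists e, (1 <= d /\ 1 <= e /\ d * e = n)%nat.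
Proof.
  rewrite in_divisors. split.
  - intros [h1 h2]. exists (n / d)%nat. pose proof (mod_0_div n d ltac:(lia) h2). nia.
  - intros (e & h1 & h2 & <-). split; [nia|]. rewrite Nat.mul_comm. apply Nat.Div0.mod_mul.
Qed.

Definition dsum (f : Z -> Z) (n : nat) : Z := Zs (fun d => f (Z.of_nat d)) (divisors n).

Lemma Zs_pairs_divisors n (h : nat -> Z) : Zs (fun '(d, e) => h d) (pairs n) = Zs h (divisors n).
Proof.
  rewrite <- (Zs_bij fst (fun d => (d, n / d))%nat h (pairs n) (divisors n)).
  - apply Zs_ext. now intros [d e].
  - apply NoDup_pairs.
  - apply NoDup_divisors.
  - intros [d e]. rewrite in_pairs, in_divisors_mul. intros (h1 & h2 & h3). cbn [fst]. split; [eauto|].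
    rewrite <- h3, Nat.mul_comm, Nat.div_mul by lia. reflexivity.
  - intros d. rewrite in_divisors_mul, in_pairs. intros (e & h1 & h2 & h3).
    rewrite <- h3, Nat.mul_comm, Nat.div_mul by lia. cbn [fst]. split; [lia|reflexivity].
Qed.

(** The test [a <= k] rules out [k = 0], which every positive [a] divides although [divisors 0] is
    empty. *)
Definition dividesb (a k : nat) : bool := ((a <=? k)%nat && (k mod a =? 0)%nat)%bool.

Lemma Zs_dividesb n k (f : nat -> Z) : (k <= n)%nat ->
  Zs (fun d => if dividesb d k then f d else 0%Z) (seq 1 n) = Zs f (divisors k).
Proof.
  intros h. replace n with (k + (n - k))%nat by lia. rewrite seq_app, Zs_app.
  rewrite (Zs_zero _ (seq (1 + k) _)).
  - rewrite Z.add_0_r. unfold divisors. rewrite Zs_filter. apply Zs_ext. intros d.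
    rewrite in_seq. intros hd. unfold dividesb. destruct (Nat.leb_spec d k); [reflexivity|lia].
  - intros d. rewrite in_seq. intros hd. unfold dividesb. destruct (Nat.leb_spec d k); [lia|reflexivity].
Qed.

Lemma Zs_mul {A B} (f : A -> Z) (g : B -> Z) l l' :
  Zs (fun x => Zs (fun y => f x * g y)%Z l') l = (Zs f l * Zs g l')%Z.
Proof.
  induction l as [|x l IH]; [reflexivity|]. rewrite !Zs_cons, IH, Zs_scal. ring.
Qed.

(** The end terms vanish, as [divisors 0] is empty; keeping them gives the shape of a Cauchy
    product. *)
Definition dconv (f g : Z -> Z) (n : nat) : Z := Zs (fun k => dsum f k * dsum g (n - k))%Z (seq 0 (S n)).

(** Group the solutions by [k = a x]: then [a] divides [k], [b] divides [n - k], and the cofactors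
    [x] and [y] are determined. *)
Lemma quads_dconv n (f g : Z -> Z) :
  Zs (fun '((a, b), _) => f (Z.of_nat a) * g (Z.of_nat b))%Z (quads n) = dconv f g n.
Proof.
  set (T := filter (fun '(k, (a, b)) => (dividesb a k && dividesb b (n - k)%nat)%bool)
    (list_prod (seq 0 (S n)) (list_prod (seq 1 n) (seq 1 n)))).
  transitivity (Zs (fun '(k, (a, b)) => f (Z.of_nat a) * g (Z.of_nat b))%Z T).
  - rewrite <- (Zs_bij (fun '((a, b), (x, y)) => (a * x, (a, b)))%nat
      (fun '(k, (a, b)) => ((a, b), (k / a, (n - k) / b)))%nat _ (quads n) T).
    + apply Zs_ext. now intros [[a b] [x y]].
    + apply NoDup_quads.
    + apply NoDup_filter. repeat apply NoDup_list_prod; apply seq_NoDup.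
    + intros [[a b] [x y]]. rewrite in_quads. unfold T. rewrite filter_In, !in_prod_iff, !in_seq.
      intros h. assert (e : (n - a * x = b * y)%nat) by lia. rewrite e. unfold dividesb.
      rewrite !(Nat.mul_comm a), !(Nat.mul_comm b), !Nat.Div0.mod_mul, !Nat.div_mul by lia.
      split; [|reflexivity]. split; [nia|].
      destruct (Nat.leb_spec a (x * a)), (Nat.leb_spec b (y * b)); try reflexivity; nia.
    + intros [k [a b]]. unfold T. rewrite filter_In, !in_prod_iff, !in_seq, in_quads. unfold dividesb.
      rewrite !Bool.andb_true_iff, !Nat.leb_le, !Nat.eqb_eq.
      intros (h1 & [h2 h3] & [h4 h5]). pose proof (mod_0_div k a ltac:(lia) h3) as e1.
      pose proof (mod_0_div (n - k) b ltac:(lia) h5) as e2.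
      split; [nia|]. repeat f_equal. exact e1.
  - unfold T, dconv. rewrite Zs_filter, Zs_list_prod. apply Zs_ext. intros k. rewrite in_seq. intros hk.
    rewrite Zs_list_prod. unfold dsum. rewrite <- (Zs_dividesb n k), <- (Zs_dividesb n (n - k)) by lia.
    rewrite <- Zs_mul. apply Zs_ext. intros a _. apply Zs_ext. intros b _.
    destruct (dividesb a k), (dividesb b (n - k)); cbn; ring.
Qed.

Lemma dconv_comm f g n : dconv f g n = dconv g f n.
Proof.
  rewrite <- !quads_dconv.
  rewrite <- (Zs_bij swap_terms swap_terms (fun '((a, b), _) => g (Z.of_nat a) * f (Z.of_nat b))%Z
    (quads n) (quads n) (NoDup_quads n) (NoDup_quads n)).
  - apply Zs_ext. intros [[a b] [x y]] _. cbn. ring.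
  - intros [[a b] [x y]]. rewrite in_quads. cbn. rewrite in_quads. intros h. split; [lia|reflexivity].
  - intros [[a b] [x y]]. rewrite in_quads. cbn. rewrite in_quads. intros h. split; [lia|reflexivity].
Qed.

(** * The four convolution formulas *)

(** The sign [(-1)^m] for negative [m] too, where [Z.pow] would return 0: Liouville's identity
    evaluates [f] at negative differences. *)
Definition alt (m : Z) : Z := if Z.even m then 1%Z else (-1)%Z.

Lemma alt_opp m : alt (- m) = alt m.
Proof. unfold alt. now rewrite Z.even_opp. Qed.

Lemma alt_add a b : alt (a + b) = (alt a * alt b)%Z.
Proof. unfold alt. rewrite Z.even_add. now destruct (Z.even a), (Z.even b). Qed.

Lemma alt_sub a b : alt (a - b) = (alt a * alt b)%Z.
Proof. unfold Z.sub. now rewrite alt_add, alt_opp. Qed.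

Lemma alt_succ a : alt (a + 1) = (- alt a)%Z.
Proof. rewrite alt_add. change (alt 1) with (-1)%Z. ring. Qed.

(** The summation formula is [g / c]; the factor [c] clears its denominator. *)
Lemma Zs_seq_closed (f g : Z -> Z) (c : Z) : g 0%Z = 0%Z ->
  (forall m, (0 <= m -> g m + c * f (m + 1) = g (m + 1))%Z) ->
  forall N, (c * Zs (fun l => f (Z.of_nat l)) (seq 1 N) = g (Z.of_nat N))%Z.
Proof.
  intros g0 h. induction N as [|N IH]; [change (Z.of_nat 0) with 0%Z; rewrite g0; unfold Zs; cbn; ring|].
  rewrite seq_S, Zs_app, Z.mul_add_distr_l, IH. unfold Zs. cbn [map Zsum fold_right].
  rewrite Z.add_0_r. replace (Z.of_nat (1 + N)) with (Z.of_nat N + 1)%Z by lia.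
  rewrite h by lia. f_equal. lia.
Qed.

Lemma dsum_add f g n : dsum (fun d => f d + g d)%Z n = (dsum f n + dsum g n)%Z.
Proof. apply Zs_add. Qed.

Lemma dsum_scal c f n : dsum (fun d => c * f d)%Z n = (c * dsum f n)%Z.
Proof. apply Zs_scal. Qed.

(** Liouville's identity when the inner sum has a closed form [g] and the
    total collapses to a divisor sum of [h]. *)
Lemma liouville_dsum (f g h : Z -> Z) (c : Z) n :
  (forall m, f (- m) = f m)%Z -> f 0%Z = 0%Z -> g 0%Z = 0%Z ->
  (forall m, (0 <= m -> g m + c * f (m + 1) = g (m + 1))%Z) ->
  (forall d e, (d * e = Z.of_nat n -> c * ((2 * e - 1 - d) * f d) - 2 * g (d - 1) = h d)%Z) ->
  (c * Zs (fun '((a, b), _) => f (Z.of_nat a - Z.of_nat b) - f (Z.of_nat a + Z.of_nat b)) (quads n)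
   = dsum h n)%Z.
Proof.
  intros even f0 g0 hg hh.
  unfold dsum. rewrite <- (Zs_pairs_divisors n (fun d => h (Z.of_nat d))).
  transitivity (c * (Zs (on_diff f) (quads n) - Zs (on_sum f) (quads n)))%Z.
  - f_equal. rewrite (Zs_ext (fun '((a, b), _) => f (Z.of_nat a - Z.of_nat b) - f (Z.of_nat a + Z.of_nat b))%Z
      (fun t => on_diff f t + (-1) * on_sum f t)%Z).
    + rewrite Zs_add, Zs_scal. ring.
    + intros [[a b] [x y]] _. unfold on_diff, on_sum. ring.
  - rewrite liouville_pairs by assumption. rewrite <- Zs_scal. apply Zs_ext. intros [d e].
    rewrite in_pairs. intros (h1 & h2 & h3). rewrite <- (hh (Z.of_nat d) (Z.of_nat e)) by lia.
    replace (Z.of_nat d - 1)%Z with (Z.of_nat (d - 1)) by lia.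
    rewrite <- (Zs_seq_closed f g c g0 hg). ring.
Qed.

Lemma quads_scal_dconv n c (f g : Z -> Z) (k : quad -> Z) :
  (forall a b x y, k ((a, b), (x, y)) = c * (f (Z.of_nat a) * g (Z.of_nat b)))%Z ->
  Zs k (quads n) = (c * dconv f g n)%Z.
Proof.
  intros h. rewrite <- quads_dconv, <- Zs_scal. apply Zs_ext. intros [[a b] [x y]] _. apply h.
Qed.

Definition zpow (s d : Z) : Z := (d ^ s)%Z.
(** The summand [(-1)^(d-1) d^s] of [sigma_tilde]. *)
Definition tpow (s d : Z) : Z := (- alt d * d ^ s)%Z.
Definition sigma (s : Z) : nat -> Z := dsum (zpow s).
Definition tsum (s : Z) : nat -> Z := dsum (tpow s).

(** For [f = m^2] the difference is [- 4 a b], a product of a function of [a] and one of [b]; [6] is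
    the denominator in the sum of squares, and [d e = n] turns the terms with [e] into multiples of
    [n]. The summand with coefficient 0 fits the formula to the shape of [dconv_relation]. *)
Lemma conv_sigma_1_1 n : (12 * dconv (zpow 1) (zpow 1) n =
  5 * sigma 3 n + 1 * sigma 1 n + 0 * sigma 1 n + -6 * (Z.of_nat n * sigma 1 n))%Z.
Proof.
  pose proof (liouville_dsum (fun m => m ^ 2)%Z (fun m => m * (m + 1) * (2 * m + 1))%Z
    (fun d => -10 * zpow 3 d + (-2) * zpow 1 d + (12 * Z.of_nat n) * zpow 1 d)%Z 6 n
    ltac:(intros; ring) ltac:(reflexivity) ltac:(reflexivity) ltac:(intros; ring)
    ltac:(intros d e <-; unfold zpow; ring)) as H.
  rewrite (quads_scal_dconv n (-4) (zpow 1) (zpow 1)) in H by (intros; unfold zpow; ring).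
  rewrite !dsum_add, !dsum_scal in H. unfold sigma. lia.
Qed.

(** For [f = m^4] the difference is [- 8 a b^3 - 8 a^3 b], two convolutions that are equal by
    symmetry. *)
Lemma conv_sigma_1_3 n : (240 * dconv (zpow 1) (zpow 3) n =
  21 * sigma 5 n + 10 * sigma 3 n + -1 * sigma 1 n + -30 * (Z.of_nat n * sigma 3 n))%Z.
Proof.
  pose proof (liouville_dsum (fun m => m ^ 4)%Z
    (fun m => m * (m + 1) * (2 * m + 1) * (3 * m ^ 2 + 3 * m - 1))%Z
    (fun d => -42 * zpow 5 d + (-20) * zpow 3 d + 2 * zpow 1 d + (60 * Z.of_nat n) * zpow 3 d)%Z 30 n
    ltac:(intros; ring) ltac:(reflexivity) ltac:(reflexivity) ltac:(intros; ring)
    ltac:(intros d e <-; unfold zpow; ring)) as H.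
  rewrite (Zs_ext _ (fun t => (fun '((a, b), _) => (-8) * (zpow 1 (Z.of_nat a) * zpow 3 (Z.of_nat b))) t +
    (fun '((a, b), _) => (-8) * (zpow 3 (Z.of_nat a) * zpow 1 (Z.of_nat b))) t)%Z) in H
    by (intros [[a b] [x y]] _; unfold zpow; ring).
  rewrite Zs_add in H.
  rewrite (quads_scal_dconv n (-8) (zpow 1) (zpow 3)) in H by (intros; ring).
  rewrite (quads_scal_dconv n (-8) (zpow 3) (zpow 1)) in H by (intros; ring).
  rewrite (dconv_comm (zpow 3)) in H.
  rewrite !dsum_add, !dsum_scal in H. unfold sigma. lia.
Qed.

Lemma alt_pred d : alt (d - 1) = (- alt d)%Z.
Proof. rewrite alt_sub. change (alt 1) with (-1)%Z. ring. Qed.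

(** The sign survives the separation of variables because [alt (a + b)] and [alt (a - b)] both equal
    [alt a * alt b]. The closed form is that of the alternating sum of squares, with denominator
    2. *)
Lemma conv_tsum_1_1 n : (4 * dconv (tpow 1) (tpow 1) n =
  -1 * tsum 3 n + -1 * tsum 1 n + 0 * tsum 1 n + 2 * (Z.of_nat n * tsum 1 n))%Z.
Proof.
  pose proof (liouville_dsum (fun m => alt m * m ^ 2)%Z (fun m => alt m * (m * (m + 1)))%Z
    (fun d => 2 * tpow 3 d + 2 * tpow 1 d + (-4 * Z.of_nat n) * tpow 1 d)%Z 2 n
    ltac:(intros; cbv beta; rewrite alt_opp; ring) ltac:(reflexivity) ltac:(reflexivity)
    ltac:(intros; cbv beta; rewrite alt_succ; ring)
    ltac:(intros d e <-; cbv beta; rewrite alt_pred; unfold tpow; ring)) as H.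
  rewrite (quads_scal_dconv n (-4) (tpow 1) (tpow 1)) in H
    by (intros; rewrite alt_add, alt_sub; unfold tpow; ring).
  rewrite !dsum_add, !dsum_scal in H. unfold tsum. lia.
Qed.

Lemma conv_tsum_1_3 n : (16 * dconv (tpow 1) (tpow 3) n =
  -1 * tsum 5 n + -2 * tsum 3 n + 1 * tsum 1 n + 2 * (Z.of_nat n * tsum 3 n))%Z.
Proof.
  pose proof (liouville_dsum (fun m => alt m * m ^ 4)%Z (fun m => alt m * (m ^ 4 + 2 * m ^ 3 - m))%Z
    (fun d => 2 * tpow 5 d + 4 * tpow 3 d + (-2) * tpow 1 d + (-4 * Z.of_nat n) * tpow 3 d)%Z 2 n
    ltac:(intros; cbv beta; rewrite alt_opp; ring) ltac:(reflexivity) ltac:(reflexivity)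
    ltac:(intros; cbv beta; rewrite alt_succ; ring)
    ltac:(intros d e <-; cbv beta; rewrite alt_pred; unfold tpow; ring)) as H.
  rewrite (Zs_ext _ (fun t => (fun '((a, b), _) => (-8) * (tpow 1 (Z.of_nat a) * tpow 3 (Z.of_nat b))) t +
    (fun '((a, b), _) => (-8) * (tpow 3 (Z.of_nat a) * tpow 1 (Z.of_nat b))) t)%Z) in H
    by (intros [[a b] [x y]] _; rewrite alt_add, alt_sub; unfold tpow; ring).
  rewrite Zs_add in H.
  rewrite (quads_scal_dconv n (-8) (tpow 1) (tpow 3)) in H by (intros; ring).
  rewrite (quads_scal_dconv n (-8) (tpow 3) (tpow 1)) in H by (intros; ring).
  rewrite (dconv_comm (tpow 3)) in H.
  rewrite !dsum_add, !dsum_scal in H. unfold tsum. lia.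
Qed.

(** * Signed divisor sums in terms of sigma *)

Lemma pow_m1_pred d : (1 <= d)%nat -> ((-1) ^ Z.of_nat (d - 1) = - alt (Z.of_nat d))%Z.
Proof.
  intros h. replace (Z.of_nat d) with (Z.of_nat (d - 1) + 1)%Z by lia. rewrite alt_succ, Z.opp_involutive.
  generalize (d - 1)%nat. clear. induction n as [|n IH]; [reflexivity|].
  rewrite Nat2Z.inj_succ, Z.pow_succ_r, IH by lia. unfold Z.succ. rewrite alt_succ. ring.
Qed.

Lemma sigma_tilde_tsum s n : sigma_tilde s n = tsum (Z.of_nat s) n.
Proof.
  apply Zs_ext. intros d. rewrite in_divisors. intros h. unfold tpow. now rewrite pow_m1_pred by lia.
Qed.

(** On coefficients, the substitution of [q^2] for [q]. *)
Definition double (f : nat -> Z) (n : nat) : Z := if Nat.even n then f (Nat.div2 n) else 0%Z.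

Lemma Zs_even_divisors n (f : nat -> Z) :
  Zs f (filter Nat.even (divisors n)) = double (fun m => Zs (fun d => f (2 * d)%nat) (divisors m)) n.
Proof.
  unfold double. destruct (Nat.even n) eqn:E.
  - apply Nat.even_spec in E. destruct E as [m ->]. rewrite Nat.div2_double.
    symmetry. apply (Zs_bij (fun d => 2 * d)%nat Nat.div2).
    + apply NoDup_divisors.
    + apply NoDup_filter, NoDup_divisors.
    + intros d. rewrite filter_In, !in_divisors_mul, Nat.div2_double. intros (e & h).
      split; [|reflexivity]. split; [exists e; nia|]. now rewrite Nat.even_mul.
    + intros d. rewrite filter_In, Nat.even_spec, !in_divisors_mul. intros [(e & h) [k ->]].
      rewrite Nat.div2_double. split; [exists e; nia|reflexivity].
  - apply Zs_zero. intros d. rewrite filter_In, in_divisors_mul. intros [(e & h1 & h2 & <-) hd].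
    rewrite Nat.even_mul, hd in E. discriminate.
Qed.

Lemma Zs_even_codivisors n (f : nat -> Z) :
  Zs f (filter (fun d => Nat.even (n / d)) (divisors n)) = double (fun m => Zs f (divisors m)) n.
Proof.
  assert (dv : forall d e, (1 <= d)%nat -> (d * e / d = e)%nat)
    by (intros d e h; rewrite Nat.mul_comm; apply Nat.div_mul; lia).
  unfold double. destruct (Nat.even n) eqn:E.
  - apply Nat.even_spec in E. destruct E as [m ->]. rewrite Nat.div2_double.
    apply (Zs_bij (fun d => d) (fun d => d)).
    + apply NoDup_filter, NoDup_divisors.
    + apply NoDup_divisors.
    + intros d. rewrite filter_In, !in_divisors_mul. intros [(e & h1 & h2 & h3) h4].
      split; [|reflexivity]. rewrite <- h3, dv in h4 by lia. apply Nat.even_spec in h4.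
      destruct h4 as [k ->]. exists k. nia.
    + intros d. rewrite filter_In, !in_divisors_mul. intros (e & h1 & h2 & h3).
      split; [|reflexivity]. split; [exists (2 * e)%nat; nia|].
      replace (2 * m)%nat with (d * (2 * e))%nat by nia. now rewrite dv, Nat.even_mul by lia.
  - apply Zs_zero. intros d. rewrite filter_In, in_divisors_mul. intros [(e & h1 & h2 & <-) hd].
    rewrite dv in hd by lia. rewrite Nat.even_mul, hd, Bool.orb_true_r in E. discriminate.
Qed.

Lemma alt_of_nat d : alt (Z.of_nat d) = if Nat.even d then 1%Z else (-1)%Z.
Proof.
  unfold alt. replace (Z.even (Z.of_nat d)) with (Nat.even d); [reflexivity|].
  induction d as [|d IH]; [reflexivity|].
  rewrite Nat2Z.inj_succ, Z.even_succ, Nat.even_succ, <- Z.negb_even, <- Nat.negb_even. now rewrite IH.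
Qed.

(** The sign subtracts the even divisors twice; they are the doubles of the divisors of [n / 2],
    whence the factor [2 ^ s]. *)
Lemma tsum_sigma s n : (0 <= s)%Z ->
  tsum s n = (sigma s n - 2 * 2 ^ s * double (sigma s) n)%Z.
Proof.
  intros hs.
  assert (E : (2 ^ s * double (sigma s) n =
    Zs (fun d => Z.of_nat d ^ s) (filter Nat.even (divisors n)))%Z).
  { rewrite (Zs_even_divisors n (fun d => Z.of_nat d ^ s)%Z). unfold double.
    destruct (Nat.even n); [|ring]. unfold sigma, dsum, zpow. rewrite <- Zs_scal. apply Zs_ext. intros d _.
    rewrite <- Z.pow_mul_l. f_equal. lia. }
  rewrite <- Z.mul_assoc, E, Zs_filter. unfold sigma, tsum, dsum, zpow, Z.sub.
  rewrite <- Z.mul_opp_l, <- Zs_scal, <- Zs_add. apply Zs_ext. intros d _. unfold tpow.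
  rewrite alt_of_nat. destruct (Nat.even d); ring.
Qed.

(** The sign depends on the cofactor [n / d], which is even exactly when [d] divides [n / 2]; no
    power of 2 arises. *)
Lemma sigma_hat_sigma n : sigma_hat 1 n = (sigma 1 n - 2 * double (sigma 1) n)%Z.
Proof.
  unfold sigma at 2, dsum. rewrite <- (Zs_even_codivisors n (fun d => zpow 1 (Z.of_nat d))), Zs_filter.
  unfold Z.sub. rewrite <- Z.mul_opp_l, <- Zs_scal. unfold sigma, dsum, zpow. rewrite <- Zs_add. apply Zs_ext.
  intros d. rewrite in_divisors_mul. intros (e & h1 & h2 & <-).
  rewrite (Nat.mul_comm d e), Nat.div_mul, pow_m1_pred, alt_of_nat by lia.
  change (Z.of_nat 1) with 1%Z. destruct (Nat.even e); ring.
Qed.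

Lemma sigma_bound s n : (0 <= s)%Z ->
  (Z.abs (sigma s n) <= Z.of_nat n ^ (s + 1))%Z.
Proof.
  intros hs. assert (L : (length (divisors n) <= n)%nat).
  { unfold divisors. rewrite filter_length_le, length_seq. lia. }
  assert (G : forall l, (forall d, In d l -> d <= n)%nat ->
    (0 <= Zs (fun d => Z.of_nat d ^ s) l <= Z.of_nat (length l) * Z.of_nat n ^ s)%Z).
  { induction l as [|d l IH]; intros h; [unfold Zs; cbn; lia|].
    rewrite Zs_cons. cbn [length]. specialize (IH (fun d hd => h d (or_intror hd))).
    assert (0 <= Z.of_nat d ^ s <= Z.of_nat n ^ s)%Z.
    { split; [apply Z.pow_nonneg; lia|]. apply Z.pow_le_mono_l. specialize (h d (or_introl eq_refl)). lia. }
    nia. }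
  destruct (G (divisors n)) as [g1 g2]; [intros d; rewrite in_divisors; lia|].
  unfold sigma, dsum, zpow. rewrite Z.abs_eq by exact g1. rewrite Z.pow_add_r, Z.pow_1_r by lia.
  assert (0 <= Z.of_nat n ^ s)%Z by (apply Z.pow_nonneg; lia). nia.
Qed.

(** * Ramanujan-type differential equations for [Pfun], [Efun], [Qfun] *)

Definition zcoef (f : nat -> Z) (n : nat) : C := RtoC (IZR (f n)).
(** The operator [q d/dq] on coefficients. *)
Definition theta (a : nat -> C) (n : nat) : C := (RtoC (INR n) * a n)%C.

Lemma good_dom rad a b : (forall n, Cmod (a n) <= Cmod (b n)) -> good rad b -> good rad a.
Proof.
  intros h hb rho hr. destruct (hb rho hr) as [M H]. exists M. intros n. eapply Rle_trans; [|apply (H n)].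
  apply Rmult_le_compat_r; [apply pow_le; lra|apply h].
Qed.

Lemma good_zcoef (f : nat -> Z) (c : Z) (k : nat) :
  (forall n, Z.abs (f n) <= c * Z.of_nat n ^ Z.of_nat k)%Z -> good 1 (zcoef f).
Proof.
  intros h.
  assert (g : good 1 (fun n => RtoC (INR n ^ k))).
  { clear h. induction k as [|k IH].
    - apply good_bounded with 1. intros n. cbn [pow]. rewrite Cmod_1. lra.
    - apply good_ext with (theta (fun n => RtoC (INR n ^ k))); [|now apply good_INR].
      intros n. unfold theta. now rewrite <- RtoC_mult. }
  apply (good_scal 1 (RtoC (IZR c))) in g. revert g. apply good_dom. intros n.
  rewrite Cmod_mult. unfold zcoef. rewrite !Cmod_R, (Rabs_pos_eq (INR n ^ k)) by (apply pow_le, pos_INR).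
  apply Rle_trans with (IZR c * INR n ^ k).
  - rewrite <- abs_IZR, INR_IZR_INZ, pow_IZR, <- mult_IZR. apply IZR_le, h.
  - apply Rmult_le_compat_r; [apply pow_le, pos_INR|apply Rle_abs].
Qed.

Lemma good_sigma s : (0 <= s)%Z -> good 1 (zcoef (sigma s)).
Proof.
  intros hs. apply good_zcoef with 1%Z (Z.to_nat (s + 1)). intros n.
  rewrite Z2Nat.id, Z.mul_1_l by lia. now apply sigma_bound.
Qed.

Definition cdouble (a : nat -> C) (n : nat) : C := if Nat.even n then a (Nat.div2 n) else 0%C.

(** The odd terms vanish, so the partial sums are those of [a], each occurring twice. *)
Lemma sum_n_double (a : nat -> C) n :
  sum_n (G := C_AbelianMonoid) (cdouble a) n =
  sum_n (G := C_AbelianMonoid) a (Nat.div2 n).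
Proof.
  enough (H : forall m,
    sum_n (G := C_AbelianMonoid) (cdouble a) (2 * m) =
      sum_n (G := C_AbelianMonoid) a m /\
    sum_n (G := C_AbelianMonoid) (cdouble a) (S (2 * m)) =
      sum_n (G := C_AbelianMonoid) a m).
  { destruct (Nat.Even_or_Odd n) as [[m ->]|[m ->]].
    - rewrite Nat.div2_double. apply H.
    - replace (2 * m + 1)%nat with (S (2 * m)) by lia. rewrite Nat.div2_succ_double. apply H. }
  assert (odd : forall m, Nat.even (S (2 * m)) = false).
  { intros m. now rewrite Nat.even_succ, <- Nat.negb_even, Nat.even_mul. }
  induction m as [|m [_ IH]].
  - change (2 * 0)%nat with 0%nat. rewrite sum_Sn, !sum_O. split; [reflexivity|].
    change (cdouble a 1) with (RtoC 0). change (cdouble a 0) with (a O). change (plus ?x ?y) with (x + y)%C. cring.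
  - replace (2 * S m)%nat with (S (S (2 * m))) by lia.
    assert (E : sum_n (G := C_AbelianMonoid) (cdouble a) (S (S (2 * m)))
      = sum_n (G := C_AbelianMonoid) a (S m)).
    { rewrite sum_Sn, IH, sum_Sn. f_equal. unfold cdouble.
      replace (S (S (2 * m))) with (2 * S m)%nat by lia. now rewrite Nat.even_mul, Nat.div2_double. }
    split; [exact E|]. rewrite sum_Sn, E. unfold cdouble.
    replace (S (S (S (2 * m)))) with (S (2 * S m)) by lia. rewrite odd.
    change (plus ?x ?y) with (x + y)%C. cring.
Qed.

Lemma is_cseries_double (a : nat -> C) (l : C) : is_cseries a l ->
  is_cseries (cdouble a) l.
Proof.
  intros h. unfold is_series in *.
  apply (proj2 (filterlim_locally (U := C_NormedModule) (F := eventually) _ _)). intros eps.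
  destruct (proj1 (filterlim_locally (U := C_NormedModule) (F := eventually) _ _) h eps) as [N HN].
  exists (2 * N)%nat. intros n hn.
  assert (hN : (N <= Nat.div2 n)%nat).
  { rewrite <- (Nat.div2_double N). rewrite !Nat.div2_div. now apply Nat.Div0.div_le_mono. }
  exact (eq_ind_r (fun u : C => ball (l : C_NormedModule) eps u) (HN _ hN) (sum_n_double a n)).
Qed.

Lemma PS_double f q : good 1 (zcoef f) -> Cmod q < 1 -> PS (zcoef (double f)) q = PS (zcoef f) (q ^ 2)%C.
Proof.
  intros hf hq. assert (hq2 : Cmod (q ^ 2)%C < 1).
  { rewrite Cmod_pow. pose proof (Cmod_ge_0 q). nra. }
  apply is_cseries_unique. pose proof (is_cseries_double _ _ (PS_correct 1 _ _ hf hq2)) as H.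
  eapply is_cseries_ext; [|exact H]. intros n. cbv beta. unfold cdouble, zcoef, double.
  destruct (Nat.even n) eqn:E; [|ring]. f_equal.
  apply Nat.even_spec in E. destruct E as [m ->]. rewrite Nat.div2_double.
  clear. induction m as [|m IH]; [reflexivity|]. replace (2 * S m)%nat with (S (S (2 * m))) by lia.
  cbn [Cpow] in *. rewrite IH. ring.
Qed.

Lemma good_double f : good 1 (zcoef f) -> good 1 (zcoef (double f)).
Proof.
  intros h rho hr. destruct (h (rho ^ 2)) as [M H]; [nra|]. exists (Rmax M 0). intros n.
  unfold zcoef, double. destruct (Nat.even n) eqn:E.
  - apply Nat.even_spec in E. destruct E as [m ->]. rewrite Nat.div2_double, pow_mult.
    eapply Rle_trans; [apply (H m)|apply Rmax_l].
  - rewrite Cmod_0, Rmult_0_l. apply Rmax_r.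
Qed.

Lemma cconv_zcoef (u v : nat -> Z) n :
  cconv (zcoef u) (zcoef v) n = RtoC (IZR (Zs (fun k => u k * v (n - k)%nat)%Z (seq 0 (S n)))).
Proof.
  unfold cconv, zcoef.
  enough (H : forall m, sum_n (G := C_AbelianMonoid) (fun k => RtoC (IZR (u k)) * RtoC (IZR (v (n - k)%nat)))%C m =
    RtoC (IZR (Zs (fun k => u k * v (n - k)%nat)%Z (seq 0 (S m))))) by apply H.
  induction m as [|m IH].
  - rewrite sum_O. unfold Zs, Zsum. cbn [seq map fold_right]. rewrite Z.add_0_r, mult_IZR, RtoC_mult. reflexivity.
  - rewrite sum_Sn, IH, (seq_S (S m)), Zs_app, (Zs_cons _ (0 + S m)%nat). change (Zs _ []) with 0%Z.
    rewrite Z.add_0_r, plus_IZR, mult_IZR, RtoC_plus, RtoC_mult. reflexivity.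
Qed.

Lemma cder_theta a q : good 1 a -> Cmod q < 1 ->
  exists l, cder (PS a) q l /\ (q * l = PS (theta a) q)%C.
Proof.
  intros ha hq. exists (PS (dcoef a) q). split; [now apply (cder_PS 1)|].
  rewrite (PS_split 1 (theta a)) by (auto; now apply good_INR).
  unfold theta at 1. cbn [INR]. change (fun n => theta a (S n)) with (dcoef a). ring.
Qed.

Definition S1 (q : C) : C := PS (zcoef (sigma 1)) q.
Definition S3 (q : C) : C := PS (zcoef (sigma 3)) q.
Definition S5 (q : C) : C := PS (zcoef (sigma 5)) q.
Definition DS1 (q : C) : C := PS (theta (zcoef (sigma 1))) q.
Definition DS3 (q : C) : C := PS (theta (zcoef (sigma 3))) q.

Lemma zcoef_tsum s n : (0 <= s)%Z -> (zcoef (tsum s) n =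
  zcoef (sigma s) n + RtoC (IZR (- (2 * 2 ^ s))) * zcoef (double (sigma s)) n)%C.
Proof.
  intros hs. unfold zcoef. rewrite tsum_sigma by exact hs.
  rewrite <- RtoC_mult, <- mult_IZR, <- RtoC_plus, <- plus_IZR. do 2 f_equal. ring.
Qed.

Lemma good_tsum s : (0 <= s)%Z -> good 1 (zcoef (tsum s)).
Proof.
  intros hs. eapply good_ext; [intros n; symmetry; now apply zcoef_tsum|].
  apply good_add; [now apply good_sigma|]. apply good_scal, good_double. now apply good_sigma.
Qed.

Lemma PS_tsum s q : (0 <= s)%Z -> Cmod q < 1 -> (PS (zcoef (tsum s)) q =
  PS (zcoef (sigma s)) q + RtoC (IZR (- (2 * 2 ^ s))) * PS (zcoef (sigma s)) (q ^ 2))%C.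
Proof.
  intros hs hq. pose proof (good_sigma s hs) as g. rewrite <- (PS_double (sigma s) q g hq).
  rewrite <- (PS_scal 1), <- (PS_add 1) by auto using good_double, good_scal.
  apply PS_ext. intros n. now apply zcoef_tsum.
Qed.

(** The extra factor 2 comes from applying [q d/dq] to a function of [q^2]. *)
Lemma PS_theta_tsum s q : (0 <= s)%Z -> Cmod q < 1 -> (PS (theta (zcoef (tsum s))) q =
  PS (theta (zcoef (sigma s))) q + RtoC (IZR (- (2 * 2 ^ s))) * (2 * PS (theta (zcoef (sigma s))) (q ^ 2)))%C.
Proof.
  intros hs hq. pose proof (good_sigma s hs) as g.
  set (f := fun n => (Z.of_nat n * sigma s n)%Z).
  assert (ef : forall n, zcoef f n = theta (zcoef (sigma s)) n).
  { intros n. unfold zcoef, theta, f. now rewrite mult_IZR, <- INR_IZR_INZ, RtoC_mult. }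
  assert (gf : good 1 (zcoef f)) by (apply good_ext with (theta (zcoef (sigma s))); auto; now apply good_INR).
  rewrite <- (PS_ext _ _ (q ^ 2)%C ef), <- (PS_double f q gf hq).
  rewrite <- (PS_scal 1), <- (PS_scal 1), <- (PS_add 1) by (auto using good_double, good_scal; now apply good_INR).
  apply PS_ext. intros n. unfold theta. rewrite zcoef_tsum by exact hs.
  rewrite Cmult_plus_distr_l. f_equal. unfold zcoef, double, f.
  destruct (Nat.even n) eqn:E; [|ring].
  apply Nat.even_spec in E. destruct E as [m ->]. rewrite Nat.div2_double, mult_INR, !RtoC_mult, mult_IZR, RtoC_mult.
  rewrite <- INR_IZR_INZ. simpl (INR 2). rewrite RtoC_plus. ring.
Qed.

Lemma dconv_relation (c0 c1 c2 c3 c4 : Z) (f g : Z -> Z) (u v w t : nat -> Z) q :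
  good 1 (zcoef (dsum f)) -> good 1 (zcoef (dsum g)) -> good 1 (zcoef u) -> good 1 (zcoef v) ->
  good 1 (zcoef w) -> good 1 (zcoef t) -> Cmod q < 1 ->
  (forall n, c0 * dconv f g n = c1 * u n + c2 * v n + c3 * w n + c4 * (Z.of_nat n * t n))%Z ->
  (IZR c0 * (PS (zcoef (dsum f)) q * PS (zcoef (dsum g)) q) = IZR c1 * PS (zcoef u) q +
   IZR c2 * PS (zcoef v) q + IZR c3 * PS (zcoef w) q + IZR c4 * PS (theta (zcoef t)) q)%C.
Proof.
  intros gf gg gu gv gw gt hq h. apply (good_INR 1) in gt as gt'.
  rewrite <- (PS_conv 1), <- !(PS_scal 1) by auto using good_conv.
  rewrite <- !(PS_add 1) by auto 10 using good_scal, good_add.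
  apply PS_ext. intros n. rewrite cconv_zcoef. specialize (h n). unfold zcoef, theta.
  rewrite INR_IZR_INZ, <- !RtoC_mult, <- !RtoC_plus, <- !mult_IZR, <- !plus_IZR. now rewrite <- h.
Qed.

Section QSeries.
Variable q : C.
Hypothesis hq : Cmod q < 1.

Lemma DS1_eq : (6 * DS1 q = 5 * S3 q + S1 q - 12 * S1 q ^ 2)%C.
Proof.
  pose proof (dconv_relation _ _ _ _ _ _ _ _ _ _ _ q ltac:(now apply (good_sigma 1)) ltac:(now apply (good_sigma 1))
    ltac:(now apply (good_sigma 3)) ltac:(now apply (good_sigma 1)) ltac:(now apply (good_sigma 1))
    ltac:(now apply (good_sigma 1)) hq conv_sigma_1_1) as H.
  change (12 * (S1 q * S1 q) = 5 * S3 q + 1 * S1 q + 0 * S1 q + -6 * DS1 q)%C in H.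
  replace (12 * S1 q ^ 2)%C with (12 * (S1 q * S1 q))%C by ring. rewrite H. ring.
Qed.

Lemma DS3_eq : (30 * DS3 q = 21 * S5 q + 10 * S3 q - S1 q - 240 * (S1 q * S3 q))%C.
Proof.
  pose proof (dconv_relation _ _ _ _ _ _ _ _ _ _ _ q ltac:(now apply (good_sigma 1)) ltac:(now apply (good_sigma 3))
    ltac:(now apply (good_sigma 5)) ltac:(now apply (good_sigma 3)) ltac:(now apply (good_sigma 1))
    ltac:(now apply (good_sigma 3)) hq conv_sigma_1_3) as H.
  change (240 * (S1 q * S3 q) = 21 * S5 q + 10 * S3 q + -1 * S1 q + -30 * DS3 q)%C in H.
  rewrite H. ring.
Qed.

Lemma theta_tsum_1 : (2 * PS (theta (zcoef (tsum 1))) q =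
  4 * PS (zcoef (tsum 1)) q ^ 2 + PS (zcoef (tsum 1)) q + PS (zcoef (tsum 3)) q)%C.
Proof.
  pose proof (dconv_relation _ _ _ _ _ _ _ _ _ _ _ q ltac:(now apply (good_tsum 1)) ltac:(now apply (good_tsum 1))
    ltac:(now apply (good_tsum 3)) ltac:(now apply (good_tsum 1)) ltac:(now apply (good_tsum 1))
    ltac:(now apply (good_tsum 1)) hq conv_tsum_1_1) as H.
  fold (tsum 1) in H.
  replace (4 * PS (zcoef (tsum 1)) q ^ 2)%C
    with (4 * (PS (zcoef (tsum 1)) q * PS (zcoef (tsum 1)) q))%C by ring.
  rewrite H. ring.
Qed.

Lemma theta_tsum_3 : (2 * PS (theta (zcoef (tsum 3))) q =
  16 * (PS (zcoef (tsum 1)) q * PS (zcoef (tsum 3)) q) + PS (zcoef (tsum 5)) q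
  + 2 * PS (zcoef (tsum 3)) q - PS (zcoef (tsum 1)) q)%C.
Proof.
  pose proof (dconv_relation _ _ _ _ _ _ _ _ _ _ _ q ltac:(now apply (good_tsum 1)) ltac:(now apply (good_tsum 3))
    ltac:(now apply (good_tsum 5)) ltac:(now apply (good_tsum 3)) ltac:(now apply (good_tsum 1))
    ltac:(now apply (good_tsum 3)) hq conv_tsum_1_3) as H.
  fold (tsum 1) (tsum 3) in H. rewrite H. ring.
Qed.
End QSeries.

Lemma Cmod_sqr_lt q : Cmod q < 1 -> Cmod (q ^ 2)%C < 1.
Proof. intros hq. rewrite Cmod_pow. pose proof (Cmod_ge_0 q). nra. Qed.

(** Compares the convolutions of [sigma] and of its alternating analogue; it says that
    [Efun^2] is a combination of weight 4 Eisenstein series. *)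
Lemma weight_4_relation q : Cmod q < 1 ->
  S3 q = (12 * (S1 q - 2 * S1 (q ^ 2)) ^ 2 + (S1 q - 2 * S1 (q ^ 2)) - 4 * S3 (q ^ 2))%C.
Proof.
  intros hq. pose proof (theta_tsum_1 q hq) as H.
  rewrite PS_theta_tsum, !PS_tsum in H by (auto; lia).
  pose proof (DS1_eq q hq) as D. pose proof (DS1_eq _ (Cmod_sqr_lt q hq)) as D'.
  fold (S1 q) (S3 q) (S1 (q ^ 2)) (S3 (q ^ 2)) (DS1 q) (DS1 (q ^ 2)) in H.
  change (2 * 2 ^ 1)%Z with 4%Z in H. change (2 * 2 ^ 3)%Z with 16%Z in H. cbn [Z.opp] in H.
  set (s1 := S1 q) in *. set (s3 := S3 q) in *. set (r1 := S1 (q ^ 2)) in *. set (r3 := S3 (q ^ 2)) in *.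
  set (d := DS1 q) in *. set (e := DS1 (q ^ 2)) in *.
  replace d with ((5 * s3 + s1 - 12 * s1 ^ 2) / 6)%C in H by (rewrite <- D; field).
  replace e with ((5 * r3 + r1 - 12 * r1 ^ 2) / 6)%C in H by (rewrite <- D'; field).
  (* The coefficient of [s3] in [H] is [5/3 - 1]; multiplying by 3/2 normalizes it. *)
  apply Ceq_minus. apply Ceq_minus in H. rewrite <- (Cmult_0_r (3 / 2)%C), <- H. field.
Qed.

(** This is [q d/dq] applied to [weight_4_relation]: [S3] is differentiated termwise and through
    that relation, and the two derivatives agree. *)
Lemma weight_6_relation q : Cmod q < 1 ->
  (DS3 q + 8 * DS3 (q ^ 2) = (24 * (S1 q - 2 * S1 (q ^ 2)) + 1) * (DS1 q - 4 * DS1 (q ^ 2)))%C.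
Proof.
  intros hq. pose proof (Cmod_sqr_lt q hq) as hq2.
  assert (g1 := good_sigma 1 ltac:(lia)). assert (g3 := good_sigma 3 ltac:(lia)).
  destruct (cder_theta _ q g1 hq) as (l1 & c1 & e1). destruct (cder_theta _ q g3 hq) as (l3 & c3 & e3).
  destruct (cder_theta _ _ g1 hq2) as (m1 & d1 & f1). destruct (cder_theta _ _ g3 hq2) as (m3 & d3 & f3).
  fold (DS1 q) in e1. fold (DS3 q) in e3. fold (DS1 (q ^ 2)) in f1. fold (DS3 (q ^ 2)) in f3.
  assert (sq : cder (fun y => y ^ 2)%C q (2 * q * 1)%C) by apply cder_sqr, cder_id.
  pose proof (cder_comp S1 (fun y => y ^ 2)%C q m1 _ sq d1) as D1.
  pose proof (cder_comp S3 (fun y => y ^ 2)%C q m3 _ sq d3) as D3.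
  pose proof (cder_sub _ _ _ _ _ c1 (cder_mul _ _ _ _ _ (cder_const 2%C q) D1)) as H.
  pose proof (cder_sub _ _ _ _ _ (cder_add _ _ _ _ _ (cder_mul _ _ _ _ _ (cder_const 12%C q) (cder_sqr _ _ _ H)) H)
    (cder_mul _ _ _ _ _ (cder_const 4%C q) D3)) as R.
  assert (L := cder_ext_loc _ S3 q _ (1 - Cmod q) ltac:(lra)
    (fun y hy => eq_sym (weight_4_relation y ltac:(pose proof (Cmod_le_minus_add y q); lra))) R).
  pose proof (cder_unique _ _ _ _ c3 L) as E. cbv beta in E.
  rewrite <- e3, <- f3, <- e1, <- f1, E. unfold S1. ring.
Qed.

(** * Power series and derivatives of [Pfun], [Efun] and [Qfun] *)

Lemma CSeries_tail (f : nat -> Z) (q : C) : f O = 0%Z -> good 1 (zcoef f) -> Cmod q < 1 ->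
  CSeries (fun n => IZR (f (S n)) * q ^ S n)%C = PS (zcoef f) q.
Proof.
  intros f0 hf hq. apply is_cseries_unique.
  replace (PS (zcoef f) q) with (PS (zcoef f) q - zcoef f 0 * q ^ 0)%C.
  - apply (is_cseries_unshift (fun n => zcoef f n * q ^ n)%C). now apply (PS_correct 1).
  - unfold zcoef. rewrite f0. ring.
Qed.

Lemma Pfun_PS q : Cmod q < 1 -> Pfun q = (1 + 8 * PS (zcoef (tsum 1)) q)%C.
Proof.
  intros hq. unfold Pfun. rewrite <- (CSeries_tail (tsum 1) q) by (auto; apply good_tsum; lia).
  do 3 f_equal. apply functional_extensionality. intros n. now rewrite sigma_tilde_tsum.
Qed.

Lemma Qfun_PS q : Cmod q < 1 -> Qfun q = (1 - 16 * PS (zcoef (tsum 3)) q)%C.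
Proof.
  intros hq. unfold Qfun. rewrite <- (CSeries_tail (tsum 3) q) by (auto; apply good_tsum; lia).
  do 3 f_equal. apply functional_extensionality. intros n. now rewrite sigma_tilde_tsum.
Qed.

Lemma zcoef_hat n : (zcoef (sigma_hat 1) n =
  zcoef (sigma 1) n + RtoC (IZR (-2)) * zcoef (double (sigma 1)) n)%C.
Proof.
  unfold zcoef. rewrite sigma_hat_sigma, <- RtoC_mult, <- mult_IZR, <- RtoC_plus, <- plus_IZR.
  do 2 f_equal. ring.
Qed.

Lemma good_hat : good 1 (zcoef (sigma_hat 1)).
Proof.
  eapply good_ext; [intros n; symmetry; apply zcoef_hat|].
  assert (g1 := good_sigma 1 ltac:(lia)). auto using good_add, good_scal, good_double.
Qed.

Lemma Efun_PS q : Cmod q < 1 -> Efun q = (1 + 24 * PS (zcoef (sigma_hat 1)) q)%C.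
Proof.
  intros hq. unfold Efun. rewrite <- (CSeries_tail (sigma_hat 1) q); auto using good_hat.
Qed.

Lemma Efun_S1 q : Cmod q < 1 -> Efun q = (1 + 24 * (S1 q - 2 * S1 (q ^ 2)))%C.
Proof.
  intros hq. assert (g1 := good_sigma 1 ltac:(lia)). rewrite Efun_PS by exact hq.
  rewrite (PS_ext _ _ q zcoef_hat), (PS_add 1), (PS_scal 1) by auto using good_scal, good_double.
  rewrite PS_double by assumption. unfold S1. ring.
Qed.

Lemma Cmod_near q y : Cmod (y - q)%C < 1 - Cmod q -> Cmod y < 1.
Proof. intros h. pose proof (Cmod_le_minus_add y q). lra. Qed.

Lemma cder_Pfun q : Cmod q < 1 ->
  exists l, cder Pfun q l /\ (q * l = (Pfun q ^ 2 - Qfun q) / 4)%C.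
Proof.
  intros hq. destruct (cder_theta (zcoef (tsum 1)) q) as (l & hl & e); [apply good_tsum; lia|exact hq|].
  exists (8 * l)%C. split.
  - apply cder_ext_loc with (fun y => 1 + 8 * PS (zcoef (tsum 1)) y)%C (1 - Cmod q); [lra| |].
    + intros y hy. symmetry. apply Pfun_PS. now apply Cmod_near with q.
    + eapply cder_eq; [apply cder_add; [apply cder_const|apply cder_mul; [apply cder_const|exact hl]]|].
      cbv beta. ring.
  - pose proof (theta_tsum_1 q hq) as H. rewrite Pfun_PS, Qfun_PS by exact hq.
    replace (q * (8 * l))%C with (4 * (2 * (q * l)))%C by ring. rewrite e, H. field.
Qed.

Lemma Pfun_S1 q : Cmod q < 1 -> Pfun q = (1 + 8 * (S1 q - 4 * S1 (q ^ 2)))%C.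
Proof.
  intros hq. rewrite Pfun_PS, PS_tsum by (auto; lia).
  change (2 * 2 ^ 1)%Z with 4%Z. unfold S1. cbn [Z.opp]. ring.
Qed.

Lemma Qfun_S3 q : Cmod q < 1 -> Qfun q = (1 - 16 * (S3 q - 16 * S3 (q ^ 2)))%C.
Proof.
  intros hq. rewrite Qfun_PS, PS_tsum by (auto; lia).
  change (2 * 2 ^ 3)%Z with 16%Z. unfold S3. cbn [Z.opp]. ring.
Qed.

(** [DS1_eq] at [q] and at [q^2] expresses the derivative by [S1] and [S3] at these points;
    [weight_4_relation] then removes [S3 q]. *)
Lemma cder_Efun q : Cmod q < 1 ->
  exists l, cder Efun q l /\ (q * l = (Efun q * Pfun q - Qfun q) / 2)%C.
Proof.
  intros hq. pose proof (Cmod_sqr_lt q hq) as hq2.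
  assert (g1 := good_sigma 1 ltac:(lia)).
  destruct (cder_theta _ q g1 hq) as (l1 & c1 & e1). destruct (cder_theta _ _ g1 hq2) as (m1 & d1 & f1).
  fold (DS1 q) in e1. fold (DS1 (q ^ 2)) in f1.
  exists (24 * (l1 - 2 * (m1 * (2 * q * 1))))%C. split.
  - apply cder_ext_loc with (fun y => 1 + 24 * (S1 y - 2 * S1 (y ^ 2)))%C (1 - Cmod q); [lra| |].
    + intros y hy. symmetry. apply Efun_S1. now apply Cmod_near with q.
    + eapply cder_eq.
      * apply cder_add; [apply cder_const|]. apply cder_mul; [apply cder_const|].
        apply cder_sub; [exact c1|]. apply cder_mul; [apply cder_const|].
        apply (cder_comp S1 (fun y => y ^ 2)%C q m1 (2 * q * 1)%C); [apply cder_sqr, cder_id|exact d1].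
      * cbv beta. ring.
  - replace (q * (24 * (l1 - 2 * (m1 * (2 * q * 1)))))%C
      with (4 * (6 * (q * l1)) - 16 * (6 * (q ^ 2 * m1)))%C by ring.
    rewrite e1, f1, DS1_eq, DS1_eq by assumption. rewrite Efun_S1, Pfun_S1, Qfun_S3 by exact hq.
    rewrite (weight_4_relation q hq). field.
Qed.

(** [DS3_eq] brings in [S5 q] and [S5 (q ^ 2)], which do not occur in the claimed equation.
    [theta_tsum_3] and [weight_6_relation] are two linear relations between them, enough to
    eliminate both. *)
Lemma cder_Qfun q : Cmod q < 1 ->
  exists l, cder Qfun q l /\ (q * l = Qfun q * (Pfun q - Efun q))%C.
Proof.
  intros hq. pose proof (Cmod_sqr_lt q hq) as hq2.
  destruct (cder_theta (zcoef (tsum 3)) q) as (l & hl & e); [apply good_tsum; lia|exact hq|].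
  exists (- (16 * l))%C. split.
  - apply cder_ext_loc with (fun y => 1 - 16 * PS (zcoef (tsum 3)) y)%C (1 - Cmod q); [lra| |].
    + intros y hy. symmetry. apply Qfun_PS. now apply Cmod_near with q.
    + eapply cder_eq; [apply cder_sub; [apply cder_const|apply cder_mul; [apply cder_const|exact hl]]|].
      cbv beta. ring.
  - replace (q * - (16 * l))%C with (- (16 * (q * l)))%C by ring. rewrite e.
    pose proof (theta_tsum_3 q hq) as H4.
    rewrite PS_theta_tsum, !PS_tsum in H4 by (auto; lia). rewrite PS_theta_tsum by (auto; lia).
    rewrite Efun_S1, Pfun_S1, Qfun_S3 by exact hq.
    change (2 * 2 ^ 1)%Z with 4%Z in H4. change (2 * 2 ^ 3)%Z with 16%Z in *.
    change (2 * 2 ^ 5)%Z with 64%Z in H4. cbn [Z.opp] in *.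
    fold (S1 q) (S3 q) (S5 q) (S1 (q ^ 2)) (S3 (q ^ 2)) (S5 (q ^ 2)) (DS3 q) (DS3 (q ^ 2)) in H4.
    fold (DS3 q) (DS3 (q ^ 2)).
    pose proof (weight_6_relation q hq) as H6.
    assert (D1 : DS1 q = ((5 * S3 q + S1 q - 12 * S1 q ^ 2) / 6)%C) by (rewrite <- DS1_eq by exact hq; field).
    assert (D1' : DS1 (q ^ 2) = ((5 * S3 (q ^ 2) + S1 (q ^ 2) - 12 * S1 (q ^ 2) ^ 2) / 6)%C)
      by (rewrite <- DS1_eq by exact hq2; field).
    assert (D3 : DS3 q = ((21 * S5 q + 10 * S3 q - S1 q - 240 * (S1 q * S3 q)) / 30)%C)
      by (rewrite <- DS3_eq by exact hq; field).
    assert (D3' : DS3 (q ^ 2) = ((21 * S5 (q ^ 2) + 10 * S3 (q ^ 2) - S1 (q ^ 2) - 240 * (S1 (q ^ 2) * S3 (q ^ 2))) / 30)%C)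
      by (rewrite <- DS3_eq by exact hq2; field).
    rewrite D1, D1', D3, D3' in *. rewrite (weight_4_relation q hq) in *.
    clear D1 D1' D3 D3'.
    apply Ceq_minus. apply Ceq_minus in H4, H6.
    (* 28 and -32 eliminate [S5 q] and [S5 (q ^ 2)]. *)
    match type of H4 with (?u = _) => match type of H6 with (?w = _) =>
      transitivity (28 * u - 32 * w)%C; [field|rewrite H4, H6; ring] end end.
Qed.

(** * Uniqueness for the singular system *)

(** The exponent 4 in the vanishing order must beat the factor 3 in the
    differential inequality, since the origin is a regular singular point. *)
Lemma singular_gronwall (g g' : R -> R) (B K : R) : 0 <= B ->
  (forall r, 0 < r <= 1 -> is_derive g r (g' r)) -> (forall r, 0 < r <= 1 -> 0 <= g r) ->
  (forall r, 0 < r <= 1 -> r * g' r <= (3 + B * r) * g r) ->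
  (forall r, 0 < r <= 1 -> g r <= K * r ^ 4) -> g 1 = 0.
Proof.
  intros hB hd h0 hle hK.
  (* [r^3 exp (B r)] solves the case of equality, so the quotient [h] does not increase; the
     fourth-order bound on [g] makes it small near 0. *)
  set (h := fun r => g r * (exp (- (B * r)) / r ^ 3)).
  set (h' := fun r => g' r * (exp (- (B * r)) / r ^ 3) +
    g r * (- B * exp (- (B * r)) / r ^ 3 - 3 * exp (- (B * r)) / r ^ 4)).
  assert (hd' : forall r, 0 < r <= 1 -> is_derive h r (h' r)).
  { intros r hr. unfold h, h'.
    apply (is_derive_mult (K := R_AbsRing) g (fun r => exp (- (B * r)) / r ^ 3) r (g' r)).
    - now apply hd.
    - auto_derive.
      + assert (0 < r ^ 3) by (apply pow_lt; lra). lra.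
      + field. lra.
    - intros; apply Rmult_comm. }
  assert (neg : forall r, 0 < r <= 1 -> h' r <= 0).
  { intros r hr. unfold h'.
    replace (g' r * (exp (- (B * r)) / r ^ 3) + g r * (- B * exp (- (B * r)) / r ^ 3 - 3 * exp (- (B * r)) / r ^ 4))
      with (exp (- (B * r)) / r ^ 4 * (r * g' r - (3 + B * r) * g r)) by (field; lra).
    assert (0 < exp (- (B * r)) / r ^ 4) by (apply Rdiv_lt_0_compat; [apply exp_pos|apply pow_lt; lra]).
    specialize (hle r hr). nra. }
  assert (dec : forall r, 0 < r < 1 -> h 1 <= h r).
  { intros r hr. destruct (MVT_gen h r 1 h') as [c [hc E]].
    - rewrite Rmin_left, Rmax_right by lra. intros t ht. apply hd'. lra.
    - rewrite Rmin_left, Rmax_right by lra. intros t ht. apply continuity_pt_filterlim.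
      apply (ex_derive_continuous h). eexists. apply hd'. lra.
    - rewrite Rmin_left, Rmax_right in hc by lra. specialize (neg c ltac:(lra)). nra. }
  assert (small : forall r, 0 < r < 1 -> h 1 <= Rabs K * r).
  { intros r hr. eapply Rle_trans; [now apply dec|]. unfold h.
    assert (p3 : 0 < r ^ 3) by (apply pow_lt; lra).
    assert (e1 : exp (- (B * r)) <= 1).
    { rewrite <- exp_0. destruct (Req_dec (B * r) 0) as [e|e]; [rewrite e, Ropp_0; lra|].
      left. apply exp_increasing. assert (0 <= B * r) by (apply Rmult_le_pos; lra). lra. }
    pose proof (exp_pos (- (B * r))).
    assert (g1 : g r <= Rabs K * r ^ 4).
    { eapply Rle_trans; [apply hK; lra|]. apply Rmult_le_compat_r; [apply pow_le; lra|apply Rle_abs]. }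
    apply Rle_trans with (Rabs K * r ^ 4 * (1 / r ^ 3)); [|right; field; lra].
    apply Rmult_le_compat; [apply h0; lra| |exact g1|].
    - apply Rdiv_le_0_compat; lra.
    - apply Rmult_le_compat_r; [left; now apply Rinv_0_lt_compat|exact e1]. }
  assert (h1 : h 1 <= 0).
  { apply Rnot_lt_le. intro hp. pose proof (Rabs_pos K).
    set (r := Rmin (1 / 2) (h 1 / 2 / (Rabs K + 1))).
    assert (l1 : r <= 1 / 2) by apply Rmin_l.
    assert (l2 : r <= h 1 / 2 / (Rabs K + 1)) by apply Rmin_r.
    assert (l3 : 0 < r) by (apply Rmin_glb_lt; [lra|]; apply Rdiv_lt_0_compat; lra).
    specialize (small r ltac:(lra)).
    assert ((Rabs K + 1) * r <= h 1 / 2).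
    { apply Rle_trans with ((Rabs K + 1) * (h 1 / 2 / (Rabs K + 1))); [apply Rmult_le_compat_l; lra|].
      right. field. lra. }
    lra. }
  unfold h in h1. pose proof (exp_pos (- (B * 1))). specialize (h0 1 ltac:(lra)).
  replace (exp (- (B * 1)) / 1 ^ 3) with (exp (- (B * 1))) in h1 by field. nra.
Qed.

Definition ip (a b : C) : R := Re a * Re b + Im a * Im b.

Lemma ip_add a b c : ip a (b + c)%C = ip a b + ip a c.
Proof. unfold ip, Re, Im. cbn. ring. Qed.

Lemma ip_bound a m b : ip a (m * b)%C <= Cmod m * ((Cmod a ^ 2 + Cmod b ^ 2) / 2).
Proof.
  assert (H : ip a (m * b)%C <= Cmod a * Cmod (m * b)%C).
  { eapply Rle_trans; [apply Rle_abs|]. unfold ip.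
    replace (Re a * Re (m * b)%C + Im a * Im (m * b)%C) with (Re (Cconj a * (m * b))%C)
      by (unfold Re, Im; cbn; ring).
    eapply Rle_trans; [apply re_le_Cmod|]. rewrite Cmod_mult, Cmod_conj. lra. }
  rewrite Cmod_mult in H. pose proof (Cmod_ge_0 a). pose proof (Cmod_ge_0 b). pose proof (Cmod_ge_0 m).
  pose proof (Rle_0_sqr (Cmod a - Cmod b)). unfold Rsqr in *.
  eapply Rle_trans; [exact H|].
  replace (Cmod a * (Cmod m * Cmod b)) with (Cmod m * (Cmod a * Cmod b)) by ring.
  apply Rmult_le_compat_l; [lra|]. nra.
Qed.

(** The matrix is the linearization at (1,1,1) of
    [((p^2 - k)/4, (e p - k)/2, k (p - e))]; its symmetric part is at most 3/2. *)
Lemma linearized_bound (a b c m11 m12 m13 m21 m22 m23 m31 m32 m33 : C) (eta : R) :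
  Cmod m11 <= eta -> Cmod m12 <= eta -> Cmod m13 <= eta -> Cmod m21 <= eta -> Cmod m22 <= eta ->
  Cmod m23 <= eta -> Cmod m31 <= eta -> Cmod m32 <= eta -> Cmod m33 <= eta ->
  2 * (ip a (RtoC (1/2) * a + RtoC (-1/4) * c + (m11 * a + m12 * b + m13 * c))%C
     + ip b (RtoC (1/2) * a + RtoC (1/2) * b + RtoC (-1/2) * c + (m21 * a + m22 * b + m23 * c))%C
     + ip c (a + RtoC (-1) * b + (m31 * a + m32 * b + m33 * c))%C)
  <= (3 + 6 * eta) * (Cmod a ^ 2 + Cmod b ^ 2 + Cmod c ^ 2).
Proof.
  intros h11 h12 h13 h21 h22 h23 h31 h32 h33.
  rewrite !ip_add.
  (* Each variable occurs in three entries by row and three by column, so the nine errors give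
     [3 * eta] for it, doubled by the outer factor 2. *)
  assert (T : forall u m v, Cmod m <= eta -> ip u (m * v)%C <= eta * ((Cmod u ^ 2 + Cmod v ^ 2) / 2)).
  { intros u m v h. eapply Rle_trans; [apply ip_bound|]. apply Rmult_le_compat_r; [|exact h].
    pose proof (pow2_ge_0 (Cmod u)). pose proof (pow2_ge_0 (Cmod v)). lra. }
  pose proof (T a m11 a h11). pose proof (T a m12 b h12). pose proof (T a m13 c h13).
  pose proof (T b m21 a h21). pose proof (T b m22 b h22). pose proof (T b m23 c h23).
  pose proof (T c m31 a h31). pose proof (T c m32 b h32). pose proof (T c m33 c h33).
  assert (Q : forall x y z : R, 2 * (x * (1/2 * x) + x * (-1/4 * z) + (y * (1/2 * x) + y * (1/2 * y) + y * (-1/2 * z))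
    + (z * x + z * (-1 * y))) <= 3 * (x ^ 2 + y ^ 2 + z ^ 2)).
  { clear. intros x y z.
    (* The right side minus the left is [(x - y/2)^2 + (x - 3/4 z)^2 + 3/2 (y + z)^2] plus
       nonnegative multiples of [y^2] and [z^2]. *)
    pose proof (pow2_ge_0 (x - y / 2)). pose proof (pow2_ge_0 (x - 3 / 4 * z)). pose proof (pow2_ge_0 (y + z)).
    pose proof (pow2_ge_0 x). pose proof (pow2_ge_0 y). pose proof (pow2_ge_0 z).
    nra. }
  pose proof (Q (Re a) (Re b) (Re c)) as Q1. pose proof (Q (Im a) (Im b) (Im c)) as Q2.
  assert (E : forall r u v, ip u (RtoC r * v)%C = Re u * (r * Re v) + Im u * (r * Im v)).
  { intros r u v. unfold ip, Re, Im. cbn. ring. }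
  rewrite !E. assert (E' : ip c a = Re c * Re a + Im c * Im a) by reflexivity. rewrite E'.
  rewrite (Cmod2_alt a), (Cmod2_alt b), (Cmod2_alt c) in *. nra.
Qed.

(** * The hypergeometric solution of the system *)

(** [pz], [ez] and [kz] are the three right-hand sides of the theorem. Writing [x (1 - x) z'] as
    [Yf] lets [cder_Yf] differentiate [pz] without a second derivative of [zf]. *)
Definition pz (t : C) : C := (zf t ^ 2 * (1 - t) + 4 * (zf t * Yf t))%C.
Definition ez (t : C) : C := (zf t ^ 2 * (1 + t))%C.
Definition kz (t : C) : C := (zf t ^ 4 * (1 - t) ^ 2)%C.

Lemma cder_pz t : Cmod t < 1 ->
  exists l, cder pz t l /\ (t * l = ef t * ((pz t ^ 2 - kz t) / 4))%C.
Proof.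
  intros ht. pose proof (zf_nz t ht). pose proof (one_minus_nz t ht).
  pose proof (cder_zf t ht) as hz. pose proof (cder_Yf t ht) as hY.
  eexists. split.
  - apply cder_add; [apply cder_mul; [apply cder_sqr; exact hz|apply cder_one_minus]|].
    apply cder_mul; [apply cder_const|]. apply cder_mul; [exact hz|exact hY].
  - cbv beta. rewrite ef_eq by exact ht. unfold pz, kz, Yf. field. auto.
Qed.

Lemma cder_ez t : Cmod t < 1 ->
  exists l, cder ez t l /\ (t * l = ef t * ((ez t * pz t - kz t) / 2))%C.
Proof.
  intros ht. pose proof (zf_nz t ht). pose proof (one_minus_nz t ht).
  pose proof (cder_zf t ht) as hz.
  eexists. split.
  - apply cder_mul; [apply cder_sqr; exact hz|]. apply cder_add; [apply cder_const|apply cder_id].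
  - cbv beta. rewrite ef_eq by exact ht. unfold pz, kz, ez, Yf. field. auto.
Qed.

Lemma cder_kz t : Cmod t < 1 ->
  exists l, cder kz t l /\ (t * l = ef t * (kz t * (pz t - ez t)))%C.
Proof.
  intros ht. pose proof (zf_nz t ht). pose proof (one_minus_nz t ht).
  pose proof (cder_zf t ht) as hz.
  eexists. split.
  - apply cder_ext with (fun t => (zf t ^ 2) ^ 2 * (1 - t) ^ 2)%C; [intros y; unfold kz; ring|].
    apply cder_mul; apply cder_sqr; [apply cder_sqr; exact hz|apply cder_one_minus].
  - cbv beta. rewrite ef_eq by exact ht. unfold pz, kz, ez, Yf. field. auto.
Qed.

(** * Comparison of the two solutions *)

Section Uniqueness.
(** Discharged by [Cmod_nome_lt_1]; as a hypothesis it keeps the comparison independent of the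
    branch [F]. *)
Hypothesis nome_lt : forall t, Cmod t < 1 -> Cmod (nome t) < 1.

Let P t := Pfun (nome t).
Let E t := Efun (nome t).
Let Q t := Qfun (nome t).

(** Since [t] times the derivative of [nome] is [ef t * nome t], the operator [q d/dq] becomes
    [t d/dt] divided by [ef]. *)
Lemma cder_comp_nome f t w : Cmod t < 1 ->
  (exists l, cder f (nome t) l /\ (nome t * l = w)%C) ->
  exists l, cder (fun t => f (nome t)) t l /\ (t * l = ef t * w)%C.
Proof.
  intros ht (l & hl & <-). eexists. split.
  - apply (cder_comp f nome); [now apply cder_nome|exact hl].
  - unfold nome, Cdiv. ring.
Qed.

Lemma cder_P t : Cmod t < 1 -> exists l, cder P t l /\ (t * l = ef t * ((P t ^ 2 - Q t) / 4))%C.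
Proof. intros ht. apply cder_comp_nome; [exact ht|]. now apply cder_Pfun, nome_lt. Qed.

Lemma cder_E t : Cmod t < 1 -> exists l, cder E t l /\ (t * l = ef t * ((E t * P t - Q t) / 2))%C.
Proof. intros ht. apply cder_comp_nome; [exact ht|]. now apply cder_Efun, nome_lt. Qed.

Lemma cder_Q t : Cmod t < 1 -> exists l, cder Q t l /\ (t * l = ef t * (Q t * (P t - E t)))%C.
Proof. intros ht. apply cder_comp_nome; [exact ht|]. now apply cder_Qfun, nome_lt. Qed.

Variable rho : R.
Hypothesis hrho : 0 <= rho < 1.

Lemma jet_cast f f0 f1 g0 g1 : f0 = g0 -> f1 = g1 -> jet rho f f0 f1 -> jet rho f g0 g1.
Proof. now intros <- <-. Qed.

Lemma zc_1 : zc 1 = (/ 4)%C.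
Proof. unfold zc. rewrite <- RtoC_inv by lra. f_equal. cbn. field. Qed.

Lemma jet_zf : jet rho zf 1%C (/ 4)%C.
Proof.
  apply (jet_cast _ (zc 0) (zc 1)); [reflexivity|apply zc_1|]. apply jet_PS with 1; [apply good_zc|exact hrho].
Qed.

Lemma jet_one_minus : jet rho (fun t => 1 - t)%C 1%C (- (1))%C.
Proof.
  apply (jet_ext rho (fun t => 1 + (- (1)) * t)%C _ (1 + (- (1)) * 0)%C (0 + (- (1)) * 1)%C);
    [intros; ring|ring|ring|]. apply jet_add; [apply jet_const|apply jet_scal, jet_id].
Qed.

Lemma jet_Yf : jet rho Yf 0%C (/ 4)%C.
Proof.
  eapply jet_cast; [| |apply jet_mul; [apply jet_mul; [apply jet_id|apply jet_one_minus]|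
    apply (jet_PS 1 (dcoef zc)); [apply good_dcoef, good_zc|exact hrho]]].
  - ring.
  - unfold dcoef at 2. rewrite zc_1. simpl INR. ring.
Qed.

Lemma jet_sqr f f0 f1 : jet rho f f0 f1 -> jet rho (fun t => f t ^ 2)%C (f0 ^ 2)%C (2 * f0 * f1)%C.
Proof.
  intros h. eapply jet_ext; [| | |apply jet_mul; exact h]; intros; cbv beta; ring.
Qed.

Lemma jet_pz : jet rho pz 1%C (/ 2)%C.
Proof.
  eapply jet_cast; [| |apply jet_add; [apply jet_mul; [apply jet_sqr, jet_zf|apply jet_one_minus]|
    apply jet_scal, jet_mul; [apply jet_zf|apply jet_Yf]]]; field.
Qed.

Lemma jet_ez : jet rho ez 1%C (3 / 2)%C.
Proof.
  eapply jet_cast; [| |apply jet_mul; [apply jet_sqr, jet_zf|apply jet_add; [apply jet_const|apply jet_id]]]; field.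
Qed.

Lemma jet_kz : jet rho kz 1%C (- (1))%C.
Proof.
  eapply (jet_ext rho (fun t => (zf t ^ 2) ^ 2 * (1 - t) ^ 2)%C);
    [| | |apply jet_mul; apply jet_sqr; [apply jet_sqr, jet_zf|apply jet_one_minus]];
    [intros; unfold kz; ring|field|field].
Qed.

Lemma jet_ef : jet rho ef 1%C (RtoC (ecoef 1)).
Proof. apply (jet_PS 1 _ rho good_ecoef hrho). Qed.

Lemma jet_nome : jet rho nome 0%C (/ 16)%C.
Proof.
  destruct (jet_near _ _ _ _ (jet_PS 1 _ rho good_scoef hrho)) as [B [hB HB]].
  apply jet_intro with (/ 16 * ((1 + 4 * exp (B * rho) * (B * rho)) * B)). intros t ht. specialize (HB t ht).
  change (PS (fun n => RtoC (scoef n)) t) with (sf t) in HB. cbn [scoef] in HB.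
  replace (sf t - 0)%C with (sf t) in HB by ring.
  unfold nome. replace (t / 16 * Cexp (sf t) - 0 - / 16 * t)%C with (/ 16 * (t * (Cexp (sf t) - 1)))%C by field.
  pose proof (Cmod_ge_0 t) as pt.
  assert (hb : Cmod (sf t) <= B * rho) by (eapply Rle_trans; [exact HB|]; apply Rmult_le_compat_l; lra).
  pose proof (Cexp_sub_1_le _ _ hb) as hE.
  rewrite !Cmod_mult. rewrite <- RtoC_inv, Cmod_R, Rabs_pos_eq by lra.
  pose proof (exp_pos (B * rho)) as pe.
  set (L := 1 + 4 * exp (B * rho) * (B * rho)) in *.
  assert (hL : 0 <= L).
  { assert (0 <= exp (B * rho) * (B * rho)) by (apply Rmult_le_pos; [lra|apply Rmult_le_pos; lra]).
    unfold L. lra. }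
  assert (h2 : Cmod (Cexp (sf t) - 1)%C <= L * (B * Cmod t)).
  { eapply Rle_trans; [exact hE|]. apply Rmult_le_compat_l; lra. }
  assert (h3 : Cmod t * Cmod (Cexp (sf t) - 1)%C <= Cmod t * (L * (B * Cmod t)))
    by (apply Rmult_le_compat_l; assumption).
  replace (/ 16 * (L * B) * Cmod t ^ 2) with (/ 16 * (Cmod t * (L * (B * Cmod t)))) by ring.
  apply Rmult_le_compat_l; lra.
Qed.

(** The constant 16 matters here: the factors 8, 24 and -16 of [Pfun], [Efun] and [Qfun] give linear
    coefficients 1/2, 3/2 and -1, those of [pz], [ez] and [kz]. *)
Lemma jet_PS_nome f : good 1 (zcoef f) -> f O = 0%Z -> f 1%nat = 1%Z ->
  jet rho (fun t => PS (zcoef f) (nome t)) 0%C (/ 16)%C.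
Proof.
  intros hf f0 f1.
  apply (jet_cast _ (zcoef f 0) (zcoef f 1 * / 16)%C).
  - unfold zcoef. now rewrite f0.
  - unfold zcoef. rewrite f1. ring.
  - apply jet_PS_comp with 1 (Cmod (nome (RtoC rho))).
    + exact hf.
    + split; [apply Cmod_ge_0|]. apply nome_lt. rewrite Cmod_R, Rabs_pos_eq; lra.
    + apply jet_nome.
    + intros t ht. apply nome_mono; lra.
Qed.

Lemma jet_P : jet rho P 1%C (/ 2)%C.
Proof.
  eapply (jet_ext rho (fun t => 1 + 8 * PS (zcoef (tsum 1)) (nome t))%C).
  4: apply jet_add; [apply jet_const|apply jet_scal, jet_PS_nome; [apply good_tsum; lia|reflexivity|reflexivity]].
  - intros t ht. symmetry. apply Pfun_PS, nome_lt. lra.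
  - ring.
  - field.
Qed.

Lemma jet_E : jet rho E 1%C (3 / 2)%C.
Proof.
  eapply (jet_ext rho (fun t => 1 + 24 * PS (zcoef (sigma_hat 1)) (nome t))%C).
  4: apply jet_add; [apply jet_const|apply jet_scal, jet_PS_nome; [apply good_hat|reflexivity|reflexivity]].
  - intros t ht. symmetry. apply Efun_PS, nome_lt. lra.
  - ring.
  - field.
Qed.

Lemma jet_Q : jet rho Q 1%C (- (1))%C.
Proof.
  eapply (jet_ext rho (fun t => 1 + (- (16)) * PS (zcoef (tsum 3)) (nome t))%C).
  4: apply jet_add; [apply jet_const|apply jet_scal, jet_PS_nome; [apply good_tsum; lia|reflexivity|reflexivity]].
  - intros t ht. unfold Q. rewrite Qfun_PS by (apply nome_lt; lra). ring.
  - ring.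
  - field.
Qed.

Lemma jet_eq_diff f g f0 f1 : jet rho f f0 f1 -> jet rho g f0 f1 ->
  exists K, 0 <= K /\ forall t, Cmod t <= rho -> Cmod (f t - g t)%C <= K * Cmod t ^ 2.
Proof.
  intros [K [hK H]] [K' [hK' H']]. exists (K + K'). split; [lra|]. intros t ht.
  specialize (H t ht). specialize (H' t ht).
  replace (f t - g t)%C with ((f t - f0 - f1 * t) + - (g t - f0 - f1 * t))%C by ring.
  eapply Rle_trans; [apply Cmod_triangle|]. rewrite Cmod_opp. lra.
Qed.

Lemma near_ef_mul f f1 : jet rho f 1%C f1 ->
  exists K, 0 <= K /\ forall t, Cmod t <= rho -> Cmod (ef t * f t - 1)%C <= K * Cmod t.
Proof.
  intros h. destruct (jet_near _ _ _ _ (jet_mul _ _ _ _ _ _ _ jet_ef h)) as [K [hK H]].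
  exists K. split; [exact hK|]. intros t ht. specialize (H t ht). now rewrite Cmult_1_r in H.
Qed.

Variable x : C.
Hypothesis hx : Cmod x <= rho.

Let D1 t := (pz t - P t)%C.
Let D2 t := (ez t - E t)%C.
Let D3 t := (kz t - Q t)%C.

(** Factoring the differences of the quadratic right-hand sides gives a linear system for [D1],
    [D2], [D3] whose coefficients, such as [ef (pz + P) / 4], differ by O(t) from their values at 0.
    Those values form the matrix of [linearized_bound], and [B * r] bounds every entry of the
    remainder. *)
Lemma system_difference : exists B, 0 <= B /\ forall t r, Cmod t <= rho -> Cmod t <= r ->
  exists l1 l2 l3, cder D1 t l1 /\ cder D2 t l2 /\ cder D3 t l3 /\
  2 * (ip (D1 t) (t * l1)%C + ip (D2 t) (t * l2)%C + ip (D3 t) (t * l3)%C) <=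
  (3 + B * r) * (Cmod (D1 t) ^ 2 + Cmod (D2 t) ^ 2 + Cmod (D3 t) ^ 2).
Proof.
  destruct (jet_near _ _ _ _ jet_ef) as [K0 [k0 H0]].
  destruct (near_ef_mul _ _ jet_pz) as [K1 [k1 H1]]. destruct (near_ef_mul _ _ jet_P) as [K2 [k2 H2]].
  destruct (near_ef_mul _ _ jet_ez) as [K3 [k3 H3]]. destruct (near_ef_mul _ _ jet_E) as [K4 [k4 H4]].
  destruct (near_ef_mul _ _ jet_kz) as [K5 [k5 H5]].
  set (B := K0 + K1 + K2 + K3 + K4 + K5).
  exists (6 * B). split; [unfold B; lra|]. intros t r ht hr.
  pose proof (Cmod_ge_0 t) as pt. assert (ht1 : Cmod t < 1) by lra.
  specialize (H0 t ht). specialize (H1 t ht). specialize (H2 t ht).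
  specialize (H3 t ht). specialize (H4 t ht). specialize (H5 t ht).
  destruct (cder_pz t ht1) as (a1 & c1 & e1). destruct (cder_P t ht1) as (b1 & d1 & f1).
  destruct (cder_ez t ht1) as (a2 & c2 & e2). destruct (cder_E t ht1) as (b2 & d2 & f2).
  destruct (cder_kz t ht1) as (a3 & c3 & e3). destruct (cder_Q t ht1) as (b3 & d3 & f3).
  exists (a1 - b1)%C, (a2 - b2)%C, (a3 - b3)%C. repeat split; try (now apply cder_sub).
  assert (M : forall K, 0 <= K -> K <= B -> K * Cmod t <= B * r)
    by (intros K h h'; apply Rmult_le_compat; assumption).
  assert (half : forall (c : R) u, 0 <= c <= 1 -> Cmod u <= B * r -> Cmod (RtoC c * u)%C <= B * r).
  { intros c u hc hu. rewrite Cmod_mult, Cmod_R, Rabs_pos_eq by lra. pose proof (Cmod_ge_0 u). nra. }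
  assert (neg : forall u, Cmod u <= B * r -> Cmod (- u)%C <= B * r) by (intros u; now rewrite Cmod_opp).
  assert (Z : 0 <= B * r) by (apply Rmult_le_pos; [unfold B; lra|lra]).
  set (P' := (ef t * P t - 1)%C) in *. set (E' := (ef t * E t - 1)%C) in *.
  set (p' := (ef t * pz t - 1)%C) in *. set (e' := (ef t * ez t - 1)%C) in *.
  set (k' := (ef t * kz t - 1)%C) in *. set (m' := (ef t - 1)%C) in *.
  replace ((3 + 6 * B * r)) with (3 + 6 * (B * r)) by ring.
  replace (t * (a1 - b1))%C with (RtoC (1/2) * D1 t + RtoC (-1/4) * D3 t +
    (RtoC (1/4) * (p' + P') * D1 t + 0 * D2 t + - (RtoC (1/4) * m') * D3 t))%C.
  2:{ transitivity (t * a1 - t * b1)%C; [|ring]. rewrite e1, f1.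
      unfold D1, D2, D3, p', P', m'. rewrite !RtoC_div by lra. field. }
  replace (t * (a2 - b2))%C with (RtoC (1/2) * D1 t + RtoC (1/2) * D2 t + RtoC (-1/2) * D3 t +
    (RtoC (1/2) * e' * D1 t + RtoC (1/2) * P' * D2 t + - (RtoC (1/2) * m') * D3 t))%C.
  2:{ transitivity (t * a2 - t * b2)%C; [|ring]. rewrite e2, f2.
      unfold D1, D2, D3, e', P', m'. rewrite !RtoC_div by lra. field. }
  replace (t * (a3 - b3))%C with (D1 t + RtoC (-1) * D2 t +
    (k' * D1 t + - k' * D2 t + (P' + - E') * D3 t))%C.
  2:{ transitivity (t * a3 - t * b3)%C; [|ring]. rewrite e3, f3.
      unfold D1, D2, D3, k', P', E'. ring. }
  apply linearized_bound.
  - apply half; [lra|]. eapply Rle_trans; [apply Cmod_triangle|].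
    apply Rle_trans with ((K1 + K2) * Cmod t); [lra|]. apply M; unfold B; lra.
  - rewrite Cmod_0. exact Z.
  - apply neg, half; [lra|]. eapply Rle_trans; [exact H0|]. apply M; unfold B; lra.
  - apply half; [lra|]. eapply Rle_trans; [exact H3|]. apply M; unfold B; lra.
  - apply half; [lra|]. eapply Rle_trans; [exact H2|]. apply M; unfold B; lra.
  - apply neg, half; [lra|]. eapply Rle_trans; [exact H0|]. apply M; unfold B; lra.
  - eapply Rle_trans; [exact H5|]. apply M; unfold B; lra.
  - apply neg. eapply Rle_trans; [exact H5|]. apply M; unfold B; lra.
  - eapply Rle_trans; [apply Cmod_triangle|]. rewrite Cmod_opp.
    apply Rle_trans with ((K2 + K4) * Cmod t); [lra|]. apply M; unfold B; lra.
Qed.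

(** The squared distance of the solutions along the ray is O(r^4), because their first-order
    expansions coincide; this is the order that [singular_gronwall] requires. *)
Lemma system_unique : pz x = P x /\ ez x = E x /\ kz x = Q x.
Proof.
  destruct system_difference as [B [hB HB]].
  destruct (jet_eq_diff _ _ _ _ jet_pz jet_P) as [K1 [k1 H1]].
  destruct (jet_eq_diff _ _ _ _ jet_ez jet_E) as [K2 [k2 H2]].
  destruct (jet_eq_diff _ _ _ _ jet_kz jet_Q) as [K3 [k3 H3]].
  (* The summand 0 keeps the parametrization in the form [a + r b] of [cder_line]. *)
  set (c := fun r : R => (0 + RtoC r * x)%C).
  assert (hc : forall r, 0 < r <= 1 -> Cmod (c r) <= r /\ Cmod (c r) <= rho).
  { intros r hr. unfold c. replace (0 + RtoC r * x)%C with (RtoC r * x)%C by ring.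
    rewrite Cmod_mult, Cmod_R, Rabs_pos_eq by lra. pose proof (Cmod_ge_0 x). split; nra. }
  set (sq := fun D : C -> C => fun r : R => Re (D (c r)) ^ 2 + Im (D (c r)) ^ 2).
  set (dsq := fun D : C -> C => fun r : R => 2 * ip (D (c r)) (C_derive D (c r) * x)%C).
  assert (hsq : forall D r l, cder D (c r) l -> is_derive (sq D) r (dsq D r)).
  { intros D r l h. rewrite <- (cder_C_derive _ _ _ h) in h.
    destruct (cder_line D 0%C x r _ h) as [h1 h2].
    unfold sq, dsq, ip.
    replace (2 * (Re (D (c r)) * Re (C_derive D (c r) * x)%C + Im (D (c r)) * Im (C_derive D (c r) * x)%C))
      with (INR 2 * Re (C_derive D (c r) * x)%C * Re (D (c r)) ^ pred 2 +
            INR 2 * Im (C_derive D (c r) * x)%C * Im (D (c r)) ^ pred 2) by (simpl; ring).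
    apply (is_derive_plus (K := R_AbsRing) (V := R_NormedModule)).
    - apply (is_derive_pow (fun r => Re (D (c r))) 2 r). exact h1.
    - apply (is_derive_pow (fun r => Im (D (c r))) 2 r). exact h2. }
  assert (G : sq D1 1 + sq D2 1 + sq D3 1 = 0).
  { apply (singular_gronwall (fun r => sq D1 r + sq D2 r + sq D3 r)
      (fun r => dsq D1 r + dsq D2 r + dsq D3 r) B (K1 ^ 2 + K2 ^ 2 + K3 ^ 2)).
    - exact hB.
    - intros r hr. destruct (hc r hr) as [h1 h2].
      destruct (HB (c r) r h2 h1) as (l1 & l2 & l3 & c1 & c2 & c3 & _).
      apply (is_derive_plus (K := R_AbsRing) (V := R_NormedModule) (fun r => sq D1 r + sq D2 r)).
      + apply (is_derive_plus (K := R_AbsRing) (V := R_NormedModule)); eapply hsq; eassumption.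
      + eapply hsq; eassumption.
    - intros r _. unfold sq. repeat apply Rplus_le_le_0_compat; apply pow2_ge_0.
    - intros r hr. destruct (hc r hr) as [h1 h2].
      destruct (HB (c r) r h2 h1) as (l1 & l2 & l3 & c1 & c2 & c3 & H).
      unfold dsq, sq. rewrite <- !Cmod2_alt.
      rewrite (cder_C_derive _ _ _ c1), (cder_C_derive _ _ _ c2), (cder_C_derive _ _ _ c3).
      eapply Rle_trans; [|exact H]. right.
      assert (S : forall u l, r * (2 * ip u (l * x)%C) = 2 * ip u (c r * l)%C).
      { intros u l. unfold ip, c, Re, Im. cbn. ring. }
      rewrite !Rmult_plus_distr_l, !S. ring.
    - intros r hr. destruct (hc r hr) as [h1 h2]. unfold sq. rewrite <- !Cmod2_alt.
      pose proof (Cmod_ge_0 (c r)) as pc.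
      assert (S : forall u K, 0 <= K -> Cmod u <= K * Cmod (c r) ^ 2 -> Cmod u ^ 2 <= K ^ 2 * r ^ 4).
      { intros u K hK hu. replace (K ^ 2 * r ^ 4) with ((K * r ^ 2) ^ 2) by ring.
        apply pow_incr. split; [apply Cmod_ge_0|]. eapply Rle_trans; [exact hu|].
        apply Rmult_le_compat_l; [exact hK|]. apply pow_incr. lra. }
      pose proof (S _ _ k1 (H1 _ h2)). pose proof (S _ _ k2 (H2 _ h2)). pose proof (S _ _ k3 (H3 _ h2)).
      unfold D1, D2, D3. lra. }
  unfold sq in G. rewrite <- !Cmod2_alt in G.
  assert (e : c 1 = x) by (unfold c; ring). rewrite e in G.
  pose proof (pow2_ge_0 (Cmod (D1 x))). pose proof (pow2_ge_0 (Cmod (D2 x))). pose proof (pow2_ge_0 (Cmod (D3 x))).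
  assert (Z : forall u, Cmod u ^ 2 <= 0 -> u = 0%C).
  { intros u h. apply Cmod_eq_0. pose proof (Cmod_ge_0 u). nra. }
  repeat split; apply Ceq_minus; apply Z; unfold D1, D2, D3 in *; lra.
Qed.
End Uniqueness.

Theorem theorem2p2
  (F : C -> C) (hF : hyp2F1_principal_branch (1 / 2)%C (1 / 2)%C 1%C F)
  (x : C) (hx : (0 < Cmod x < 1)%R)
  (v : C) (hv : branch_value F (1 - x)%C v) :
  let z : C := hyp2F1 (1 / 2)%C (1 / 2)%C 1%C x in
  let dz : C := C_derive (hyp2F1 (1 / 2)%C (1 / 2)%C 1%C) x in
  let y : C := (PI * (v / z))%C in
  let q : C := Cexp (- y)%C in
  (Cmod q < 1)%R /\
  Pfun q = (z ^ 2 * (1 - x) + 4 * x * (1 - x) * z * dz)%C /\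
  Efun q = (z ^ 2 * (1 + x))%C /\
  Qfun q = (z ^ 4 * (1 - x) ^ 2)%C.
Proof.
  intros z dz y q.
  assert (hx1 : Cmod x < 1) by apply hx.
  pose proof (Cmod_nome_lt_1 F hF) as hn.
  assert (hz : z = zf x) by (unfold z; now rewrite hyp2F1_zf).
  assert (hdz : dz = zf' x) by (unfold dz; rewrite hyp2F1_zf; now apply cder_C_derive, cder_zf).
  assert (hq : q = nome x).
  { unfold q, y. rewrite hz. now apply (branch_value_nome F hF). }
  destruct (system_unique hn (Cmod x) (conj (Cmod_ge_0 x) hx1) x (Rle_refl _)) as (EP & EE & EQ).
  rewrite hq, hz, hdz, <- EP, <- EE, <- EQ. split; [now apply hn|].
  unfold pz, ez, kz, Yf. repeat split. ring.
Qed.
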